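(* Let $h$ be distributionally integrable on $[a,b]$ and let $\{g_n\}_{n=1}^\infty$ be a monotone sequence of measurable functions on $[a,b]$ that satisfies, for every $n$, $$g_{n+1}(x)\ge g_n(x)\ge h(x)\quad\text{almost everywhere.}$$ Let $g(x)=\lim_{n\to\infty}g_n(x)$. Then $g$ is distributionally integrable over $[a,b]$ if and only if $$\lim_{n\to\infty}(\mathfrak{dist})\int_a^bg_n(x)\,dx<\infty,$$ and if that is the case then $(\mathfrak{dist})\int_a^bg_n(x)\,dx\to(\mathfrak{dist})\int_a^bg(x)\,dx$ as $n\to\infty$.
   Context: Infinite integrals. If $k$ is measurable on $[a,b]$ and $k=k_1+k_2$ with $k_1$ distributionally integrable over $[a,b]$ and $k_2\ge0$ a.e. measurable and not distributionally integrable, one writes $(\mathfrak{dist})\int_a^bk(x)\,dx=\infty$. If $k$ is measurable and $k\ge h$ a.e. with $h$ distributionally integrable, then either $k$ is distributionally integrable or $(\mathfrak{dist})\int_a^bk(x)\,dx=\infty$; so $(\mathfrak{dist})\int_a^bg_n(x)\,dx\in\mathbb R\cup\{\infty\}$ is defined for each $n$. Distributions are real. Notation: $\overline{\mathbb R}=\mathbb R\cup\{-\infty,\infty\}$; $\mathcal E'[a,b]$ is the space of distributions on $\mathbb R$ with support contained in $[a,b]$; $\langle \mathsf g(x+ty),\phi(y)\rangle:=|t|^{-1}\langle \mathsf g(y),\phi((y-x)/t)\rangle$ for $t\ne0$. Point values. For $\mathsf g\in\mathcal D'(\mathbb R)$, the distributional (Łojasiewicz) point value $\mathsf g(x_0)$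 exists and equals $\gamma\in\mathbb R$ if $\lim_{\varepsilon\to0}\langle \mathsf g(x_0+\varepsilon y),\phi(y)\rangle=\gamma\int_{-\infty}^\infty\phi(y)\,dy$ for every $\phi\in\mathcal D(\mathbb R)$. A Łojasiewicz distribution is one having a point value at every point of $\mathbb R$. Test classes. $\mathcal T_0$: functions $\phi\in C^\infty(\mathbb R)$, $\phi\ge0$, $\int\phi=1$, such that for some $\alpha<-1$, $\phi^{(m)}(x)=O(|x|^{\alpha-m})$ as $|x|\to\infty$ for all $m\ge0$. $\mathcal T_1$: those $\phi\in\mathcal T_0$ with $x\phi'(x)\le0$ for all $x$. For $\mathsf g\in\mathcal E'(\mathbb R)$, $\phi\in\mathcal T_0$: $\mathsf g^{+}_{\phi,0}(x)=\limsup_{t\to0^+}\langle \mathsf g(x+ty),\phi(y)\rangle$ and $\mathsf g^{-}_{\phi,0}(x)=\liminf_{t\to0^+}\langle \mathsf g(x+ty),\phi(y)\rangle$. Integral. Let $f:[a,b]\to\overline{\mathbb R}$. A major distributional pair $(\mathsf u,\mathsf U)$ for $f$ consists of $\mathsf u\in\mathcal E'[a,b]$ and a Łojasiewicz distribution $\mathsf U$ with $\mathsf U'=\mathsf u$, $\mathsf U(a)=0$, such that there exist a countable set $E$ and a Lebesgue null set $Z$ with $\mathsf u^-_{\phi,0}(x)\ge f(x)$ for all $x\in[a,b]\setminus Z$, $\phi\in\mathcal T_0$, and $\mathsf u^-_{\phi,0}(x)>-\infty$ for all $x\in[a,b]\setminus E$, $\phi\in\mathcal T_1$. A minor distributional pair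 $(\mathsf v,\mathsf V)$ for $f$ consists of $\mathsf v\in\mathcal E'[a,b]$ and a Łojasiewicz distribution $\mathsf V$ with $\mathsf V'=\mathsf v$, $\mathsf V(a)=0$, such that there exist a countable set $E$ and a null set $Z$ with $\mathsf v^+_{\phi,0}(x)\le f(x)$ for all $x\in[a,b]\setminus Z$, $\phi\in\mathcal T_0$, and $\mathsf v^+_{\phi,0}(x)<\infty$ for all $x\in[a,b]\setminus E$, $\phi\in\mathcal T_1$. The function $f$ is distributionally integrable over $[a,b]$ if it has both major and minor pairs and $\sup\mathsf V(b)=\inf\mathsf U(b)$ (sup over minor pairs, inf over major pairs); the common value is $(\mathfrak{dist})\int_a^bf(x)\,dx$. Integrability and the integral do not change if $f$ is modified on a null set; integrable functions are finite almost everywhere. *)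

(* Defs.v *)
From HB Require Import structures.
From mathcomp Require Import all_boot all_order all_algebra.
From mathcomp Require Import all_classical all_reals all_analysis.
From mathcomp Require Import measurable_realfun.

Set Implicit Arguments.
Unset Strict Implicit.
Unset Printing Implicit Defensive.
Import Order.TTheory GRing.Theory Num.Theory.
Import numFieldNormedType.Exports.

Local Open Scope classical_set_scope.
Local Open Scope ring_scope.

Section Distributions.
Context {R : realType}.
Implicit Types (phi psi chi : R -> R) (T u U v V : (R -> R) -> R).
Implicit Types (a b x t c : R).

Definition smooth phi := forall m x, derivable phi^`(m)%classic x 1.

Definition tsupport phi : set R := closure [set x | phi x != 0].

(* The space D(R). *)
Definition test_function phi := smooth phi /\ compact (tsupport phi).

(* A distribution is represented by a functional on all of [R -> R]; for
   elements of D'(R) only its values on D(R) matter.  Continuity is the usual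
   seminorm estimate |T phi| <= C sup_(k <= m) sup_x |phi^(k)(x)| on every
   compact set K; the supremum is expressed through its upper bounds B. *)
Definition distribution T :=
  (forall c phi psi, test_function phi -> test_function psi ->
     T (fun x => c * phi x + psi x) = c * T phi + T psi) /\
  (forall K : set R, compact K -> exists C (m : nat),
     forall phi, test_function phi -> tsupport phi `<=` K ->
     forall B, (forall (k : nat) x, (k <= m)%N -> `|phi^`(k)%classic x| <= B) ->
     `|T phi| <= C * B).

Definition supported_in (F : set R) T :=
  forall phi, test_function phi -> tsupport phi `&` F = set0 -> T phi = 0.

(* The space E'[a, b].  Such a distribution acts on every smooth function;
   the last clause says that its values outside D(R) are those of the
   canonical extension, defined by a cutoff equal to 1 near [a, b]. *)
Definition supported_distribution a b u :=
  [/\ distribution u,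
      supported_in `[a, b] u &
      forall psi chi, smooth psi -> test_function chi ->
        (forall x, x \in `[a, b] -> \forall y \near x, chi y = 1) ->
        u psi = u (fun x => chi x * psi x)].

(* U' = u *)
Definition derivative_of U u :=
  forall phi, test_function phi -> u phi = - U phi^`()%classic.

(* <T(x + t y), phi(y)> *)
Definition dilation T x t phi : R :=
  `|t|^-1 * T (fun y => phi ((y - x) / t)).

(* T has the Lojasiewicz point value c at x. *)
Definition point_value T x c :=
  forall phi, test_function phi ->
    dilation T x e phi @[e --> 0^'] -->
      c * \int[@lebesgue_measure R]_y phi y.

Definition lojasiewicz U :=
  distribution U /\ forall x, exists c, point_value U x c.

Definition test_class0 phi :=
  [/\ smooth phi,
      forall x, 0 <= phi x,
      (\int[@lebesgue_measure R]_x (phi x)%:E = 1)%E &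
      exists2 alpha : R, alpha < -1 &
        forall m : nat, exists C M : R, forall x, M <= `|x| ->
          `|phi^`(m)%classic x| <= C * `|x| `^ (alpha - m%:R)].

Definition test_class1 phi :=
  test_class0 phi /\ forall x, x * phi^`()%classic x <= 0.

Definition upper_value T phi x : \bar R :=
  limf_esup (fun t => (dilation T x t phi)%:E) 0^'+.

Definition lower_value T phi x : \bar R :=
  limf_einf (fun t => (dilation T x t phi)%:E) 0^'+.

End Distributions.

(* Functions on [a, b] are total functions on R; only their values on [a, b]
   are ever used. *)
Section DistributionalIntegral.
Context {R : realType}.
Implicit Types (a b : R) (f k : R -> \bar R).
Local Notation mu := (@lebesgue_measure R).

Definition major_pair a b f (u U : (R -> R) -> R) :=
  [/\ supported_distribution a b u,
      lojasiewicz U,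
      derivative_of U u,
      point_value U a 0 &
      exists E Z : set R,
        [/\ countable E,
            mu.-negligible Z,
            forall x phi, x \in `[a, b] -> ~ Z x -> test_class0 phi ->
              (f x <= lower_value u phi x)%E &
            forall x phi, x \in `[a, b] -> ~ E x -> test_class1 phi ->
              (-oo < lower_value u phi x)%E]].

Definition minor_pair a b f (v V : (R -> R) -> R) :=
  [/\ supported_distribution a b v,
      lojasiewicz V,
      derivative_of V v,
      point_value V a 0 &
      exists E Z : set R,
        [/\ countable E,
            mu.-negligible Z,
            forall x phi, x \in `[a, b] -> ~ Z x -> test_class0 phi ->
              (upper_value v phi x <= f x)%E &
            forall x phi, x \in `[a, b] -> ~ E x -> test_class1 phi ->
              (upper_value v phi x < +oo)%E]].

Definition major_values a b f : set (\bar R) :=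
  [set c%:E | c in [set c | exists u U, major_pair a b f u U /\
                                        point_value U b c]].

Definition minor_values a b f : set (\bar R) :=
  [set c%:E | c in [set c | exists v V, minor_pair a b f v V /\
                                        point_value V b c]].

Definition dist_integrable a b f :=
  [/\ exists u U, major_pair a b f u U,
      exists v V, minor_pair a b f v V &
      ereal_sup (minor_values a b f) = ereal_inf (major_values a b f)].

(* Measurability with respect to the Lebesgue (i.e. completed Borel)
   sigma-algebra; the default one on R is the Borel sigma-algebra. *)
Definition lebesgue_measurable_fun (D : set R) f :=
  @measurable_fun _ _
    (g_sigma_algebraType (completed_algebra_gen mu)) (\bar R) D f.

Definition infinite_dist_integral a b k :=
  lebesgue_measurable_fun `[a, b] k /\
  exists k1 k2 : R -> \bar R,
    [/\ {ae mu, forall x, x \in `[a, b] -> k x = (k1 x + k2 x)%E},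
        dist_integrable a b k1,
        {ae mu, forall x, x \in `[a, b] -> (0 <= k2 x)%E},
        lebesgue_measurable_fun `[a, b] k2 &
        ~ dist_integrable a b k2].

(* The value in the last branch is a placeholder: there the integral is
   undefined. *)
Definition dist_integral a b k : \bar R :=
  if `[< dist_integrable a b k >] then ereal_inf (major_values a b k)
  else if `[< infinite_dist_integral a b k >] then +oo%E
  else 0%E.

End DistributionalIntegral.

(* Main.v *)
(* If (u, U) is a major pair and (v, V) a minor pair of a function, then w = u - v has
   the primitive W = U - V, which has point values everywhere, and for a bump psi the
   lower limits of <w(x + t y), psi(y)> are nonnegative almost everywhere and > -oo off
   a countable set.  Such a w is a positive distribution: near some point of the closed
   set where positivity fails, a gliding hump argument bounds <W(x + t y), psi(y)>
   uniformly, so W has a continuous primitive G there, and a variant of Schwarz's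
   theorem on generalized second derivatives makes G convex.  Integrating over [a, b],
   Fatou's lemma gives int liminf <w(x + t y), psi(y)> dx <= U(b) - V(b).  Hence an
   integrable h is almost everywhere equal to a real Borel function, and h + p with
   p >= 0 Borel is distributionally integrable if and only if p is Lebesgue integrable,
   its integral being the sum; for the converse p dx is added to the pairs of h.  This
   reduces the claim to Lebesgue's monotone convergence theorem for p_n = g_n - h. *)
Require Import Defs.
From HB Require Import structures.
From mathcomp Require Import all_boot all_order all_algebra.
From mathcomp Require Import all_classical all_reals all_analysis.
From mathcomp Require Import measurable_realfun.
From mathcomp Require Import ring lra.
Set Implicit Arguments.
Unset Strict Implicit.
Unset Printing Implicit Defensive.
Import Order.TTheory GRing.Theory Num.Theory.
Import numFieldNormedType.Exports.
Local Open Scope classical_set_scope.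
Local Open Scope ring_scope.

(** * Smooth functions *)

Section SmoothCalculus.
Context {R : realType}.
Implicit Types (f g : R -> R) (x y t : R) (n k : nat).

(** The conditions on pairs are pointwise, with a threshold for the scale that depends on the point,
    while Fatou's lemma needs one sign for all small scales on the whole of [[a, b]]; closing this
    gap is the purpose of positivity. A single even bump [psi] of [test_class1] suffices, because
    integrals of [<w(x + s y), psi(y)>] against a test function recover [w]. Point values bound the
    dilations of [W] for each point and test function separately; the uniform bound is sought along
    cones [x + l * t], where a dilation is that of a shifted bump at [x]. The two exceptional sets
    enter differently: the null set is absorbed by a convex function with infinite curvature there,
    the countable set by counting slopes, for which the point values of [W] exclude concave corners.
    Major pairs accept any integrable density, but minor pairs require finite upper values off a
    countable set, so only truncations of [p] are added to them. Integrability does not presuppose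
    measurability of [h], and [g_ n] is measurable only for the completed sigma-algebra; both are
    replaced by Borel functions up to null sets. *)

Definition Cn n f := forall k x, (k <= n)%N -> derivable f^`(k)%classic x 1.

(** [smooth] offers no order to induct on, and the derivative of a product or composition contains
    the functions themselves again; peeling off one derivative at finite order turns the closure
    proofs into inductions over all functions at once. *)
Lemma CnS n f : Cn n.+1 f <-> (forall x, derivable f x 1) /\ Cn n f^`()%classic.
Proof.
split=> [H|[H0 H] [|k] x kn].
- split=> [x|k x kn]; first by have := H 0%N x isT; rewrite derive1n0.
  by rewrite -derive1Sn; apply: H.
- by rewrite derive1n0.
- by rewrite derive1Sn; apply: H.
Qed.

Lemma Cn0 f : Cn 0 f <-> (forall x, derivable f x 1).
Proof.
split=> [H x|H k x]; first by have := H 0%N x isT; rewrite derive1n0.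
by rewrite leqn0 => /eqP ->; rewrite derive1n0.
Qed.

Lemma CnW n f : Cn n.+1 f -> Cn n f.
Proof. by move=> H k x kn; apply: H; rewrite ltnW. Qed.

Lemma smoothP f : smooth f <-> forall n, Cn n f.
Proof. by split=> [H n k x _|H m x]; [apply: H|apply: (H m)]. Qed.

Lemma derive1_is f x (df : R) : is_derive x 1 f df -> f^`()%classic x = df.
Proof. by move=> H; rewrite derive1E derive_val. Qed.

Lemma derivable_is f x : derivable f x 1 -> is_derive x 1 f (f^`()%classic x).
Proof. by move=> H; apply: DeriveDef => //; rewrite derive1E. Qed.

Lemma is_derive_add f g x (df dg : R) : is_derive x 1 f df ->
  is_derive x 1 g dg -> is_derive x 1 (fun y => f y + g y) (df + dg).
Proof. by move=> Hf Hg; exact: is_deriveD. Qed.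

Lemma is_derive_opp f x (df : R) : is_derive x 1 f df ->
  is_derive x 1 (fun y => - f y) (- df).
Proof. by move=> Hf; exact: is_deriveN. Qed.

Lemma is_derive_mul f g x (df dg : R) : is_derive x 1 f df ->
  is_derive x 1 g dg -> is_derive x 1 (fun y => f y * g y) (df * g x + f x * dg).
Proof.
move=> Hf Hg; have -> : df * g x + f x * dg = f x *: dg + g x *: df.
  by rewrite addrC /GRing.scale /= (mulrC df).
exact: is_deriveM.
Qed.

Lemma is_derive_scal f x (c df : R) : is_derive x 1 f df ->
  is_derive x 1 (fun y => c * f y) (c * df).
Proof. by move=> Hf; exact: is_deriveZ. Qed.

Lemma CnD n f g : Cn n f -> Cn n g -> Cn n (fun x => f x + g x).
Proof.
elim: n f g => [|n IH] f g; first by rewrite !Cn0 => Hf Hg x; apply: derivableD.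
rewrite !CnS => -[f1 f2] [g1 g2]; split; first by move=> x; apply: derivableD.
suff -> : (fun x => f x + g x)^`()%classic = (fun x => f^`()%classic x + g^`()%classic x).
  exact: IH.
apply/funext => x; apply: derive1_is.
by apply: is_derive_add; exact: derivable_is.
Qed.

Lemma CnM n f g : Cn n f -> Cn n g -> Cn n (fun x => f x * g x).
Proof.
elim: n f g => [|n IH] f g; first by rewrite !Cn0 => Hf Hg x; apply: derivableM.
move=> Hf Hg; move: (Hf) (Hg); rewrite !CnS => -[f1 f2] [g1 g2].
split; first by move=> x; apply: derivableM.
suff -> : (fun x => f x * g x)^`()%classic =
    (fun x => f^`()%classic x * g x + f x * g^`()%classic x).
  exact: (CnD (IH _ _ f2 (CnW Hg)) (IH _ _ (CnW Hf) g2)).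
apply/funext => x; apply: derive1_is.
exact: (is_derive_mul (derivable_is (f1 x)) (derivable_is (g1 x))).
Qed.

Lemma is_derive_comp f g x (df dg : R) : is_derive (g x) 1 f df ->
  is_derive x 1 g dg -> is_derive x 1 (fun y => f (g y)) (df * dg).
Proof. by move=> Hf Hg; exact: is_derive1_comp. Qed.

Lemma CnC n f g : Cn n f -> Cn n g -> Cn n (fun x => f (g x)).
Proof.
elim: n f g => [|n IH] f g.
  rewrite !Cn0 => Hf Hg x.
  by have [] := is_derive_comp (derivable_is (Hf (g x))) (derivable_is (Hg x)).
move=> Hf Hg; move: (Hf) (Hg); rewrite !CnS => -[f1 f2] [g1 g2].
have H x := is_derive_comp (derivable_is (f1 (g x))) (derivable_is (g1 x)).
split; first by move=> x; have [] := H x.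
suff -> : (fun x => f (g x))^`()%classic =
    (fun x => f^`()%classic (g x) * g^`()%classic x).
  exact: (CnM (IH _ _ f2 (CnW Hg)) g2).
by apply/funext => x; apply: derive1_is.
Qed.

Lemma Cn_cst n (c : R) : Cn n (fun=> c).
Proof.
elim: n c => [|n IH] c; first by rewrite Cn0.
rewrite CnS; split=> //.
suff -> : (fun=> c)^`()%classic = (fun=> 0) :> (R -> R) by [].
by apply/funext => x; rewrite derive1_cst.
Qed.

Lemma Cn_id n : Cn n (@id R).
Proof.
case: n => [|n]; rewrite ?Cn0 ?CnS; first by [].
split=> //; suff -> : (@id R)^`()%classic = (fun=> 1) by exact: Cn_cst.
by apply/funext => x; rewrite derive1_id.
Qed.

Lemma smooth_derivable f x : smooth f -> derivable f x 1.
Proof. by move=> /(_ 0%N x); rewrite derive1n0. Qed.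

Lemma smooth_is f x : smooth f -> is_derive x 1 f (f^`()%classic x).
Proof. by move=> H; apply: derivable_is; exact: smooth_derivable. Qed.

Lemma smooth_derive f : smooth f -> smooth f^`()%classic.
Proof. by move=> H m x; rewrite -derive1Sn. Qed.

Lemma smooth_derive1n f n : smooth f -> smooth f^`(n)%classic.
Proof.
elim: n => [|n IH] H; first by rewrite derive1n0.
by rewrite derive1nS; apply: smooth_derive; apply: IH.
Qed.

Lemma smooth_cst (c : R) : smooth (fun=> c).
Proof. by apply/smoothP => n; apply: Cn_cst. Qed.

Lemma smooth_id : smooth (@id R).
Proof. by apply/smoothP => n; apply: Cn_id. Qed.

Lemma smoothD f g : smooth f -> smooth g -> smooth (fun x => f x + g x).
Proof. by move=> /smoothP Hf /smoothP Hg; apply/smoothP => n; apply: CnD. Qed.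

Lemma smoothM f g : smooth f -> smooth g -> smooth (fun x => f x * g x).
Proof. by move=> /smoothP Hf /smoothP Hg; apply/smoothP => n; apply: CnM. Qed.

Lemma smooth_comp f g : smooth f -> smooth g -> smooth (fun x => f (g x)).
Proof. by move=> /smoothP Hf /smoothP Hg; apply/smoothP => n; apply: CnC. Qed.

Lemma smoothZ (c : R) f : smooth f -> smooth (fun x => c * f x).
Proof. by apply: smoothM; apply: smooth_cst. Qed.

Lemma smoothN f : smooth f -> smooth (fun x => - f x).
Proof.
move=> H; suff -> : (fun x => - f x) = (fun x => -1 * f x) by apply: smoothZ.
by apply/funext => x; rewrite mulN1r.
Qed.

Lemma smoothB f g : smooth f -> smooth g -> smooth (fun x => f x - g x).
Proof. by move=> Hf Hg; exact: (smoothD Hf (smoothN Hg)). Qed.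

Lemma smooth_sum (I : Type) (r : seq I) (P : pred I) (F : I -> R -> R) :
  (forall i, smooth (F i)) -> smooth (fun x => \sum_(i <- r | P i) F i x).
Proof.
move=> H; elim: r => [|i r IH].
  suff -> : (fun x => \sum_(i <- [::] | P i) F i x) = fun=> 0 by apply: smooth_cst.
  by apply/funext => x; rewrite big_nil.
have -> : (fun x => \sum_(j <- i :: r | P j) F j x) =
   (fun x => (if P i then F i x else 0) + \sum_(j <- r | P j) F j x).
  by apply/funext => x; rewrite big_cons; case: (P i); rewrite ?add0r.
apply: smoothD; last exact: IH.
by case: (P i); [exact: H|exact: smooth_cst].
Qed.

Lemma smooth_affine (x t : R) : smooth (fun y => (y - x) / t).
Proof.
have -> : (fun y => (y - x) / t) = (fun y => t^-1 * (y + - x)).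
  by apply/funext => y; rewrite mulrC.
by apply: smoothZ; apply: smoothD; [apply: smooth_id|apply: smooth_cst].
Qed.

Lemma derive1nD f g n : smooth f -> smooth g ->
  (fun x => f x + g x)^`(n)%classic = (fun x => f^`(n)%classic x + g^`(n)%classic x).
Proof.
move=> Hf Hg; elim: n => [|n IH]; first by rewrite !derive1n0.
rewrite !derive1nS IH; apply/funext => x; apply: derive1_is.
by apply: is_derive_add; apply: derivable_is; [apply: Hf|apply: Hg].
Qed.

Lemma derive1nZ (c : R) f n : smooth f ->
  (fun x => c * f x)^`(n)%classic = (fun x => c * f^`(n)%classic x).
Proof.
move=> Hf; elim: n => [|n IH]; first by rewrite !derive1n0.
rewrite !derive1nS IH; apply/funext => x; apply: derive1_is.
by apply: is_derive_scal; apply: derivable_is; apply: Hf.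
Qed.

Lemma derive1n0f n : (fun=> 0 : R)^`(n)%classic = (fun=> 0) :> (R -> R).
Proof.
elim: n => [|n IH]; first by rewrite derive1n0.
by rewrite derive1nS IH; apply/funext => x; rewrite derive1_cst.
Qed.

Lemma derive1n_sum (I : Type) (r : seq I) (F : I -> R -> R) n :
  (forall i, smooth (F i)) ->
  (fun x => \sum_(i <- r) F i x)^`(n)%classic =
  (fun x => \sum_(i <- r) (F i)^`(n)%classic x).
Proof.
move=> H; elim: r => [|i r IH].
  have -> : (fun x => \sum_(i <- [::]) F i x) = fun=> 0.
    by apply/funext => x; rewrite big_nil.
  by rewrite derive1n0f; apply/funext => x; rewrite big_nil.
have -> : (fun x => \sum_(j <- i :: r) F j x) =
   (fun x => F i x + \sum_(j <- r) F j x).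
  by apply/funext => x; rewrite big_cons.
rewrite derive1nD // ?IH; last exact: smooth_sum.
by apply/funext => x; rewrite big_cons.
Qed.

Lemma is_derive_affine (x t y : R) : is_derive y 1 (fun y => (y - x) / t) t^-1.
Proof.
have -> : (fun y => (y - x) / t) = (fun y => t^-1 * (y + - x)).
  by apply/funext => z; rewrite mulrC.
have H : is_derive y 1 (fun y : R => y + - x) 1.
  by rewrite -[X in is_derive _ _ _ X]addr0; apply: is_derive_add.
by have := is_derive_scal t^-1 H; rewrite mulr1.
Qed.

Lemma derive1n_affine f n (x t : R) : smooth f ->
  (fun y => f ((y - x) / t))^`(n)%classic =
  (fun y => t^-1 ^+ n * f^`(n)%classic ((y - x) / t)).
Proof.
move=> Hf; elim: n => [|n IH].
  by rewrite derive1n0; apply/funext => y; rewrite expr0 mul1r derive1n0.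
rewrite !derive1nS IH; apply/funext => y; apply: derive1_is.
rewrite exprSr -mulrA [X in _ * X]mulrC.
apply: (@is_derive_scal (fun y => f^`(n)%classic ((y - x) / t))).
apply: is_derive_comp; last exact: is_derive_affine.
by apply: derivable_is; apply: Hf.
Qed.

Lemma derive1_affine f (x t : R) : smooth f ->
  (fun y => f ((y - x) / t))^`()%classic =
  (fun y => t^-1 * f^`()%classic ((y - x) / t)).
Proof. by move=> Hf; have := derive1n_affine 1 x t Hf; rewrite !derive1n1 expr1. Qed.

Lemma smooth_comp_affine f (x t : R) : smooth f -> smooth (fun y => f ((y - x) / t)).
Proof. by move=> H; apply: (smooth_comp H); apply: smooth_affine. Qed.

End SmoothCalculus.

(** * Flat exponentials and a criterion for derivatives *)

Section FlatExponential.
Context {R : realType}.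
Implicit Types (x y : R) (n k : nat).

(** The powers of [x^-1] are carried along because the family is then stable under differentiation:
    the derivative at index [k] combines the indices [k.+2] and [k.+1]. *)
Definition flatexp k x : R := if 0 < x then x^-1 ^+ k * expR (- x^-1) else 0.

Lemma flatexp_ge0 k x : 0 <= flatexp k x.
Proof.
rewrite /flatexp; case: ifPn => // x0.
by rewrite mulr_ge0 ?expR_ge0 // exprn_ge0 // invr_ge0 ltW.
Qed.

Lemma flatexp_gt0 k x : 0 < x -> 0 < flatexp k x.
Proof.
by move=> x0; rewrite /flatexp x0 mulr_gt0 ?expR_gt0 // exprn_gt0 // invr_gt0.
Qed.

Lemma flatexp0 k x : x <= 0 -> flatexp k x = 0.
Proof. by rewrite /flatexp leNgt; case: ifP. Qed.

Lemma expR_ge_pow n (y : R) : 0 <= y -> (y / n.+1%:R) ^+ n.+1 <= expR y.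
Proof.
move=> y0; have -> : expR y = expR (y / n.+1%:R) ^+ n.+1.
  by rewrite -expRM_natr divfK // pnatr_eq0.
have h0 : 0 <= y / n.+1%:R by rewrite divr_ge0.
by rewrite lerXn2r // ?nnegrE ?expR_ge0 // (le_trans _ (expR_ge1Dx _)) // lerDr.
Qed.

(** With [y = x^-1], the lower bound of [expR y] by the power [k.+2] of [y / k.+2%:R] absorbs the
    [k] negative powers and leaves [x ^+ 2]; the square is what differentiability at 0 needs. *)
Lemma flatexp_bound k : exists2 C : R, 0 <= C & forall x, `|flatexp k x| <= C * x ^+ 2.
Proof.
exists ((k.+2)%:R ^+ k.+2) => [|x]; first by rewrite exprn_ge0.
have [x0|x0] := leP x 0.
  by rewrite flatexp0 // normr0 mulr_ge0 ?sqr_ge0 // exprn_ge0.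
rewrite ger0_norm ?flatexp_ge0 // /flatexp x0 expRN.
have y0 : 0 <= x^-1 by rewrite invr_ge0 ltW.
rewrite ler_pdivrMr ?expR_gt0 //.
apply: le_trans (ler_wpM2l _ (expR_ge_pow k.+1 y0)); last first.
  by rewrite mulr_ge0 ?sqr_ge0 // exprn_ge0.
have c0 : (k.+2%:R ^+ k.+2 : R) != 0 by rewrite expf_neq0 // pnatr_eq0.
have -> : k.+2%:R ^+ k.+2 * x ^+ 2 * (x^-1 / k.+2%:R) ^+ k.+2 =
   x^-1 ^+ k * (x^-1 * x) ^+ 2 * (k.+2%:R ^+ k.+2 / k.+2%:R ^+ k.+2).
  by rewrite expr_div_n -addn2 [x^-1 ^+ (k + 2)]exprD exprMn; ring.
by rewrite mulVf ?gt_eqF // divff // expr1n !mulr1.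
Qed.

(** A quadratic remainder is the form in which derivatives are available later: at the flat point of
    [flatexp], for dilations of distributions, and for pointwise limits of smooth functions. *)
Lemma is_derive_quad (F : R -> R) (x D C : R) :
  (forall h, `|h| <= 1 -> `|F (x + h) - F x - h * D| <= C * h ^+ 2) ->
  is_derive x 1 F D.
Proof.
move=> H; have C0 : 0 <= C.
  have := le_trans (normr_ge0 _) (H 1 _).
  by rewrite normr1 expr1n mulr1; apply.
have H1 : (fun h => h^-1 *: (F (h *: 1 + x) - F x)) @ 0^' --> D.
  apply/cvgrPdist_le => e e0.
  near=> h; rewrite /GRing.scale /= mulr1.
  have h0 : h != 0 by near: h; exact: nbhs_dnbhs_neq.
  have h1 : `|h| <= 1 by apply/ltW; near: h; apply: (@dnbhs0_lt _ R^o).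
  have -> : D - h^-1 * (F (h + x) - F x) = - (h^-1 * (F (x + h) - F x - h * D)).
    by rewrite [h + x]addrC; field.
  rewrite normrN normrM normfV mulrC ler_pdivrMr ?normr_gt0 //.
  apply: (le_trans (H h h1)); rewrite -real_normK ?num_real // expr2 mulrA.
  apply: ler_wpM2r => //.
  have hC : `|h| < e / (C + 1).
    by near: h; apply: (@dnbhs0_lt _ R^o); rewrite divr_gt0 // ltr_wpDl.
  apply: le_trans (_ : (C + 1) * `|h| <= _); first by rewrite ler_wpM2r // lerDl.
  by rewrite mulrC -ler_pdivlMr ?ltr_wpDl // ltW.
have Dx : derivable F x 1 by apply/cvg_ex; exists D.
by apply: DeriveDef => //; rewrite /derive; apply/cvg_lim.
Unshelve. all: by end_near. Qed.

Lemma is_derive_flatexp k x :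
  is_derive x 1 (flatexp k) (flatexp k.+2 x - k%:R * flatexp k.+1 x).
Proof.
have [x0|x0|->] := ltgtP x 0.
- rewrite !flatexp0 ?ltW // mulr0 subr0.
  have H : \forall y \near x, (fun=> 0) y = flatexp k y.
    near=> y; rewrite flatexp0 //; near: y.
    have := lt_nbhsl x0; apply: filterS => z; exact: ltW.
  exact: (near_eq_is_derive H (@is_derive_cst _ R^o R^o 0 x 1)).
- have H : \forall y \near x, y^-1 ^+ k * expR (- y^-1) = flatexp k y.
    near=> y; rewrite /flatexp ifT //; near: y.
    exact: lt_nbhsr.
  have xn0 : x != 0 by rewrite gt_eqF.
  have D1 : is_derive x 1 (fun y : R => y^-1) (- x ^- 2).
    have := @is_deriveV _ (@id R) x 1 1 xn0 (is_derive_id _ _).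
    by rewrite /GRing.scale /= mulr1.
  have D2 : is_derive x 1 (fun y : R => expR (- y^-1)) (expR (- x^-1) * (x ^- 2)).
    apply: is_derive_comp; rewrite -[X in is_derive _ _ _ X]opprK; exact: is_derive_opp.
  have D3 : is_derive x 1 (fun y : R => y^-1 ^+ k) (k%:R * x^-1 ^+ k.-1 * (- x ^- 2)).
    have -> : (fun y : R => y^-1 ^+ k) = (fun y : R => y^-1) ^+ k.
      by apply/funext => y; rewrite fctE.
    have := @is_deriveX _ _ (fun y : R => y^-1) k x 1 _ D1.
    by rewrite /GRing.scale /= mulr_natl.
  have D4 := is_derive_mul D3 D2.
  have -> : flatexp k.+2 x - k%:R * flatexp k.+1 x =
     k%:R * x^-1 ^+ k.-1 * (- x ^- 2) * expR (- x^-1) +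
     x^-1 ^+ k * (expR (- x^-1) * (x ^- 2)).
    rewrite /flatexp x0 -exprVn.
    case: k {H D3 D4} => [|k] /=; first by ring.
    by rewrite !exprS; ring.
  exact: (near_eq_is_derive H D4).
- rewrite !flatexp0 // mulr0 subr0.
  have [C _ HC] := flatexp_bound k; apply: (@is_derive_quad _ _ _ C) => h _.
  by rewrite add0r [flatexp k 0]flatexp0 // mulr0 !subr0.
Unshelve. all: by end_near. Qed.

Lemma smooth_flatexp k : smooth (flatexp k).
Proof.
apply/smoothP => n; elim: n k => [|n IH] k.
  by apply/Cn0 => x; have [] := is_derive_flatexp k x.
apply/CnS; split; first by move=> x; have [] := is_derive_flatexp k x.
have -> : (flatexp k)^`()%classic = (fun x => flatexp k.+2 x + - k%:R * flatexp k.+1 x).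
  apply/funext => x; rewrite (derive1_is (is_derive_flatexp k x)).
  by rewrite mulNr.
by apply: CnD => //; apply: CnM => //; apply: Cn_cst.
Qed.

End FlatExponential.

(** * Integrals of continuous functions, distributions and dilations *)

Section ContinuousIntegral.
Context {R : realType}.
Local Notation mu := (@lebesgue_measure R).
Implicit Types (f g F : R -> R) (a b c x t : R).

(** Unoriented: the value is 0 when [b < a], hence the hypotheses [a <= b] in the lemmas that move
    end points. *)
Definition cint a b f : R := \int[mu]_(x in `[a, b]) f x.

Lemma cint_integrable f a b : continuous f -> mu.-integrable `[a, b] (EFin \o f).
Proof.
move=> cf; apply: continuous_compact_integrable; first exact: segment_compact.
exact: continuous_subspaceT.
Qed.

Lemma derivable_cont f x : derivable f x 1 -> {for x, continuous f}.
Proof. by move=> /derivable1_diffP /differentiable_continuous. Qed.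

Lemma is_derive_cont f x (df : R) : is_derive x 1 f df -> {for x, continuous f}.
Proof. by move=> [H _]; apply: derivable_cont. Qed.

Lemma contD f g : continuous f -> continuous g -> continuous (fun x => f x + g x).
Proof. by move=> cf cg x; apply: continuousD; [exact: cf|exact: cg]. Qed.

Lemma contB f g : continuous f -> continuous g -> continuous (fun x => f x - g x).
Proof. by move=> cf cg x; apply: continuousB; [exact: cf|exact: cg]. Qed.

Lemma contM f g : continuous f -> continuous g -> continuous (fun x => f x * g x).
Proof. by move=> cf cg x; apply: continuousM; [exact: cf|exact: cg]. Qed.

Lemma contZ (k : R) f : continuous f -> continuous (fun x => k * f x).
Proof. by apply: contM; exact: cst_continuous. Qed.

(** The base point [a - 1] and the bound [b + 1] make both end points interior, so the derivative
    there is two-sided. *)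
Lemma cont_primitive f a b : continuous f ->
  exists F, forall x, a <= x <= b -> is_derive x 1 F (f x).
Proof.
move=> cf; exists (fun x => cint (a - 1) x f) => x /andP[ax xb].
have xb1 : x < b + 1 by rewrite (le_lt_trans xb) // ltrDl.
have ax1 : a - 1 < x by rewrite (lt_le_trans _ ax) // gtrBl.
have [D1 D2] := continuous_FTC1_closed xb1 (cint_integrable (a - 1) (b + 1) cf) ax1 (cf x).
by rewrite -D2; exact: derivable_is.
Qed.

Lemma cint_FTC f F a b : a <= b -> continuous f ->
  (forall x, a <= x <= b -> is_derive x 1 F (f x)) -> cint a b f = F b - F a.
Proof.
rewrite le_eqVlt => /predU1P[<-|ab] cf H.
  by rewrite /cint set_itv1 Rintegral_set1 subrr.
have H1 : derivable_oo_LRcontinuous F a b.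
  split.
  - move=> x; rewrite in_itv /= => /andP[ax xb].
    by have [] := H x; rewrite ?(ltW ax) ?(ltW xb).
  - apply: cvg_at_right_filter; apply: (@is_derive_cont _ _ (f a)); apply: H.
    by rewrite lexx ltW.
  - apply: cvg_at_left_filter; apply: (@is_derive_cont _ _ (f b)); apply: H.
    by rewrite lexx ltW.
have H2 : {in `]a, b[, F^`()%classic =1 f}.
  move=> x; rewrite in_itv /= => /andP[ax xb].
  by apply: derive1_is; apply: H; rewrite !ltW.
by rewrite /cint /Rintegral (continuous_FTC2 ab (continuous_subspaceT cf) H1 H2).
Qed.

Lemma cintD f g a b : continuous f -> continuous g ->
  cint a b (fun x => f x + g x) = cint a b f + cint a b g.
Proof. by move=> cf cg; rewrite /cint RintegralD //; exact: cint_integrable. Qed.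

Lemma cintB f g a b : continuous f -> continuous g ->
  cint a b (fun x => f x - g x) = cint a b f - cint a b g.
Proof. by move=> cf cg; rewrite /cint RintegralB //; exact: cint_integrable. Qed.

Lemma cintZ f (k : R) a b : continuous f ->
  cint a b (fun x => k * f x) = k * cint a b f.
Proof. by move=> cf; rewrite /cint RintegralZl //; exact: cint_integrable. Qed.

Lemma eq_cint f g a b : (forall x, a <= x <= b -> f x = g x) ->
  cint a b f = cint a b g.
Proof.
by move=> H; apply: eq_Rintegral => x; rewrite inE /= in_itv /= => /H.
Qed.

Lemma cint_le f g a b : continuous f -> continuous g ->
  (forall x, a <= x <= b -> f x <= g x) -> cint a b f <= cint a b g.
Proof.
move=> cf cg H; apply: le_Rintegral; [by []|exact: cint_integrable..|].
by move=> x /=; rewrite in_itv /=; exact: H.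
Qed.

Lemma cint_cst (k : R) a b : a <= b -> cint a b (fun=> k) = k * (b - a).
Proof.
move=> ab; have H x : a <= x <= b -> is_derive x 1 (fun x => k * x) k.
  by move=> _; rewrite -[X in is_derive _ _ _ X]mulr1; apply: is_derive_scal.
by rewrite (cint_FTC ab (@cst_continuous _ _ k) H) mulrBr.
Qed.

Lemma cint_bound f (M : R) a b : a <= b -> continuous f ->
  (forall x, a <= x <= b -> `|f x| <= M) -> `|cint a b f| <= M * (b - a).
Proof.
move=> ab cf H; rewrite ler_norml -mulNr -!cint_cst //.
apply/andP; split; apply: cint_le => //; try exact: cst_continuous.
- by move=> x /H; rewrite ler_norml => /andP[].
- by move=> x /H; rewrite ler_norml => /andP[].
Qed.

Lemma cint_chasles f a b c : a <= b -> b <= c -> continuous f ->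
  cint a b f + cint b c f = cint a c f.
Proof.
move=> ab bc cf; have [F HF] := cont_primitive a c cf.
have H1 x : a <= x <= b -> is_derive x 1 F (f x).
  by move=> /andP[ax xb]; apply: HF; rewrite ax (le_trans xb).
have H2 x : b <= x <= c -> is_derive x 1 F (f x).
  by move=> /andP[ax xb]; apply: HF; rewrite xb (le_trans ab).
rewrite (cint_FTC ab cf H1) (cint_FTC bc cf H2) (cint_FTC (le_trans ab bc) cf HF); ring.
Qed.

Lemma continuous_lin f x t : continuous f -> continuous (fun y => f (x + t * y)).
Proof.
move=> cf y; apply: (@continuous_comp _ _ _ (fun y => x + t * y) f); last exact: cf.
by apply: continuousD; [exact: cst_continuous|apply: continuousM; [exact: cst_continuous|]].
Qed.

Lemma cint_subst f x t a b : 0 < t -> a <= b -> continuous f ->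
  cint (x + t * a) (x + t * b) f = t * cint a b (fun y => f (x + t * y)).
Proof.
move=> t0 ab cf; have [F HF] := cont_primitive (x + t * a) (x + t * b) cf.
have le1 : x + t * a <= x + t * b by rewrite lerD2l ler_pM2l.
rewrite (cint_FTC le1 cf HF).
rewrite -cintZ; last exact: continuous_lin.
have H y : a <= y <= b -> is_derive y 1 (fun y => F (x + t * y)) (t * f (x + t * y)).
  move=> /andP[ay yb]; rewrite mulrC; apply: is_derive_comp.
    by apply: HF; rewrite !lerD2l !ler_pM2l // ay.
  rewrite -[X in is_derive _ _ _ X]add0r; apply: is_derive_add.
  by rewrite -[X in is_derive _ _ _ X]mulr1; apply: is_derive_scal.
rewrite (cint_FTC ab _ H) // => y.
by apply: continuousM; [exact: cst_continuous|exact: continuous_lin].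
Qed.

Lemma Rintegral_cint f a b : (forall x, ~~ (a <= x <= b) -> f x = 0) ->
  \int[mu]_x f x = cint a b f.
Proof.
move=> H; rewrite /cint [RHS]Rintegral_mkcond; congr Rintegral.
apply/funext => x; rewrite patchE; case: ifPn => // /negP xn; apply: H.
by apply/negP => H; apply: xn; rewrite inE /= in_itv.
Qed.

Lemma cint_extend f a b a' b' : a' <= a -> b <= b' ->
  (forall x, ~~ (a <= x <= b) -> f x = 0) -> cint a b f = cint a' b' f.
Proof.
move=> aa bb H; rewrite -(@Rintegral_cint f a b) // (@Rintegral_cint f a' b') //.
by move=> x Hx; apply: H; apply: contra Hx => /andP[ax xb]; rewrite (le_trans aa) ?(le_trans xb).
Qed.

Lemma cint_gt0 f a b : a < b -> continuous f ->
  (forall x, a < x < b -> 0 < f x) -> 0 < cint a b f.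
Proof.
move=> ab cf H; have [F HF] := cont_primitive a b cf.
rewrite (cint_FTC (ltW ab) cf HF).
have [||x xab ->] := @MVT _ F f a b ab.
- by move=> x; rewrite in_itv /= => /andP[ax xb]; apply: HF; rewrite !ltW.
- apply: derivable_within_continuous => x; rewrite in_itv /= => xab.
  by have [] := HF x xab.
- by rewrite mulr_gt0 ?subr_gt0 // H //; move: xab; rewrite in_itv.
Qed.

Lemma smooth_cont f : smooth f -> continuous f.
Proof. by move=> H x; apply: derivable_cont; exact: smooth_derivable. Qed.

(** For [f] odd with primitive [F], the function [F (- x)] is another primitive, so [F k - F (- k)]
    equals its own opposite. *)
Lemma cint_even f (k : R) : (forall x, f (- x) = - f x) -> continuous f -> 0 <= k ->
  cint (- k) k f = 0.
Proof.
move=> fN cf k0; have Nk : - k <= k by rewrite ge0_cp.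
have [F HF] := cont_primitive (- k) k cf.
have H := cint_FTC Nk cf HF.
have H2 : cint (- k) k f = F k - F (- k) by [].
have H3 : cint (- k) k f = F (- k) - F (- - k).
  apply: (@cint_FTC _ (fun x => F (- x))) => // x /andP[xk kx].
  rewrite -[f x]opprK -fN -mulrN1; apply: is_derive_comp.
    by apply: HF; rewrite lerN2 kx lerNl.
by rewrite opprK in H3; lra.
Qed.

End ContinuousIntegral.

(** * The bump and its companion kernel *)

Section Bump.
Context {R : realType}.
Local Notation mu := (@lebesgue_measure R).
Implicit Types (x y : R) (k : nat).

Definition sqc y : R := 1 - y ^+ 2.

Lemma smooth_sqc : smooth sqc.
Proof.
apply: smoothB; first exact: smooth_cst.
have -> : (fun x : R => x ^+ 2) = (fun x => x * x) by apply/funext => x; rewrite expr2.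
by apply: smoothM; exact: smooth_id.
Qed.

Lemma sqcN y : sqc (- y) = sqc y. Proof. by rewrite /sqc sqrrN. Qed.

Lemma sqc_le0 y : 1 <= `|y| -> sqc y <= 0.
Proof.
move=> y1; rewrite /sqc subr_le0 -[y ^+ 2]real_normK ?num_real //.
by rewrite exprn_ege1.
Qed.

Lemma sqc_gt0 y : -1 < y < 1 -> 0 < sqc y.
Proof. by move=> /andP[y1 y2]; rewrite /sqc; nra. Qed.

Definition bump_mass : R := cint (-1) 1 (fun y => flatexp 0 (sqc y)).

Lemma smooth_flat_sqc k : smooth (fun y => flatexp k (sqc y)).
Proof. by apply: smooth_comp; [exact: smooth_flatexp|exact: smooth_sqc]. Qed.

Lemma bump_mass_gt0 : 0 < bump_mass.
Proof.
apply: cint_gt0; rewrite ?ltrN1 //; last by move=> x /sqc_gt0 /flatexp_gt0; apply.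
exact: smooth_cont (@smooth_flat_sqc 0).
Qed.

(* [psi' y = - y * phi y], which makes [t <G''(x + t y), psi(y)>] the derivative in
   [t] of [<G(x + t y), phi(y)>] ([derive_t_dilation]). *)
Definition psi y := bump_mass^-1 * flatexp 0 (sqc y).
Definition phi y := bump_mass^-1 * (2 * flatexp 2 (sqc y)).

Lemma smooth_psi : smooth psi.
Proof. by apply: smoothZ; exact: smooth_flat_sqc. Qed.

Lemma smooth_phi : smooth phi.
Proof. by do 2!apply: smoothZ; exact: smooth_flat_sqc. Qed.

Lemma psi_ge0 y : 0 <= psi y.
Proof. by rewrite mulr_ge0 ?flatexp_ge0 // invr_ge0 ltW // bump_mass_gt0. Qed.

Lemma phi_ge0 y : 0 <= phi y.
Proof. by rewrite !mulr_ge0 ?flatexp_ge0 // invr_ge0 ltW // bump_mass_gt0. Qed.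

Lemma phi_gt0 y : -1 < y < 1 -> 0 < phi y.
Proof.
by move=> /sqc_gt0 y1; rewrite !mulr_gt0 ?flatexp_gt0 // invr_gt0 bump_mass_gt0.
Qed.

Lemma psi0 y : 1 < `|y| -> psi y = 0.
Proof. by move=> /ltW /sqc_le0 H; rewrite /psi flatexp0 // mulr0. Qed.

Lemma phi0 y : 1 < `|y| -> phi y = 0.
Proof. by move=> /ltW /sqc_le0 H; rewrite /phi flatexp0 // !mulr0. Qed.

Lemma psiN y : psi (- y) = psi y. Proof. by rewrite /psi sqcN. Qed.
Lemma phiN y : phi (- y) = phi y. Proof. by rewrite /phi sqcN. Qed.

Lemma derive_psi : psi^`()%classic = (fun y => - (y * phi y)).
Proof.
apply/funext => y; apply: derive1_is.
have -> : - (y * phi y) = bump_mass^-1 * (flatexp 2 (sqc y) * (0 - (1 * y + y * 1))).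
  by rewrite /phi; ring.
apply: is_derive_scal; apply: is_derive_comp.
  by have := is_derive_flatexp 0 (sqc y); rewrite mul0r subr0.
apply: is_derive_add; apply: is_derive_opp.
have -> : (fun x : R => x ^+ 2) = (fun x => x * x) by apply/funext => x; rewrite expr2.
by apply: is_derive_mul.
Qed.

Lemma out_norm (L x : R) : ~~ (- L <= x <= L) -> L < `|x|.
Proof. by rewrite -ler_norml -ltNge. Qed.

Lemma int_psi : cint (-1) 1 psi = 1.
Proof.
rewrite /psi cintZ; last exact: smooth_cont (@smooth_flat_sqc 0).
by rewrite mulVf // gt_eqF // bump_mass_gt0.
Qed.

Lemma integral_psi : (\int[mu]_x (psi x)%:E = 1)%E.
Proof.
have H : (\int[mu]_(x in `[(-1)%R, 1%R]%classic) (psi x)%:E = 1)%E.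
  have H1 : mu.-integrable `[(-1 : R), 1] (EFin \o psi).
    exact: cint_integrable (smooth_cont smooth_psi).
  have := int_psi; rewrite /cint /Rintegral => H; rewrite -[in RHS]H fineK //.
  exact: integrable_fin_num.
rewrite -[RHS]H [RHS]integral_mkcond; apply: eq_integral => x _.
rewrite patchE; case: ifPn => // /negP xn; rewrite psi0 //; apply: out_norm.
by apply/negP => H1; apply: xn; rewrite inE /= in_itv.
Qed.

End Bump.

(** * Supports, linearity and dilations of distributions *)

Section DistributionBasics.
Context {R : realType}.
Implicit Types (T : (R -> R) -> R) (f g : R -> R) (L x t : R).

(** Support in [[- L, L]] expressed by a radius, which is easier to track through derivatives,
    translations and dilations than [tsupport]; [vanish_test] and [test_vanish] translate between
    the two. *)
Definition vanish L f := forall x, L < `|x| -> f x = 0.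

Lemma vanish_le L L' f : L <= L' -> vanish L f -> vanish L' f.
Proof. by move=> LL H x Lx; apply: H; exact: le_lt_trans Lx. Qed.

Lemma vanish_near L f x : vanish L f -> L < `|x| -> \forall y \near x, 0 = f y.
Proof.
move=> H Lx; have : \forall y \near x, L < `|y|.
  have := @norm_continuous _ R^o x; move=> /cvgrPdist_lt /(_ (`|x| - L)).
  rewrite subr_gt0 => /(_ Lx); apply: filterS => y /=.
  by move=> /(le_lt_trans (ler_norm _)); rewrite ltrBlDr -ltrBlDl opprB addrC subrK.
by apply: filterS => y /H ->.
Qed.

Lemma vanish_derive L f : vanish L f -> vanish L f^`()%classic.
Proof.
move=> H x Lx; apply: derive1_is.
exact: (near_eq_is_derive (vanish_near H Lx) (@is_derive_cst _ R^o R^o 0 x 1)).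
Qed.

Lemma vanish_derive1n L f n : vanish L f -> vanish L f^`(n)%classic.
Proof.
move=> H; elim: n => [|n IH]; first by rewrite derive1n0.
by rewrite derive1nS; exact: vanish_derive.
Qed.

Lemma vanish_affine L f x t : 0 < t -> vanish L f ->
  vanish (`|x| + t * L) (fun y => f ((y - x) / t)).
Proof.
move=> t0 H y Hy; apply: H; rewrite normrM normfV (gtr0_norm t0) ltr_pdivlMr //.
by have := lerB_dist y x; lra.
Qed.

Lemma vanishD L f g : vanish L f -> vanish L g -> vanish L (fun x => f x + g x).
Proof. by move=> Hf Hg x Lx; rewrite Hf // Hg // addr0. Qed.

Lemma vanishM L f g : vanish L f -> vanish L (fun x => g x * f x).
Proof. by move=> Hf x Lx; rewrite Hf // mulr0. Qed.

Lemma vanishN L f : vanish L f -> vanish L (fun x => - f x).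
Proof. by move=> Hf x Lx; rewrite Hf // oppr0. Qed.

Lemma vanish_sum L n (F : 'I_n -> R -> R) : (forall i, vanish L (F i)) ->
  vanish L (fun x => \sum_(i < n) F i x).
Proof. by move=> H x Lx; apply: big1 => i _; exact: H. Qed.

Lemma tsupport_vanish L f : vanish L f -> tsupport f `<=` `[- L, L].
Proof.
move=> H; rewrite /tsupport [X in _ `<=` X](_ : _ = closure `[- L, L]).
  apply: closureS => x /= fx; rewrite in_itv /=.
  by apply: contraNT fx => /out_norm /H ->.
by apply/closure_id; exact: interval_closed.
Qed.

Lemma vanish_test L f : smooth f -> vanish L f -> test_function f.
Proof.
move=> sf H; split => //.
apply: (subclosed_compact _ (@segment_compact _ (- L) L)).
  exact: closed_closure.
exact: tsupport_vanish.
Qed.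

Lemma test_vanish f : test_function f -> exists2 L, 0 < L & vanish L f.
Proof.
move=> [sf /compact_bounded [M [_ HM]]]; exists (`|M| + 1).
  by rewrite ltr_wpDl.
move=> x Hx; apply/eqP/negP => /negP fx.
have /HM /(_ x) : M < `|M| + 1 by rewrite (le_lt_trans (ler_norm _)) // ltrDl.
move=> /(_ _)/wrap[]; first by apply: subset_closure.
by move=> H; move: Hx; rewrite ltNge H.
Qed.

Lemma vanish_bounded L f : continuous f -> vanish L f ->
  exists2 B : R, 0 <= B & forall x, `|f x| <= B.
Proof.
move=> cf H; have : compact (f @` `[- L, L]).
  by apply: continuous_compact; [exact: continuous_subspaceT|exact: segment_compact].
move=> /compact_bounded [M [_ HM]]; exists (`|M| + 1); first by rewrite ltW // ltr_wpDl.
move=> x; have [Lx|xL] := ltP L `|x|; first by rewrite H // normr0 ltW // ltr_wpDl.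
have /HM : M < `|M| + 1 by rewrite (le_lt_trans (ler_norm _)) // ltrDl.
by apply; exists x => //=; rewrite in_itv /= -ler_norml.
Qed.

Lemma derive1n_bounded L f m : smooth f -> vanish L f ->
  exists2 B : R, 0 <= B & forall (k : nat) x, (k <= m)%N -> `|f^`(k)%classic x| <= B.
Proof.
move=> sf H; elim: m => [|m [B B0 HB]].
  have [B B0 HB] := vanish_bounded (smooth_cont sf) H; exists B => // k x.
  by rewrite leqn0 => /eqP ->; rewrite derive1n0.
have [C C0 HC] := vanish_bounded (smooth_cont (@smooth_derive1n _ f m.+1 sf))
  (vanish_derive1n m.+1 H).
exists (B + C); first exact: addr_ge0.
move=> k x; rewrite leq_eqVlt => /predU1P[->|km].
  by rewrite (le_trans (HC x)) // lerDr.
by rewrite (le_trans (HB k x _)) // lerDl.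
Qed.

Lemma dist_bound T L : Defs.distribution T -> exists (C : R) (m : nat), 0 <= C /\
  forall f, smooth f -> vanish L f -> forall B, 0 <= B ->
   (forall (k : nat) x, (k <= m)%N -> `|f^`(k)%classic x| <= B) -> `|T f| <= C * B.
Proof.
move=> [_ /(_ _ (@segment_compact _ (- L) L))[C [m H]]].
exists `|C|, m; split => // f sf vf B B0 HB.
have := H f (vanish_test sf vf) (tsupport_vanish vf) B (fun k x km => HB k x km).
by move=> /le_trans; apply; rewrite ler_wpM2r // ler_norm.
Qed.

Section Linear.
Variable T : (R -> R) -> R.
Hypothesis HT : Defs.distribution T.

Lemma test_smooth f : test_function f -> smooth f. Proof. by case. Qed.

Lemma test_cst0 : test_function (fun=> 0 : R).
Proof. by apply: (@vanish_test 0) => //; exact: smooth_cst. Qed.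

Lemma dist0 : T (fun=> 0) = 0.
Proof.
have := HT.1 1 _ _ test_cst0 test_cst0.
have -> : (fun x => 1 * (fun=> 0 : R) x + (fun=> 0 : R) x) = (fun=> 0 : R).
  by apply/funext => x; rewrite mulr0 addr0.
lra.
Qed.

Lemma distD f g : test_function f -> test_function g ->
  T (fun x => f x + g x) = T f + T g.
Proof.
move=> Hf Hg; have := HT.1 1 _ _ Hf Hg; rewrite mul1r => <-; congr T.
by apply/funext => x; rewrite mul1r.
Qed.

Lemma distZ c f : test_function f -> T (fun x => c * f x) = c * T f.
Proof.
move=> Hf; have := HT.1 c _ _ Hf test_cst0; rewrite dist0 addr0 => <-; congr T.
by apply/funext => x; rewrite addr0.
Qed.

Lemma distN f : test_function f -> T (fun x => - f x) = - T f.
Proof.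
move=> Hf; rewrite -mulN1r -distZ //; congr T.
by apply/funext => x; rewrite mulN1r.
Qed.

Lemma testZ (c : R) f : test_function f -> test_function (fun x => c * f x).
Proof.
move=> tf; have [L _ vf] := test_vanish tf; apply: (@vanish_test L).
  exact: smoothZ (test_smooth tf).
exact: vanishM.
Qed.

Lemma testN f : test_function f -> test_function (fun x => - f x).
Proof.
move=> tf; have [L _ vf] := test_vanish tf; apply: (@vanish_test L).
  exact: smoothN (test_smooth tf).
exact: vanishN.
Qed.

Lemma testD f g : test_function f -> test_function g -> test_function (fun x => f x + g x).
Proof.
move=> tf tg; have [L _ vf] := test_vanish tf; have [L' _ vg] := test_vanish tg.
apply: (@vanish_test (Num.max L L')); first exact: smoothD (test_smooth tf) (test_smooth tg).
apply: vanishD; first by apply: vanish_le vf; rewrite le_max lexx.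
by apply: vanish_le vg; rewrite le_max lexx orbT.
Qed.

Lemma distB f g : test_function f -> test_function g ->
  T (fun x => f x - g x) = T f - T g.
Proof.
by move=> tf tg; rewrite -distN // -distD //; exact: testN.
Qed.

Lemma test_derive f : test_function f -> test_function f^`()%classic.
Proof.
move=> tf; have [L _ vf] := test_vanish tf; apply: (@vanish_test L).
  exact: smooth_derive (test_smooth tf).
exact: vanish_derive.
Qed.

Lemma test_affine f x t : 0 < t -> test_function f ->
  test_function (fun y => f ((y - x) / t)).
Proof.
move=> t0 tf; have [L _ vf] := test_vanish tf.
apply: vanish_test (vanish_affine t0 vf).
exact: smooth_comp_affine (test_smooth tf).
Qed.

Lemma test_sum n (F : 'I_n -> R -> R) : (forall i, test_function (F i)) ->
  test_function (fun x => \sum_(i < n) F i x).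
Proof.
elim: n F => [|n IH] F H.
  have -> : (fun x => \sum_(i < 0) F i x) = fun=> 0.
    by apply/funext => x; rewrite big_ord0.
  exact: test_cst0.
have -> : (fun x => \sum_(i < n.+1) F i x) =
    (fun x => \sum_(i < n) F (widen_ord (leqnSn n) i) x + F ord_max x).
  by apply/funext => x; rewrite big_ord_recr.
by apply: testD => //; apply: IH.
Qed.

Lemma dist_sum n (F : 'I_n -> R -> R) : (forall i, test_function (F i)) ->
  T (fun x => \sum_(i < n) F i x) = \sum_(i < n) T (F i).
Proof.
elim: n F => [|n IH] F H.
  have -> : (fun x => \sum_(i < 0) F i x) = fun=> 0.
    by apply/funext => x; rewrite big_ord0.
  by rewrite dist0 big_ord0.
have -> : (fun x => \sum_(i < n.+1) F i x) =
    (fun x => \sum_(i < n) F (widen_ord (leqnSn n) i) x + F ord_max x).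
  by apply/funext => x; rewrite big_ord_recr.
by rewrite distD ?IH ?big_ord_recr //; apply: test_sum => i.
Qed.

Lemma dilationE x t f : 0 < t -> dilation T x t f = t^-1 * T (fun y => f ((y - x) / t)).
Proof. by move=> t0; rewrite /dilation gtr0_norm. Qed.

End Linear.

Lemma smooth_MVT f x y : smooth f -> exists z, f y - f x = f^`()%classic z * (y - x).
Proof.
move=> sf; have H a b : a < b -> exists z, f b - f a = f^`()%classic z * (b - a).
  move=> ab; have [||z _ ->] := @MVT _ f f^`()%classic a b ab.
  - by move=> z _; exact: smooth_is.
  - exact: continuous_subspaceT (smooth_cont sf).
  - by exists z.
have [/H//|/H[z Hz]|->] := ltgtP x y; last by exists y; rewrite !subrr mulr0.
by exists z; rewrite -opprB Hz; ring.
Qed.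

(** Two applications of the mean value theorem, so the constant lacks the factor 1/2. The increment
    is [- s] because moving the centre of a dilation by [h] moves the argument by [- h / t]. *)
Lemma smooth_taylor f B x s : smooth f ->
  (forall z, `|f^`()%classic^`()%classic z| <= B) ->
  `|f (x - s) - f x + s * f^`()%classic x| <= B * s ^+ 2.
Proof.
move=> sf HB.
have B0 : 0 <= B := le_trans (normr_ge0 _) (HB 0).
have H a b : a < b -> exists2 z, a < z < b & f b - f a = f^`()%classic z * (b - a).
  move=> ab; have [||z zab ->] := @MVT _ f f^`()%classic a b ab.
  - by move=> z _; exact: smooth_is.
  - exact: continuous_subspaceT (smooth_cont sf).
  - by exists z => //; move: zab; rewrite in_itv.
have [z Hz1 Hz2] : exists2 z, `|z - x| <= `|s| & f (x - s) - f x = f^`()%classic z * - s.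
  have [s0|s0|s0] := ltgtP s 0.
  - have [|z /andP[z1 z2] Hz] := H x (x - s); first by lra.
    exists z; last by rewrite Hz; ring.
    by rewrite (ltr0_norm s0) ger0_norm; lra.
  - have [|z /andP[z1 z2] Hz] := H (x - s) x; first by lra.
    exists z; last by rewrite -opprB Hz; ring.
    by rewrite (gtr0_norm s0) ler0_norm; lra.
  - by exists x; rewrite ?subrr ?normr0 // s0 subr0 subrr oppr0 mulr0.
have [w Hw] := smooth_MVT x z (smooth_derive sf).
have -> : f (x - s) - f x + s * f^`()%classic x = - s * (f^`()%classic z - f^`()%classic x).
  by rewrite Hz2; ring.
rewrite Hw !normrM normrN -[s ^+ 2]real_normK ?num_real // expr2 mulrCA.
by rewrite ler_pM ?mulr_ge0 // ler_wpM2l.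
Qed.

(** The first-order error is [t^-1] times [T] applied to the Taylor remainder [r], whose derivatives
    up to order [m] are of size [h ^+ 2] on a fixed compact set; the seminorm estimate for [T]
    carries this over. *)
Lemma is_derive_dilation T f x t : Defs.distribution T -> test_function f -> 0 < t ->
  is_derive x 1 (fun x => dilation T x t f) (- t^-1 * dilation T x t f^`()%classic).
Proof.
move=> HT tf t0; have sf := test_smooth tf; have [L L0 vf] := test_vanish tf.
have [C [m [C0 HC]]] := dist_bound (`|x| + 1 + t * L) HT.
have [B B0 HB] := derive1n_bounded m.+2 sf vf.
(* Summing over all orders [k <= m] bounds every power of [t^-1] at once, whether [t] is below or
   above 1. *)
pose K := \sum_(k < m.+1) t^-1 ^+ k * (B * t^-1 ^+ 2).
have tV0 : 0 <= t^-1 by rewrite invr_ge0 ltW.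
have K0 : 0 <= K.
  by apply: sumr_ge0 => k _; rewrite mulr_ge0 ?mulr_ge0 ?exprn_ge0.
apply: (@is_derive_quad _ _ _ _ (t^-1 * (C * K))) => h h1.
rewrite !dilationE //.
have tx u : test_function (fun y => f ((y - u) / t)) by exact: test_affine.
have tx' u : test_function (fun y => f^`()%classic ((y - u) / t)).
  exact: (test_affine u t0 (test_derive tf)).
pose r y := f ((y - (x + h)) / t) - f ((y - x) / t) + (h / t) * f^`()%classic ((y - x) / t).
have -> : t^-1 * T (fun y => f ((y - (x + h)) / t)) - t^-1 * T (fun y => f ((y - x) / t)) -
    h * (- t^-1 * (t^-1 * T (fun y => f^`()%classic ((y - x) / t)))) = t^-1 * T r.
  have -> : T r = T (fun y => f ((y - (x + h)) / t)) - T (fun y => f ((y - x) / t)) +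
      (h / t) * T (fun y => f^`()%classic ((y - x) / t)).
    rewrite -(distZ HT _ (tx' x)) -(distB HT (tx _) (tx _)).
    rewrite -(distD HT _ (testZ _ (tx' x))); first by [].
    exact: testD (tx _) (testN (tx _)).
  by ring.
rewrite normrM (ger0_norm tV0) -!mulrA; apply: ler_wpM2l => //.
have -> : C * (K * h ^+ 2) = C * (h ^+ 2 * K) by ring.
apply: HC.
- apply: smoothD; last by apply: smoothZ; exact: test_smooth (tx' x).
  by apply: smoothB; exact: test_smooth (tx _).
- have v u : `|u| <= `|x| + 1 -> vanish (`|x| + 1 + t * L) (fun y => f ((y - u) / t)).
    by move=> ux; apply: vanish_le (vanish_affine t0 vf); rewrite lerD2r.
  have xh : `|x + h| <= `|x| + 1 by rewrite (le_trans (ler_normD _ _)) // lerD2l.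
  apply: vanishD; first by apply: vanishD; [exact: v|apply: vanishN; apply: v; rewrite lerDl].
  apply: vanishM; apply: vanish_le (vanish_affine t0 (vanish_derive vf)).
  by rewrite lerD2r lerDl.
- by rewrite mulr_ge0 ?sqr_ge0.
- move=> k y km.
  have -> : r^`(k)%classic y = t^-1 ^+ k * (f^`(k)%classic ((y - x) / t - h / t)
      - f^`(k)%classic ((y - x) / t) + (h / t) * f^`(k)%classic^`()%classic ((y - x) / t)).
    rewrite /r derive1nD; last 2 first.
    - by apply: smoothB; exact: test_smooth (tx _).
    - by apply: smoothZ; exact: test_smooth (tx' x).
    rewrite derive1nD; last 2 first.
    - exact: test_smooth (tx _).
    - by apply: smoothN; exact: test_smooth (tx _).
    have -> : (fun x0 => - f ((x0 - x) / t)) = (fun x0 => -1 * f ((x0 - x) / t)).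
      by apply/funext => z; rewrite mulN1r.
    rewrite (@derive1nZ _ (-1) _ k (test_smooth (tx x))).
    rewrite (@derive1nZ _ (h / t) _ k (test_smooth (tx' x))).
    rewrite !derive1n_affine //; last exact: smooth_derive.
    rewrite -derive1nS derive1Sn.
    have -> : (y - (x + h)) / t = (y - x) / t - h / t by ring.
    by ring.
  rewrite normrM ger0_norm ?exprn_ge0 //.
  have Hk : (k < m.+1)%N by [].
  apply: le_trans (_ : h ^+ 2 * (t^-1 ^+ k * (B * t^-1 ^+ 2)) <= _).
    have -> : h ^+ 2 * (t^-1 ^+ k * (B * t^-1 ^+ 2)) = t^-1 ^+ k * (B * (h / t) ^+ 2).
      by rewrite exprMn; ring.
    apply: ler_wpM2l; first exact: exprn_ge0.
    apply: smooth_taylor; first exact: smooth_derive1n.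
    by move=> z; rewrite -!derive1nS; apply: HB; rewrite !ltnS.
  apply: ler_wpM2l; first exact: sqr_ge0.
  rewrite /K (bigD1 (Ordinal Hk)) //= lerDl; apply: sumr_ge0 => i _.
  by rewrite mulr_ge0 ?mulr_ge0 ?exprn_ge0.
Qed.

Lemma dilation_cont T f t : Defs.distribution T -> test_function f -> 0 < t ->
  continuous (fun x => dilation T x t f).
Proof. by move=> HT tf t0 x; exact: is_derive_cont (is_derive_dilation x HT tf t0). Qed.

(** A centre moving with speed [l] in [t] amounts to a fixed centre and a shifted test function:
    bounds on a cone are bounds for a family of shifted bumps at its vertex. *)
Lemma dilation_shift T f x t l : 0 < t ->
  dilation T (x + l * t) t f = dilation T x t (fun y => f (y - l)).
Proof.
move=> t0; rewrite !dilationE //; congr (_ * T _); apply/funext => y; congr f.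
by rewrite opprD addrA mulrDl mulNr mulfK ?gt_eqF.
Qed.

End DistributionBasics.

(** * Mollification *)

Section Mollification.
Context {R : realType}.
Implicit Types (T : (R -> R) -> R) (f g : R -> R) (L x t : R).

Lemma norm_mul_le (x y A B : R) : `|x| <= A -> `|y| <= B -> `|x * y| <= A * B.
Proof. by move=> xA yB; rewrite normrM ler_pM. Qed.

Lemma is_derive_lipschitz f f' (K : R) : (forall x, is_derive x 1 f (f' x)) ->
  (forall x, `|f' x| <= K) -> forall x y, `|f y - f x| <= K * `|y - x|.
Proof.
move=> df HK x y; wlog xy : x y / x < y.
  move=> H; have [/H//|/H H'|->] := ltgtP x y; last by rewrite !subrr normr0 mulr0.
  by rewrite distrC [`|y - x|]distrC.
have [|z _ ->] := @MVT _ f f' x y xy.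
- by apply: continuous_subspaceT => z; exact: is_derive_cont (df z).
- by rewrite normrM ler_wpM2r.
Qed.

Lemma riemann_sum f (K a h : R) n : 0 <= h -> continuous f ->
  (forall x y, `|f y - f x| <= K * `|y - x|) ->
  `|\sum_(i < n) h * f (a + i%:R * h) - cint a (a + n%:R * h) f| <= n%:R * (K * h ^+ 2).
Proof.
move=> h0 cf HK; elim: n => [|n IH].
  by rewrite big_ord0 !mul0r addr0 /cint set_itv1 Rintegral_set1 subrr normr0.
have K0 : 0 <= K.
  by have := le_trans (normr_ge0 _) (HK 0 1); rewrite subr0 normr1 mulr1.
rewrite big_ord_recr /= -(@cint_chasles _ f a (a + n%:R * h) (a + n.+1%:R * h)) //; last 2 first.
- by rewrite lerDl mulr_ge0.
- by rewrite lerD2l ler_wpM2r // ler_nat.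
have le1 : a + n%:R * h <= a + n.+1%:R * h by rewrite lerD2l ler_wpM2r // ler_nat.
have E : a + n.+1%:R * h - (a + n%:R * h) = h by rewrite -natr1; ring.
have H2 : `|h * f (a + n%:R * h) - cint (a + n%:R * h) (a + n.+1%:R * h) f| <= K * h ^+ 2.
  have -> : h * f (a + n%:R * h) = cint (a + n%:R * h) (a + n.+1%:R * h) (fun=> f (a + n%:R * h)).
    by rewrite cint_cst // E mulrC.
  rewrite -cintB //; last exact: cst_continuous.
  have -> : K * h ^+ 2 = (K * h) * (a + n.+1%:R * h - (a + n%:R * h)) by rewrite E; ring.
  apply: cint_bound => //; first by apply: contB cf; exact: cst_continuous.
  move=> x /andP[x1 x2]; apply: (le_trans (HK _ _)); apply: ler_wpM2l => //.
  by rewrite ler0_norm; lra.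
have -> : n.+1%:R * (K * h ^+ 2) = n%:R * (K * h ^+ 2) + K * h ^+ 2.
  by rewrite -natr1; ring.
set S := \sum_(i < n) _ in IH *; set A := cint a _ f in IH *.
set y := h * f _ in H2 *; set D := cint _ _ f in H2 *.
have -> : S + y - (A + D) = (S - A) + (y - D) by ring.
by rewrite (le_trans (ler_normD _ _)) // lerD.
Qed.

Lemma is_derive_kernel g (z s x : R) : smooth g ->
  is_derive x 1 (fun x => g ((z - x) / s)) (- s^-1 * g^`()%classic ((z - x) / s)).
Proof.
move=> sg; have -> : (fun x => g ((z - x) / s)) = (fun x => g ((x - z) / - s)).
  by apply/funext => y; congr g; rewrite invrN; ring.
rewrite mulrC; have -> : (z - x) / s = (x - z) / - s by rewrite invrN; ring.
by rewrite -invrN; apply: is_derive_comp; [exact: smooth_is|exact: is_derive_affine].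
Qed.

Lemma conv_parts f g (L M z s : R) : smooth f -> smooth g -> vanish L f -> L < M -> 0 <= M ->
  cint (- M) M (fun x => f x * (s^-1 * g^`()%classic ((z - x) / s))) =
  cint (- M) M (fun x => f^`()%classic x * g ((z - x) / s)).
Proof.
move=> sf sg vf LM M0; have MM : - M <= M by rewrite ge0_cp.
have sk (k : R -> R) : smooth k -> smooth (fun x => k ((z - x) / s)).
  move=> H; have -> : (fun x => k ((z - x) / s)) = (fun x => k ((x - z) / - s)).
    by apply/funext => y; congr k; rewrite invrN; ring.
  exact: smooth_comp_affine.
have c1 : continuous (fun x => f^`()%classic x * g ((z - x) / s)).
  by apply: smooth_cont; apply: smoothM; [exact: smooth_derive|exact: sk].
have c2 : continuous (fun x => f x * (s^-1 * g^`()%classic ((z - x) / s))).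
  by apply: smooth_cont; apply: (smoothM sf); apply: smoothZ; apply: sk; exact: (smooth_derive sg).
apply/eqP; rewrite eq_sym -subr_eq0 -cintB //.
have H x : - M <= x <= M -> is_derive x 1 (fun x => f x * g ((z - x) / s))
   (f^`()%classic x * g ((z - x) / s) - f x * (s^-1 * g^`()%classic ((z - x) / s))).
  move=> _; rewrite -mulrN -mulNr; apply: is_derive_mul; last exact: is_derive_kernel.
  exact: smooth_is.
rewrite (cint_FTC MM _ H); last exact: contB c1 c2.
rewrite !vf ?normrN ?ger0_norm //; apply/eqP; ring.
Qed.

(** The [k]-th derivative of a bump at scale [s] costs a factor [s^-1 ^+ k]. Moving it onto [f]
    shows that mollification approximates each derivative of [f] with an error linear in [s]. *)
Lemma conv_parts_n f (L M z s : R) k : smooth f -> vanish L f -> L < M -> 0 <= M ->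
  cint (- M) M (fun x => f x * (s^-1 ^+ k * psi^`(k)%classic ((z - x) / s))) =
  cint (- M) M (fun x => f^`(k)%classic x * psi ((z - x) / s)).
Proof.
move=> sf vf LM M0; elim: k f sf vf => [|k IH] f sf vf.
  by apply: eq_cint => x _; rewrite expr0 mul1r !derive1n0.
rewrite [f^`(k.+1)%classic]derive1Sn -IH; last 2 first.
- exact: smooth_derive.
- exact: vanish_derive.
have spsi : smooth (fun x => s^-1 ^+ k * psi^`(k)%classic x).
  by apply: smoothZ; exact: smooth_derive1n smooth_psi.
rewrite -(conv_parts z s sf spsi vf LM M0); apply: eq_cint => x _; congr (_ * _).
have -> : (fun x0 => s^-1 ^+ k * psi^`(k)%classic x0)^`()%classic =
    (fun x0 => s^-1 ^+ k * psi^`(k)%classic^`()%classic x0).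
  apply/funext => y; apply: derive1_is; apply: is_derive_scal; apply: smooth_is.
  exact: smooth_derive1n smooth_psi.
by rewrite -derive1nS exprS; ring.
Qed.

Lemma conv_approx f (L M z s B : R) : smooth f -> vanish L f -> L < M -> 0 <= M -> 0 < s ->
  (forall x, `|f^`()%classic x| <= B) ->
  `|cint (- M) M (fun x => f x * (s^-1 * psi ((z - x) / s))) - f z| <= B * s.
Proof.
move=> sf vf LM M0 s0 HB.
have sg : smooth (fun x => f x * (s^-1 * psi ((z - x) / s))).
  apply: (smoothM sf); apply: smoothZ.
  have -> : (fun x => psi ((z - x) / s)) = (fun x => psi ((x - z) / s)).
    by apply/funext => y; rewrite -psiN; congr psi; ring.
  exact: smooth_comp_affine smooth_psi.
set g := (fun x => f x * _) in sg *.
have vg x : ~~ (- M <= x <= M) -> g x = 0.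
  by move=> /out_norm Mx; rewrite /g vf ?mul0r // (lt_trans LM).
have vg' x : ~~ (z + s * -1 <= x <= z + s * 1) -> g x = 0.
  move=> H; rewrite /g psi0 ?mulr0 //; rewrite normrM normfV (gtr0_norm s0).
  rewrite ltr_pdivlMr // mul1r; apply: out_norm; apply: contra H => /andP[h1 h2].
  by apply/andP; split; lra.
rewrite -(Rintegral_cint vg) (Rintegral_cint vg') cint_subst //; last exact: smooth_cont.
have cz : continuous (fun y => f (z + s * y)) by apply: continuous_lin; exact: smooth_cont.
have cp := smooth_cont (@smooth_psi R).
rewrite -cintZ; last by apply: continuous_lin; exact: smooth_cont.
have -> : f z = cint (-1) 1 (fun y => f z * psi y) by rewrite cintZ // int_psi mulr1.
have -> : cint (-1) 1 (fun x => s * g (z + s * x)) = cint (-1) 1 (fun y => f (z + s * y) * psi y).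
  apply: eq_cint => y _; rewrite /g; have -> : (z - (z + s * y)) / s = - y.
    by field; rewrite gt_eqF.
  by rewrite psiN; field; rewrite gt_eqF.
have c1 : continuous (fun y => f (z + s * y) * psi y).
  exact: contM cz cp.
have c2 : continuous (fun y => f z * psi y).
  exact: contZ.
have H y : -1 <= y <= 1 -> `|f (z + s * y) * psi y - f z * psi y| <= B * s * psi y.
  move=> y1; rewrite -mulrBl normrM (ger0_norm (psi_ge0 _)); apply: ler_wpM2r; first exact: psi_ge0.
  have /is_derive_lipschitz := fun x => smooth_is x sf.
  move=> /(_ _ HB z (z + s * y)) /le_trans; apply.
  rewrite addrAC subrr add0r normrM (gtr0_norm s0) ler_wpM2l //.
    exact: le_trans (normr_ge0 _) (HB 0).
  by rewrite ger_pMr // ler_norml.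
have c3 : continuous (fun y => B * s * psi y).
  exact: contZ.
have c4 : continuous (fun y => - (B * s) * psi y).
  exact: contZ.
rewrite -cintB // ler_norml; apply/andP; split.
  have -> : - (B * s) = cint (-1) 1 (fun y => - (B * s) * psi y) by rewrite cintZ // int_psi mulr1.
  apply: cint_le => //; first exact: contB c1 c2.
  by move=> y /H; rewrite ler_norml mulNr => /andP[].
have -> : B * s = cint (-1) 1 (fun y => B * s * psi y) by rewrite cintZ // int_psi mulr1.
apply: cint_le => //; first exact: contB c1 c2.
by move=> y /H; rewrite ler_norml => /andP[].
Qed.

Lemma le_all_eps (x y C : R) : (forall e, 0 < e -> x <= y + C * e) -> x <= y.
Proof.
move=> H; apply/ler_addgt0Pr => e e0; have [C0|C0] := leP C 0.
  by apply: (le_trans (H e e0)); rewrite lerD2l (le_trans _ (ltW e0)) // mulr_le0_ge0 // ltW.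
have := H (e / C); rewrite mulrCA divff ?gt_eqF // mulr1; apply; exact: divr_gt0.
Qed.

(* A Riemann sum for the integral is [T] applied to a sum of shifted bumps, which
   approximates [f] together with its derivatives. *)
Lemma mollified_pairing T f L M : Defs.distribution T -> smooth f -> vanish L f ->
  L < M -> 0 <= M -> exists C : R, forall s, 0 < s -> s <= 1 ->
  `|cint (- M) M (fun x => f x * dilation T x s psi) - T f| <= C * s.
Proof.
move=> HT sf vf LM M0; have MM : - M <= M by rewrite ge0_cp.
have spsi := @smooth_psi R.
have tpsi : test_function (@psi R) := vanish_test spsi (fun x => @psi0 R x).
have tf := vanish_test sf vf.
have [C [m [C0 HC]]] := dist_bound (M + 1) HT.
have [B B0 HB] := derive1n_bounded m.+1 sf vf.
have [B' B'0 HB'] := @derive1n_bounded _ 1 psi m.+1 spsi (fun x => @psi0 R x).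
exists (C * B) => s s0 s1.
have sV0 : 0 <= s^-1 by rewrite invr_ge0 ltW.
have sV1 : 1 <= s^-1 by rewrite invf_ge1.
pose dT x := dilation T x s psi.
pose dT' x := - s^-1 * dilation T x s psi^`()%classic.
have DdT x : is_derive x 1 dT (dT' x) by exact: is_derive_dilation.
have cdT' : continuous dT'.
  exact: (@contZ _ (- s^-1) _ (dilation_cont HT (test_derive tpsi) s0)).
have cdT : continuous dT by exact: dilation_cont.
pose g x := f x * dT x.
pose g' x := f^`()%classic x * dT x + f x * dT' x.
have Dg x : is_derive x 1 g (g' x) by apply: is_derive_mul; exact: smooth_is.
have cg : continuous g by move=> x; exact: is_derive_cont (Dg x).
have cg' : continuous g'.
  apply: contD; apply: contM => //; last exact: smooth_cont.
  exact: (smooth_cont (smooth_derive sf)).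
have vg' : vanish L g'.
  by move=> x Lx; rewrite /g' (vanish_derive vf) // vf // !mul0r addr0.
have [K K0 HK] := vanish_bounded cg' vg'.
have [S S0 HS] : exists2 S : R, 0 <= S & forall k, (k <= m.+2)%N -> s^-1 ^+ k <= S.
  by exists (s^-1 ^+ m.+2) => [|k km]; [exact: exprn_ge0|exact: ler_weXn2l].
pose K' := B * (S * B') + B * (S * B').
have K'0 : 0 <= K' by apply: addr_ge0; apply: mulr_ge0 => //; exact: mulr_ge0.
(* The scale [s] stays fixed while the mesh shrinks: the Lipschitz constants [K] and [K'] may blow
   up as [s] tends to 0, but they only occur in the term that disappears as [n] grows. *)
suff H n : `|cint (- M) M g - T f| <= C * B * s + ((K + C * K') * (2 * M) ^+ 2) * n.+1%:R^-1.
  apply: (@le_all_eps _ _ ((K + C * K') * (2 * M) ^+ 2)) => e e0.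
  have [n _ Hn] := near_infty_natSinv_lt (PosNum e0).
  apply: (le_trans (H n)); rewrite lerD2l ler_wpM2l //.
    by rewrite mulr_ge0 ?exprn_ge0 ?addr_ge0 ?mulr_ge0.
  by apply: ltW; exact: (Hn n (leqnn n)).
pose h : R := (2 * M) / n.+1%:R.
have h0 : 0 <= h by rewrite divr_ge0 // mulr_ge0.
have nh : n.+1%:R * h = 2 * M by rewrite /h mulrCA divff ?mulr1.
have MnM : - M + n.+1%:R * h = M by rewrite nh; ring.
have nhh (k : R) : n.+1%:R * (k * h ^+ 2) = k * (2 * M) ^+ 2 * n.+1%:R^-1.
  by rewrite /h; field.
pose pt (i : 'I_n.+1) := - M + i%:R * h.
pose Rn z := \sum_(i < n.+1) (h * f (pt i) * s^-1) * psi ((z - pt i) / s).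
have tRi (i : 'I_n.+1) : test_function (fun z => (h * f (pt i) * s^-1) * psi ((z - pt i) / s)).
  exact: testZ _ (test_affine (pt i) s0 tpsi).
have TRn : T Rn = \sum_(i < n.+1) h * g (pt i).
  rewrite /Rn (dist_sum HT tRi); apply: eq_bigr => i _.
  rewrite (distZ HT _ (test_affine (pt i) s0 tpsi)).
  by rewrite /g /dT dilationE; [ring|exact: s0].
have E1 : `|T Rn - cint (- M) M g| <= K * (2 * M) ^+ 2 * n.+1%:R^-1.
  have := @riemann_sum g K (- M) h n.+1 h0 cg (is_derive_lipschitz Dg HK).
  by rewrite MnM nhh TRn.
have pt_M i : `|pt i| <= M.
  rewrite /pt ler_norml lerDl mulr_ge0 //= -[leRHS]MnM lerD2l ler_wpM2r // ler_nat.
  by rewrite ltnW.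
have smk (k : R -> R) z : smooth k -> smooth (fun x => k ((z - x) / s)).
  move=> H; have -> : (fun x => k ((z - x) / s)) = (fun x => k ((x - z) / - s)).
    by apply/funext => y; congr k; rewrite invrN; ring.
  exact: smooth_comp_affine.
(* Derivative by derivative, the bump sum is within the Riemann error of the convolution of [f] with
   the bump, which in turn is within [B * s] of [f]. *)
have E2 : `|T (fun x => Rn x - f x)| <= C * (B * s + K' * (2 * M) ^+ 2 * n.+1%:R^-1).
  apply: HC.
  - by apply: smoothB sf; apply: smooth_sum => i; exact: test_smooth (tRi i).
  - apply: vanishD; last by apply: vanishN; apply: vanish_le vf; rewrite ltW // (lt_trans LM) // ltrDl.
    apply: vanish_sum => i; apply: vanishM.
    apply: vanish_le (vanish_affine s0 (fun x => @psi0 R x)).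
    by apply: lerD => //; rewrite mulr1.
  - apply: addr_ge0; first exact: mulr_ge0 B0 (ltW s0).
    by apply: mulr_ge0; [apply: mulr_ge0 => //; exact: sqr_ge0|rewrite invr_ge0].
  move=> k z km.
  have -> : (fun x => Rn x - f x)^`(k)%classic z =
     (\sum_(i < n.+1) h * (f (pt i) * (s^-1 ^+ k.+1 * psi^`(k)%classic ((z - pt i) / s))))
      - f^`(k)%classic z.
    have -> : (fun x => Rn x - f x) = (fun x => Rn x + -1 * f x).
      by apply/funext => y; rewrite mulN1r.
    rewrite derive1nD; last 2 first.
    - by apply: smooth_sum => i; exact: test_smooth (tRi i).
    - exact: smoothZ.
    rewrite (@derive1nZ _ (-1) _ k sf) mulN1r; congr (_ - _).
    rewrite /Rn derive1n_sum; last by move=> i; exact: test_smooth (tRi i).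
    apply: eq_bigr => i _.
    rewrite (@derive1nZ _ _ (fun z => psi ((z - pt i) / s)) k); last exact: smooth_comp_affine.
    by rewrite (@derive1n_affine _ _ k (pt i) s spsi) exprS; ring.
  pose q x := f x * (s^-1 ^+ k.+1 * psi^`(k)%classic ((z - x) / s)).
  pose q' x := f^`()%classic x * (s^-1 ^+ k.+1 * psi^`(k)%classic ((z - x) / s)) +
    f x * (s^-1 ^+ k.+1 * (- s^-1 * psi^`(k)%classic^`()%classic ((z - x) / s))).
  have Dq x : is_derive x 1 q (q' x).
    apply: is_derive_mul; first exact: smooth_is.
    by apply: is_derive_scal; apply: is_derive_kernel; exact: smooth_derive1n.
  have Hq x : `|q' x| <= K'.
    apply: (le_trans (ler_normD _ _)); apply: lerD.
      apply: norm_mul_le; first by have := HB 1%N x isT; rewrite derive1n1.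
      apply: norm_mul_le; last by apply: HB'; rewrite ltnW.
      by rewrite ger0_norm ?exprn_ge0 // HS // ltnS ltnW.
    apply: norm_mul_le; first by have := HB 0%N x isT; rewrite derive1n0.
    rewrite mulrA; apply: norm_mul_le; last by rewrite -derive1nS; exact: HB'.
    by rewrite mulrN normrN -exprSr ger0_norm ?exprn_ge0 // HS.
  have cq : continuous q by move=> x; exact: is_derive_cont (Dq x).
  have := @riemann_sum q K' (- M) h n.+1 h0 cq (is_derive_lipschitz Dq Hq).
  rewrite MnM nhh => E3.
  have E4 : `|cint (- M) M q - f^`(k)%classic z| <= B * s.
    have -> : cint (- M) M q = cint (- M) M (fun x => f^`(k)%classic x * (s^-1 * psi ((z - x) / s))).
      have -> : cint (- M) M q = s^-1 * cint (- M) M (fun x => f x * (s^-1 ^+ k * psi^`(k)%classic ((z - x) / s))).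
        rewrite -cintZ; first by apply: eq_cint => x _; rewrite /q exprS; ring.
        apply: smooth_cont; apply: (smoothM sf); apply: smoothZ; apply: smk.
        exact: smooth_derive1n.
      rewrite (conv_parts_n _ _ _ sf vf LM M0) -cintZ.
        by apply: eq_cint => x _; ring.
      by apply: smooth_cont; apply: smoothM; [exact: smooth_derive1n|exact: smk].
    have sfk : smooth f^`(k)%classic by exact: smooth_derive1n.
    have vfk : vanish L f^`(k)%classic by exact: vanish_derive1n.
    apply: (conv_approx _ sfk vfk LM M0 s0).
    by move=> x; rewrite -derive1nS; apply: HB; rewrite ltnS.
  set A := \sum_(i < _) _ in E3 *; set D := cint _ _ q in E3 E4.
  have -> : A - f^`(k)%classic z = (D - f^`(k)%classic z) + (A - D) by ring.
  by rewrite (le_trans (ler_normD _ _)) // lerD.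
rewrite (distB HT (test_sum tRi) tf) in E2.
have -> : cint (- M) M g - T f = - (T Rn - cint (- M) M g) + (T Rn - T f) by ring.
apply: (le_trans (ler_normD _ _)); rewrite normrN.
apply: (le_trans (lerD E1 E2)); rewrite le_eqVlt; apply/orP; left; apply/eqP; ring.
Qed.

End Mollification.

(** * A uniform bound by the gliding hump method *)

Section SmoothLimits.
Context {R : realType}.

Lemma norm_cvg_le (u : nat -> R) (l B : R) : u n @[n --> \oo] --> l ->
  (forall n, `|u n| <= B) -> `|l| <= B.
Proof.
move=> ul H; rewrite ler_norml; apply/andP; split.
  by apply: (cvgr_to_ge ul); apply: nearW => n; have := H n; rewrite ler_norml => /andP[].
by apply: (cvgr_to_le ul); apply: nearW => n; have := H n; rewrite ler_norml => /andP[].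
Qed.

(** The Taylor remainders of the [f_ n] are bounded by [B * h ^+ 2] uniformly in [n]. This passes to
    pointwise limits, so uniform convergence does not have to be established. *)
Lemma limit_derive (f_ : nat -> R -> R) (f g : R -> R) (B : R) : (forall n, smooth (f_ n)) ->
  (forall y, f_ n y @[n --> \oo] --> f y) ->
  (forall y, (f_ n)^`()%classic y @[n --> \oo] --> g y) ->
  (forall n y, `|(f_ n)^`()%classic^`()%classic y| <= B) ->
  forall y : R, is_derive y 1 f (g y).
Proof.
move=> sf cf cg HB y; apply: (@is_derive_quad _ _ _ _ B) => h _.
apply: (@norm_cvg_le (fun n => f_ n (y + h) - f_ n y - h * (f_ n)^`()%classic y)).
  apply: cvgB; first by apply: cvgB; exact: cf.
  by apply: cvgM; [exact: cvg_cst|exact: cg].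
move=> n; have := smooth_taylor y (- h) (sf n) (HB n).
by rewrite opprK sqrrN mulNr.
Qed.

Lemma smooth_limit (f_ : nat -> R -> R) (g : nat -> R -> R) : (forall n, smooth (f_ n)) ->
  (forall k y, (f_ n)^`(k)%classic y @[n --> \oo] --> g k y) ->
  (forall k, exists B : R, forall n y, `|(f_ n)^`(k)%classic y| <= B) ->
  smooth (g 0%N) /\ forall k, (g 0%N)^`(k)%classic = g k.
Proof.
move=> sf cf HB.
have D k (y : R) : is_derive y 1 (g k) (g k.+1 y).
  have [B HBk] := HB k.+2.
  apply: (@limit_derive (fun n => (f_ n)^`(k)%classic) _ _ B).
  - by move=> n; apply: smooth_derive1n; exact: sf.
  - by move=> z; exact: cf.
  - move=> z; have := cf k.+1 z; apply: cvg_trans; apply: near_eq_cvg.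
    by apply: nearW => n; rewrite derive1nS.
  - by move=> n z; rewrite -!derive1nS; exact: HBk.
have E k : (g 0%N)^`(k)%classic = g k.
  elim: k => [|k IH]; first by rewrite derive1n0.
  by rewrite derive1nS IH; apply/funext => y; apply: derive1_is; exact: D.
by split => // m x; rewrite E; have [] := D m x.
Qed.

End SmoothLimits.

(** * Series of small shifted bumps *)

Section BumpSeries.
Context {R : realType}.
Variables (c l e : nat -> R).
Hypotheses (ce : forall i, `|c i| <= e i) (l1 : forall i, `|l i| <= 1).
Hypotheses (e0 : forall i, 0 < e i) (eh : forall i, e i.+1 <= e i / 2) (e01 : e 0%N <= 1).

Let P n (y : R) : R := \sum_(i < n) c i * psi (y - l i).

Let smooth_shift (k : R) : smooth (fun y : R => psi (y - k)).
Proof.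
have -> : (fun y : R => psi (y - k)) = (fun y => psi ((y - k) / 1)).
  by apply/funext => y; rewrite divr1.
exact: smooth_comp_affine smooth_psi.
Qed.

Lemma smooth_bump_sum n : smooth (P n).
Proof. by apply: smooth_sum => i; apply: smoothZ; exact: smooth_shift. Qed.

Lemma vanish_bump_sum n : vanish 2 (P n).
Proof.
apply: vanish_sum => i; apply: vanishM => y y2; apply: psi0.
by have := lerB_dist y (l i); have := l1 i; lra.
Qed.

Lemma derive1n_bump_sum n k y :
  (P n)^`(k)%classic y = \sum_(i < n) c i * psi^`(k)%classic (y - l i).
Proof.
rewrite /P derive1n_sum; last by move=> i; apply: smoothZ; exact: smooth_shift.
apply: eq_bigr => i _; rewrite (@derive1nZ _ _ _ k (@smooth_shift (l i))); congr (_ * _).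
have -> : (fun y : R => psi (y - l i)) = (fun y => psi ((y - l i) / 1)).
  by apply/funext => z; rewrite divr1.
by rewrite (@derive1n_affine _ _ k (l i) 1 smooth_psi) invr1 expr1n mul1r mulr1.
Qed.

(** Halving gives [e k <= 2 * (e k - e k.+1)], so the bounds on the coefficients of the tail
    telescope. *)
Lemma bump_sum_tail (B : R) k : (forall y, `|psi^`(k)%classic y| <= B) -> forall n m y,
  `|(P (n + m))^`(k)%classic y - (P n)^`(k)%classic y| <= 2 * (e n - e (n + m)%N) * B.
Proof.
move=> HB n m y; elim: m => [|m IH]; first by rewrite addn0 !subrr normr0 mulr0 mul0r.
rewrite addnS !derive1n_bump_sum big_ord_recr /= -!derive1n_bump_sum.
rewrite addrAC; apply: (le_trans (ler_normD _ _)); apply: (le_trans (lerD IH (norm_mul_le (ce _) (HB _)))).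
rewrite -mulrDl; apply: ler_wpM2r; first exact: le_trans (normr_ge0 _) (HB 0).
by have := eh (n + m)%N; lra.
Qed.

Lemma e_pow n : e n <= 2^-1 ^+ n.
Proof.
elim: n => [|n IH]; first by rewrite expr0.
by apply: (le_trans (eh n)); rewrite exprSr ler_pM2r ?invr_gt0.
Qed.

Lemma e_small n : e n <= n.+1%:R^-1.
Proof.
apply: (le_trans (e_pow n)); rewrite exprVn lef_pV2 ?posrE ?exprn_gt0 //.
by rewrite -natrX ler_nat ltn_expl.
Qed.

(** The tail after [n] terms is controlled by [e n] in every derivative. As [e n] may be chosen
    after the first [n] bumps, each step of the gliding hump can protect itself against all later
    ones. *)
Lemma bump_series : exists Th : R -> R, [/\ smooth Th, vanish 2 Th &
  forall k (B : R), (forall y, `|psi^`(k)%classic y| <= B) -> forall n y,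
    `|Th^`(k)%classic y - (P n)^`(k)%classic y| <= 2 * e n * B].
Proof.
have tail (B : R) k : (forall y, `|psi^`(k)%classic y| <= B) -> forall n p y, (n <= p)%N ->
    `|(P p)^`(k)%classic y - (P n)^`(k)%classic y| <= 2 * e n * B.
  move=> HB n p y np; rewrite -(subnKC np); apply: (le_trans (bump_sum_tail HB _ _ _)).
  apply: ler_wpM2r; first exact: le_trans (normr_ge0 _) (HB 0).
  by rewrite ler_pM2l // gerBl ltW.
have HB k : exists2 B : R, 0 <= B & forall y, `|psi^`(k)%classic y| <= B.
  exact: vanish_bounded (smooth_cont (smooth_derive1n smooth_psi))
    (vanish_derive1n k (fun x => @psi0 R x)).
have cv k y : exists g : R, (P n)^`(k)%classic y @[n --> \oo] --> g.
  have [B B0 HBk] := HB k.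
  suff : cvgn (fun n => (P n)^`(k)%classic y) by move=> /cvg_ex.
  apply/cauchy_cvgP; apply: cauchy_exP => eps eps0.
  pose d := eps / (2 * B + 1).
  have d0 : 0 < d by rewrite divr_gt0 // ltr_wpDl // mulr_ge0.
  have [n _ Hn] := near_infty_natSinv_lt (PosNum d0).
  exists ((P n)^`(k)%classic y); exists n => // p /= np.
  rewrite /ball /= distrC; apply: le_lt_trans (tail B k HBk n p y np) _.
  have := e_small n; have := Hn n (leqnn n) => /= h1 h2.
  have h3 : e n < d by apply: le_lt_trans h2 h1.
  apply: le_lt_trans (_ : e n * (2 * B + 1) < _); first by have := ltW (e0 n); nra.
  by rewrite -ltr_pdivlMr // ltr_wpDl // mulr_ge0.
have [g Hg] : exists g : nat -> R -> R, forall k y, (P n)^`(k)%classic y @[n --> \oo] --> g k y.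
  by exists (fun k y => projT1 (cid (cv k y))) => k y; case: cid.
have [sg gE] : smooth (g 0%N) /\ forall k, (g 0%N)^`(k)%classic = g k.
  apply: (smooth_limit smooth_bump_sum Hg) => k; have [B B0 HBk] := HB k.
  exists (2 * e 0%N * B) => n y; have := tail B k HBk 0%N n y (leq0n n).
  by rewrite [(P 0)^`(k)%classic y]derive1n_bump_sum big_ord0 subr0.
exists (g 0%N); split => //.
  move=> y y2; have := Hg 0%N y.
  rewrite (_ : (fun n => _) = (fun=> 0)); last first.
    by apply/funext => n; rewrite derive1n0 vanish_bump_sum.
  by move=> /cvg_lim <- //; rewrite lim_cst.
move=> k B HBk n y; rewrite gE.
have H : (P (n + p))^`(k)%classic y - (P n)^`(k)%classic y @[p --> \oo] --> g k y - (P n)^`(k)%classic y.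
  apply: cvgB; last exact: cvg_cst.
  have := Hg k y; rewrite -(cvg_shiftn n) => H; apply: cvg_trans H.
  by apply: near_eq_cvg; apply: nearW => p; rewrite addnC.
by apply: (norm_cvg_le H) => p; apply: tail => //; rewrite leq_addr.
Qed.

End BumpSeries.

(** * Uniform bounds on cones over a closed set *)

Section ConeBound.
Context {R : realType}.
Variable T : (R -> R) -> R.
Hypothesis HT : Defs.distribution T.

Lemma tpsi : test_function (@psi R).
Proof. exact: vanish_test smooth_psi (fun x => @psi0 R x). Qed.

Lemma test_shift (f : R -> R) k : test_function f -> test_function (fun y => f (y - k)).
Proof.
move=> tf; have -> : (fun y : R => f (y - k)) = (fun y => f ((y - k) / 1)).
  by apply/funext => y; rewrite divr1.
exact: test_affine.
Qed.

Lemma dilationD x t f g : 0 < t -> test_function f -> test_function g ->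
  dilation T x t (fun y => f y + g y) = dilation T x t f + dilation T x t g.
Proof.
move=> t0 tf tg; rewrite !dilationE // -mulrDr; congr (_ * _).
have := distD HT (test_affine x t0 tf) (test_affine x t0 tg). exact.
Qed.

Lemma dilationZ x t c f : 0 < t -> test_function f ->
  dilation T x t (fun y => c * f y) = c * dilation T x t f.
Proof.
move=> t0 tf; rewrite !dilationE // mulrCA; congr (_ * _).
have := distZ HT c (test_affine x t0 tf). exact.
Qed.

Lemma dilation_bound (A L : R) : 0 <= L -> exists (C : R) (m : nat), 0 <= C /\
  forall x t rho B, `|x| <= A -> 0 < t -> t <= 1 -> smooth rho -> vanish L rho -> 0 <= B ->
  (forall (k : nat) y, (k <= m)%N -> `|rho^`(k)%classic y| <= B) ->
  `|dilation T x t rho| <= C * t^-1 ^+ m.+1 * B.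
Proof.
move=> L0; have [C [m [C0 HC]]] := dist_bound (A + L) HT; exists C, m; split => //.
move=> x t rho B xA t0 t1 sr vr B0 HB.
have tV0 : 0 <= t^-1 by rewrite invr_ge0 ltW.
have tV1 : 1 <= t^-1 by rewrite invf_ge1.
rewrite dilationE // normrM (ger0_norm tV0).
have -> : C * t^-1 ^+ m.+1 * B = t^-1 * (C * (t^-1 ^+ m * B)) by rewrite exprS; ring.
apply: ler_wpM2l => //; apply: HC.
- exact: smooth_comp_affine.
- by apply: vanish_le (vanish_affine t0 vr); rewrite lerD // ler_piMl.
- by rewrite mulr_ge0 // exprn_ge0.
- move=> k y km; rewrite (@derive1n_affine _ _ k x t sr); apply: norm_mul_le; last exact: HB.
  by rewrite ger0_norm ?exprn_ge0 // ler_weXn2l.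
Qed.

Variable S : set R.
Hypothesis clS : closed S.
Hypothesis bdd : forall x f, S x -> test_function f -> exists (N tau : R), 0 < tau /\
  forall t, 0 < t < tau -> `|dilation T x t f| <= N.

Variable x0 : R.
Hypothesis Sx0 : S x0.

Hypothesis neg : forall x r N tau, S x -> 0 < r -> 0 < tau ->
  exists x' l t, [/\ S x', `|x' - x| < r, `|l| <= 1, 0 < t < tau &
     N < `|dilation T (x' + l * t) t psi|].

(* Gliding hump: were [neg] true, a series of small shifted bumps chosen one after the
   other would sum to a test function whose dilations at a limit point of [S] are
   unbounded, against [bdd]. *)
Lemma hump_step : exists (B : R) (m : nat), (forall (k : nat) y, (k <= m)%N -> `|psi^`(k)%classic y| <= B) /\
  forall (n : nat) (x r e : R) th, S x -> `|x - x0| + r <= 1 -> 0 < r -> 0 < e ->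
  smooth th -> vanish 2 th ->
  exists x' r' e' c l t,
   [/\ [/\ S x', 0 < r', r' <= r / 2 & `|x' - x| <= r / 2], 0 < e', e' <= e / 2,
       [/\ `|c| <= e, `|l| <= 1 & 0 < t < n.+1%:R^-1] &
    forall rho, smooth rho -> vanish 2 rho ->
      (forall (k : nat) y, (k <= m)%N -> `|rho^`(k)%classic y| <= 2 * e' * B) ->
      forall x'', `|x'' - x'| <= r' ->
        n%:R <= `|dilation T x'' t (fun y => th y + c * psi (y - l) + rho y)|].
Proof.
have [C [m [C0 HC]]] := @dilation_bound (`|x0| + 1) 2 (ltW (@ltr0n R 2)).
have [B B0 HB] := @derive1n_bounded _ 1 psi m (@smooth_psi R) (fun x => @psi0 R x).
exists B, m; split => // n x r e th Sx xr r0 e0 sth vth.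
have [|||x' [l [t [Sx' xx' l1 /andP[t0 tn] Hd]]]] := neg (x := x) (r := r / 2) (n.+1%:R / e) (tau := n.+1%:R^-1) => //.
- by rewrite divr_gt0.
have t1 : t <= 1 by rewrite (le_trans (ltW tn)) // invf_le1 // ler1n.
have tth : test_function th := vanish_test sth vth.
have tps := test_shift l tpsi.
rewrite dilation_shift // in Hd.
set d := dilation _ _ _ _ in Hd; pose A := dilation T x' t th.
(* The sign of [c = e] or [c = - e] is chosen so that [A] and [c * d] do not cancel; then the sum is
   at least [e] times the absolute value of [d]. *)
have [c ce Hc] : exists2 c, `|c| <= e & n.+1%:R < `|A + c * d|.
  have H : n.+1%:R < e * `|d| by rewrite mulrC -ltr_pdivrMr.
  have [Ad|Ad] := leP 0 (A * d).
    exists e; first by rewrite gtr0_norm.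
    apply: (lt_le_trans H); rewrite -(@ler_pXn2r _ 2) ?nnegrE ?mulr_ge0 ?(ltW e0) //.
    by rewrite exprMn !real_normK ?num_real //; nra.
  exists (- e); first by rewrite normrN gtr0_norm.
  apply: (lt_le_trans H); rewrite -(@ler_pXn2r _ 2) ?nnegrE ?mulr_ge0 ?(ltW e0) //.
  by rewrite exprMn !real_normK ?num_real //; nra.
pose th' y := th y + c * psi (y - l).
have tth' : test_function th' := testD tth (testZ c tps).
have Hc' : n.+1%:R < `|dilation T x' t th'|.
  by rewrite (dilationD _ t0 tth (testZ c tps)) (dilationZ _ _ t0 tps).
have [r1 r10 Hr1] : exists2 r1 : R, 0 < r1 & forall y, `|y - x'| < r1 -> n.+1%:R < `|dilation T y t th'|.
  have := @dilation_cont _ T th' t HT tth' t0 x'.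
  move=> /cvgrPdist_lt /(_ (`|dilation T x' t th'| - n.+1%:R)).
  rewrite subr_gt0 => /(_ Hc') /nbhs_ballP [r1 /= r10 H]; exists r1 => // y yx.
  have := H y; rewrite /ball /= distrC => /(_ yx).
  by have := lerB_dist (dilation T x' t th') (dilation T y t th'); lra.
(* With [e' <= q^-1], a later perturbation with derivatives at most [2 * e' * B] changes the
   dilation at scale [t] by at most 1, so a value above [n.+1] remains at least [n]. *)
pose q := C * t^-1 ^+ m.+1 * (2 * B) + 1.
have q0 : 0 <= C * t^-1 ^+ m.+1 * (2 * B).
  by rewrite !mulr_ge0 ?exprn_ge0 // invr_ge0 ltW.
have q1 : 0 < q by rewrite ltr_wpDl.
exists x', (Num.min (r / 2) (r1 / 2)), (Num.min (e / 2) q^-1), c, l, t.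
split.
- split => //; last exact: ltW.
    by rewrite lt_min !divr_gt0.
  by rewrite ge_min lexx.
- by rewrite lt_min divr_gt0 // invr_gt0.
- by rewrite ge_min lexx.
- by split => //; rewrite t0.
move=> rho srho vrho Hrho x'' Hx''.
set e' := Num.min _ _ in Hrho.
have e'q : e' <= q^-1 by rewrite ge_min lexx orbT.
have e'0 : 0 < e' by rewrite lt_min divr_gt0 // invr_gt0.
have x''A : `|x''| <= `|x0| + 1.
  have h1 : `|x'' - x'| <= r / 2 by apply: (le_trans Hx''); rewrite ge_min lexx.
  have := ler_distD x' x'' x0; have := ler_distD x x' x0; have := lerB_dist x'' x0; lra.
have := HC x'' t rho (2 * e' * B) x''A t0 t1 srho vrho _ Hrho.
move=> /(_ (mulr_ge0 (mulr_ge0 (ltW (@ltr0n R 2)) (ltW e'0)) B0)) Hd1.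
have Hd2 : `|dilation T x'' t rho| <= 1.
  apply: (le_trans Hd1).
  have -> : C * t^-1 ^+ m.+1 * (2 * e' * B) = (q - 1) * e' by rewrite /q; ring.
  apply: le_trans (_ : q * e' <= 1); first by rewrite ler_wpM2r ?gerBl // ltW.
  by rewrite mulrC -ler_pdivlMr // div1r.
have Hd3 : n.+1%:R < `|dilation T x'' t th'|.
  apply: Hr1; apply: (le_lt_trans Hx''); apply: (@le_lt_trans _ _ (r1 / 2)).
    by rewrite ge_min lexx orbT.
  by rewrite ltr_pdivrMr // ltr_pMr // ltr1n.
rewrite (dilationD _ t0 tth' (vanish_test srho vrho)).
have := lerB_normD (dilation T x'' t th') (dilation T x'' t rho).
by rewrite -natr1 in Hd3; lra.
Qed.

(** State after finitely many bumps: [hx] and [hr] give the ball in which all later points stay,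
    [he] bounds the next coefficient, [hth] is the sum so far, and [hc], [hl], [ht] are the
    coefficient, shift and scale of the latest bump. *)
Record hump_state := HumpState {
  hx : R; hr : R; he : R; hth : R -> R; hc : R; hl : R; ht : R }.

Definition hump_inv s :=
  [/\ S (hx s), `|hx s - x0| + hr s <= 1, 0 < hr s, 0 < he s & smooth (hth s) /\ vanish 2 (hth s)].

(** The nested balls shrink to a point of the closed set [S]. There the sum of all bumps is one test
    function whose dilations, at scales tending to 0, are at least [n] in absolute value, against
    [bdd]. *)
Lemma cone_absurd : False.
Proof.
have [B [m [HB step]]] := hump_step.
pose Rel (n : nat) s s' := [/\ hump_inv s', hr s' <= hr s / 2 /\ `|hx s' - hx s| <= hr s / 2,
  he s' <= he s / 2 /\ hth s' = (fun y => hth s y + hc s' * psi (y - hl s')),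
  [/\ `|hc s'| <= he s, `|hl s'| <= 1 & 0 < ht s' < n.+1%:R^-1] &
  forall rho, smooth rho -> vanish 2 rho ->
      (forall (k : nat) y, (k <= m)%N -> `|rho^`(k)%classic y| <= 2 * he s' * B) ->
      forall x'', `|x'' - hx s'| <= hr s' ->
        n%:R <= `|dilation T x'' (ht s') (fun y => hth s' y + rho y)|].
have [F HF] : exists F : nat * hump_state -> hump_state,
    forall ns, hump_inv ns.2 -> Rel ns.1 ns.2 (F ns).
  suff H (ns : nat * hump_state) : exists s', hump_inv ns.2 -> Rel ns.1 ns.2 s'.
    by exists (fun ns => projT1 (cid (H ns))) => ns; case: cid.
  case: ns => n s /=.
  have [Is|nIs] := pselect (hump_inv s); last by exists s.
  have [Sx xr r0 e0 [sth vth]] := Is.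
  have [x' [r' [e' [c [l [t [[Sx' r'0 r'r x'x] e'0 e'e [ce l1 tn] Hd]]]]]]] :=
    step n (hx s) (hr s) (he s) (hth s) Sx xr r0 e0 sth vth.
  exists (HumpState x' r' e' (fun y => hth s y + c * psi (y - l)) c l t) => _; split => //=.
  have tth := testD (vanish_test sth vth) (testZ c (test_shift l tpsi)).
  split => //=.
    have := ler_distD (hx s) x' x0; lra.
  split; first exact: test_smooth tth.
  apply: vanishD => //; apply: vanishM => y y2; apply: psi0.
  by have := lerB_dist y l; lra.
pose s0 := HumpState x0 1 1 (fun=> 0) 0 0 1.
pose st n := iteri n (fun k s => F (k, s)) s0.
have Is n : hump_inv (st n).
  elim: n => [|n IH]; last by have [] := HF (n, st n) IH.
  split => //=; first by rewrite subrr normr0 add0r.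
  by split => //; exact: smooth_cst.
have Hst n : Rel n (st n) (st n.+1) by exact: (HF (n, st n) (Is n)).
(* Index shift: bump [n] is stored in state [n.+1], while the bound on its coefficient was fixed in
   state [n]. *)
pose c n := hc (st n.+1); pose l n := hl (st n.+1); pose e n := he (st n).
have ce n : `|c n| <= e n by have [_ _ _ []] := Hst n.
have l1 n : `|l n| <= 1 by have [_ _ _ []] := Hst n.
have e0 n : 0 < e n by have [] := Is n.
have eh n : e n.+1 <= e n / 2 by have [_ _ []] := Hst n.
have e01 : e 0%N <= 1 by [].
have [Th [sTh vTh HTh]] := bump_series ce l1 e0 eh e01.
have thE n : hth (st n) = (fun y => \sum_(i < n) c i * psi (y - l i)).
  elim: n => [|n IH]; first by apply/funext => y; rewrite big_ord0.
  have [_ _ [_ ->] _ _] := Hst n; rewrite IH; apply/funext => y.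
  by rewrite big_ord_recr.
pose x n := hx (st n); pose r n := hr (st n).
have r0 n : 0 < r n by have [] := Is n.
have rh n : r n.+1 <= r n / 2 by have [_ []] := Hst n.
have xh n : `|x n.+1 - x n| <= r n / 2 by have [_ []] := Hst n.
have rsmall n : r n <= n.+1%:R^-1 by apply: (e_small rh).
have a_nd n p : (n <= p)%N -> x n - r n <= x p - r p.
  move=> np; rewrite -(subnKC np); elim: (p - n)%N => [|k IH]; first by rewrite addn0.
  apply: (le_trans IH); rewrite addnS.
  have := xh (n + k)%N; have := rh (n + k)%N; rewrite ler_norml => h1 /andP[h2 h3]; lra.
have b_ni n p : (n <= p)%N -> x p + r p <= x n + r n.
  move=> np; rewrite -(subnKC np); elim: (p - n)%N => [|k IH]; first by rewrite addn0.
  apply: le_trans IH; rewrite addnS.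
  have := xh (n + k)%N; have := rh (n + k)%N; rewrite ler_norml => h1 /andP[h2 h3]; lra.
pose A := [set x n - r n | n in setT].
have ab n p : x n - r n <= x p + r p.
  apply: (@le_trans _ _ (x (n + p)%N - r (n + p)%N)); first by apply: a_nd; rewrite leq_addr.
  apply: (@le_trans _ _ (x (n + p)%N + r (n + p)%N)); last by apply: b_ni; rewrite leq_addl.
  by have := r0 (n + p)%N; lra.
have hsA : has_sup A.
  split; first by exists (x 0%N - r 0%N), 0%N.
  by exists (x 0%N + r 0%N) => _ [n _ <-]; exact: ab.
pose xs := sup A.
have xsn n : `|xs - x n| <= r n.
  rewrite ler_distl; apply/andP; split; first by apply: (ub_le_sup hsA.2); exists n.
  by apply: (ge_sup hsA.1) => _ [p _ <-]; exact: ab.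
have Sxs : S xs.
  have [//|nS] := pselect (S xs); exfalso.
  have : nbhs xs (~` S) by apply: open_nbhs_nbhs; split => //; rewrite openC.
  move=> /nbhs_ballP [eps /= eps0 Heps].
  have [n _ Hn] := near_infty_natSinv_lt (PosNum eps0).
  have /Heps : ball xs eps (x n).
    rewrite /ball /=; apply: (le_lt_trans (xsn n)); apply: (le_lt_trans (rsmall n)).
    exact: (Hn n (leqnn n)).
  by apply; have [] := Is n.
have tTh := vanish_test sTh vTh.
have [N [tau [tau0 HN]]] := bdd Sxs tTh.
have [n1 _ Hn1] := near_infty_natSinv_lt (PosNum tau0).
(* Large enough for the scale, which is below [n.+1%:R^-1], to be less than [tau], and for [n] to
   exceed [N]. *)
pose n := maxn n1 (Num.truncn `|N|).+1.
have [_ _ _ [_ _ /andP[t0 tn]] Hd] := Hst n.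
have nt : n.+1%:R^-1 < tau by apply: Hn1; rewrite /= leq_maxl.
have := HN (ht (st n.+1)); rewrite t0 (lt_trans tn nt) => /(_ isT).
pose rho y := Th y - hth (st n.+1) y.
have [_ _ _ _ [sth vth]] := Is n.+1.
have := Hd rho _ _ _ xs (xsn n.+1).
have -> : (fun y => hth (st n.+1) y + rho y) = Th.
  by apply/funext => y; rewrite /rho; ring.
move=> H1 H2.
have nN : N < n%:R.
  apply: (le_lt_trans (ler_norm _)); apply: (lt_le_trans (truncnS_gt _)).
  by rewrite ler_nat leq_maxr.
suff : n%:R <= `|dilation T xs (ht (st n.+1)) Th| by lra.
apply: H1.
- exact: smoothB sTh sth.
- by apply: vanishD vTh _; exact: vanishN.
- move=> k y km; rewrite /rho.
  have -> : (fun y => Th y - hth (st n.+1) y) = (fun y => Th y + -1 * hth (st n.+1) y).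
    by apply/funext => z; rewrite mulN1r.
  rewrite (derive1nD k sTh (@smoothZ _ (-1) _ sth)) (@derive1nZ _ (-1) _ k sth) mulN1r.
  by rewrite thE; apply: HTh => z; exact: HB.
Qed.

End ConeBound.

(** Boundedness at each point of [S] for each test function becomes a uniform bound for [psi] over
    the cones with vertices in a piece of [S]. With [S] a singleton it bounds the cone at one
    point. *)
Lemma cone_bound (R : realType) (T : (R -> R) -> R) (S : set R) (x0 : R) :
  Defs.distribution T -> closed S -> S x0 ->
  (forall x f, S x -> test_function f -> exists N tau : R, 0 < tau /\
     forall t, 0 < t < tau -> `|dilation T x t f| <= N) ->
  exists x1 r N tau : R, [/\ S x1, 0 < r, 0 < tau &
    forall x l t, S x -> `|x - x1| < r -> `|l| <= 1 -> 0 < t < tau ->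
      `|dilation T (x + l * t) t psi| <= N].
Proof.
move=> HT clS Sx0 bdd; apply: contrapT => H.
apply: (@cone_absurd R T HT S clS bdd x0 Sx0) => x r N tau Sx r0 tau0.
apply: contrapT => H2; apply: H; exists x, r, N, tau; split => // x' l t Sx' xr l1 tt.
rewrite leNgt; apply/negP => H3; apply: H2; exists x', l, t; split => //.
Qed.

(** * Points of local positivity *)

Section GoodPoints.
Context {R : realType}.
Variables w W : (R -> R) -> R.
Hypothesis Hw : Defs.distribution w.
Hypothesis HW : Defs.distribution W.
Hypothesis wW : derivative_of W w.

Lemma dilation_derivative x t f : 0 < t -> test_function f ->
  dilation w x t f = - t^-1 * dilation W x t f^`()%classic.
Proof.
move=> t0 tf; rewrite !dilationE // wW; last exact: test_affine.
rewrite (derive1_affine x t (test_smooth tf)).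
rewrite (distZ HW _ (test_affine x t0 (test_derive tf))); ring.
Qed.

Lemma is_derive_dilation_psi (x t : R) : 0 < t ->
  is_derive x 1 (fun x => dilation W x t psi) (dilation w x t psi).
Proof.
move=> t0; rewrite (dilation_derivative x t0 (@tpsi R)).
exact: is_derive_dilation HW (@tpsi R) t0.
Qed.

(** Uniform in the point and in the scale, so that [good] is an open condition and the bad points
    form a closed set, as [cone_bound] requires. *)
Definition good (x : R) := exists2 d : R, 0 < d & forall x' t, `|x' - x| < d -> 0 < t < d ->
  0 <= dilation w x' t psi.

Lemma good_open : open [set x | good x].
Proof.
move=> x [d d0 Hd]; apply/nbhs_ballP; exists (d / 2); first by rewrite /= divr_gt0.
move=> y; rewrite /ball /= distrC => yx; exists (d / 2); first by rewrite divr_gt0.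
move=> z t zy /andP[t0 td]; apply: Hd; last by rewrite t0; lra.
by have := ler_distD y z x; lra.
Qed.

Lemma good_segment (c d : R) : (forall x, c <= x <= d -> good x) ->
  exists2 e : R, 0 < e & forall x t, c <= x <= d -> 0 < t < e -> 0 <= dilation w x t psi.
Proof.
move=> H; have : compact `[c, d] by exact: segment_compact.
move=> /compact_near_coveringP /(_ R 0^'+ (fun t x => 0 <= dilation w x t psi) _) [].
  move=> x; rewrite /= in_itv /= => /H [e e0 He].
  exists ([set x' | `|x' - x| < e], [set t | 0 < t < e]) => /=.
    split.
      by apply/nbhs_ballP; exists e => // y; rewrite /ball /= distrC.
    near=> t; apply/andP; split; near: t; first exact: nbhs_right_gt.
    exact: nbhs_right_lt.
  by move=> [x' t] /= [x'x te]; exact: He.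
move=> e /= e0 He; exists e => // x t xcd /andP[t0 te].
by apply: He => //=; rewrite ?in_itv // /ball /= sub0r normrN gtr0_norm.
Unshelve. all: by end_near. Qed.

(** [w f] is the limit of the integrals of [f x] times [<w(x + s y), psi(y)>], which are nonnegative
    for small [s]. This frees positivity from the particular bump and from small scales. *)
Lemma good_positive (c d : R) f : (forall x, c <= x <= d -> good x) -> smooth f ->
  (forall x, 0 <= f x) -> (forall x, ~~ (c <= x <= d) -> f x = 0) -> 0 <= w f.
Proof.
move=> gd sf f0 vf; have [e e0 He] := good_segment gd.
pose L := `|c| + `|d|.
have L0 : 0 <= L by rewrite addr_ge0.
have vL : vanish L f.
  move=> x; rewrite /L => Lx; apply: vf; apply/negP => /andP[cx xd].
  move: Lx; rewrite ltNge => /negP; apply; rewrite ler_norml.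
  have := ler_norm c; have := ler_norm d; have := ler_norm (- c); have := ler_norm (- d).
  by rewrite !normrN => *; apply/andP; split; lra.
have LL : L < L + 1 by rewrite ltrDl.
have L10 : 0 <= L + 1 by rewrite addr_ge0.
have [C HC] := mollified_pairing Hw sf vL LL L10.
apply: (@le_all_eps _ _ _ `|C|) => s s0.
pose s' := Num.min (Num.min s (e / 2)) 1.
have s'0 : 0 < s' by rewrite !lt_min s0 divr_gt0 //=.
have := HC s' s'0; rewrite ge_min lexx orbT => /(_ isT).
set I := cint _ _ _ => HI.
have I0 : 0 <= I.
  rewrite /I; apply: Rintegral_ge0 => x _.
  case: (boolP (c <= x <= d)) => [xcd|/vf ->]; last by rewrite mul0r.
  apply: mulr_ge0 => //; apply: He => //; rewrite s'0 /=.
  by rewrite !gt_min ltr_pdivrMr // ltr_pMr // ltr1n orbT.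
have h1 : C * s' <= `|C| * s'  by rewrite ler_wpM2r ?ler_norm // ltW.
have h2 : `|C| * s' <= `|C| * s by rewrite ler_wpM2l // !ge_min lexx.
by move: HI; rewrite ler_norml => /andP[_]; lra.
Qed.

Lemma good_dilation x t : 0 < t -> (forall y, x - t <= y <= x + t -> good y) ->
  0 <= dilation w x t psi.
Proof.
move=> t0 H; rewrite dilationE //; apply: mulr_ge0; first by rewrite invr_ge0 ltW.
apply: (good_positive H); first exact: smooth_comp_affine smooth_psi.
  by move=> y; exact: psi_ge0.
move=> y Hy; apply: psi0; rewrite normrM normfV (gtr0_norm t0) ltr_pdivlMr // mul1r.
by apply: out_norm; apply: contra Hy => /andP[h1 h2]; apply/andP; split; lra.
Qed.

(** The derivative in [x] is a dilation of [w], nonnegative as long as the window [[x - t, x + t]]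
    stays among good points; hence the margins [t] at both ends. *)
Lemma good_monotone (c d t x y : R) : 0 < t -> (forall z, c < z < d -> good z) ->
  c + t <= x -> x <= y -> y <= d - t -> dilation W x t psi <= dilation W y t psi.
Proof.
move=> t0 H cx; rewrite le_eqVlt => /predU1P[->//|xy] yd.
have [||z zxy] := @MVT _ (fun x => dilation W x t psi) (fun x => dilation w x t psi) x y xy.
- move=> z _; exact: is_derive_dilation_psi.
- by apply: continuous_subspaceT => z; exact: is_derive_cont (is_derive_dilation_psi z t0).
rewrite -subr_ge0 => ->; apply: mulr_ge0; last by rewrite subr_ge0 ltW.
apply: good_dilation => // u /andP[u1 u2]; apply: H.
by move: zxy; rewrite in_itv /= => /andP[z1 z2]; apply/andP; split; lra.
Qed.

Hypothesis pvW : forall x, exists c, point_value W x c.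

Lemma point_value_bounded x f : test_function f -> exists N tau : R, 0 < tau /\
  forall t, 0 < t < tau -> `|dilation W x t f| <= N.
Proof.
move=> tf; have [c /(_ _ tf) H] := pvW x.
exists (`|c * \int[@lebesgue_measure R]_y f y| + 1).
have : \forall e \near 0^', `|dilation W x e f| <= `|c * \int[@lebesgue_measure R]_y f y| + 1.
  by apply: (cvgr_norm_le _ H); rewrite ltrDl.
move=> [tau /= tau0 Htau]; exists tau; split => // t /andP[t0 tt]; apply: Htau.
  by rewrite /ball /= sub0r normrN gtr0_norm.
by rewrite gt_eqF.
Qed.

Lemma closed_sup (A : set R) x l : closed A -> A l -> l <= x ->
  exists2 c, A c /\ c <= x & forall y, c < y <= x -> ~ A y.
Proof.
move=> cA Al lx; pose B := [set y | A y /\ y <= x].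
have hsB : has_sup B by split; [exists l|exists x => y []].
exists (sup B).
  split; last by apply: (ge_sup hsB.1) => y [].
  have [//|nA] := pselect (A (sup B)); exfalso.
  have : nbhs (sup B) (~` A) by apply: open_nbhs_nbhs; split => //; rewrite openC.
  move=> /nbhs_ballP [e /= e0 He].
  have [y [Ay yx] ey] := sup_adherent e0 hsB.
  apply: (He y) => //; rewrite /ball /= ger0_norm; last by rewrite subr_ge0; apply: (ub_le_sup hsB.2).
  by rewrite ltrBlDl -ltrBlDr.
move=> y /andP[By yx] Ay; move: By; rewrite ltNge => /negP; apply.
exact: (ub_le_sup hsB.2).
Qed.

Lemma closed_inf (A : set R) x l : closed A -> A l -> x <= l ->
  exists2 c, A c /\ x <= c & forall y, x <= y < c -> ~ A y.
Proof.
move=> cA Al xl.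
have cA' : closed [set - y | y in A].
  have -> : [set - y | y in A] = -%R @^-1` A.
    apply/seteqP; split => y /=; first by move=> [z Az <-]; rewrite opprK.
    by move=> Ay; exists (- y) => //; rewrite opprK.
  by apply: closed_comp => // y _; exact: oppr_continuous.
have [||c [[c' Ac' <-] cx] H] := @closed_sup _ (- x) (- l) cA'.
- by exists l.
- by rewrite lerN2.
exists c'; first by split => //; rewrite -lerN2.
move=> y /andP[xy yc] Ay; apply: (H (- y)); last by exists y.
by rewrite ltrN2 lerN2 yc.
Qed.

(* Between bad points [x |-> <W(x + t y), psi(y)>] is nondecreasing at distance [t] from
   them, so bounds on cones over the bad points carry over to a full neighbourhood. *)
Lemma locally_bounded x0 : ~ good x0 -> exists x1 r N tau : R,
  [/\ ~ good x1, 0 < r, 0 < tau & forall x t, `|x - x1| <= r -> 0 < t < tau ->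
     `|dilation W x t psi| <= N].
Proof.
move=> bad0; pose P := [set x | ~ good x].
have cP : closed P by rewrite -openC setCK; exact: good_open.
have [x1 [r [N [tau [Px1 r0 tau0 HN]]]]] := cone_bound HW cP bad0 (fun x f _ => @point_value_bounded x f).
have cone1 p : exists N tau : R, 0 < tau /\ forall l t, `|l| <= 1 -> 0 < t < tau ->
    `|dilation W (p + l * t) t psi| <= N.
  have cl1 : closed [set p] by exact: closed_eq.
  have [x2 [r2 [N2 [tau2 [-> r20 tau20 HN2]]]]] :=
    cone_bound HW cl1 (erefl p) (fun x f _ => @point_value_bounded x f).
  exists N2, tau2; split => // l t l1 tt; apply: HN2 => //.
  by rewrite subrr normr0.
pose lo := x1 - r / 2; pose hi := x1 + r / 2.
have [N1 [tau1 [tau10 HN1]]] := cone1 lo.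
have [N2 [tau2 [tau20 HN2]]] := cone1 hi.
pose N' := Num.max N (Num.max N1 N2).
pose tau' := Num.min tau (Num.min tau1 tau2).
exists x1, (r / 2), N', tau'; split => //; first by rewrite divr_gt0.
  by rewrite !lt_min tau0 tau10.
(* The end points join the bad points as vertices, so that every [x] in between has a vertex on
   either side; [cone1] bounds the two additional cones. *)
pose P' := (P `&` [set x | lo <= x <= hi]) `|` ([set lo] `|` [set hi]).
have cP' : closed P'.
  apply: closedU; last by apply: closedU; exact: closed_eq.
  apply: closedI => //; rewrite (_ : [set x | _] = `[lo, hi]%classic).
    exact: interval_closed.
  by apply/seteqP; split => x /=; rewrite in_itv.
have CB p l t : P' p -> `|l| <= 1 -> 0 < t < tau' -> `|dilation W (p + l * t) t psi| <= N'.
  move=> Pp l1; rewrite !lt_min => /and4P[t0 tt t1 t2].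
  rewrite !le_max; case: Pp => [[Pp /andP[p1 p2]]|[->|->]].
  - rewrite HN ?t0 ?tt //; rewrite /lo /hi in p1 p2.
    by rewrite (@le_lt_trans _ _ (r / 2)) ?ler_norml; [|apply/andP; split|]; lra.
  - by rewrite HN1 ?t0 // !orbT.
  - by rewrite HN2 ?t0 // !orbT.
move=> x t xx1 tt; have /andP[t0 _] := tt.
have xlo : lo <= x by move: xx1; rewrite /lo ler_norml => /andP[h1 h2]; lra.
have xhi : x <= hi by move: xx1; rewrite /hi ler_norml => /andP[h1 h2]; lra.
(* Within distance [t] of a vertex, [x] lies on its cone. Otherwise [x] lies in a gap between
   vertices [c] and [d], and monotonicity compares it with [c + t] and [d - t], which lie on the
   cones with [l = 1] and [l = -1]. *)
have [[p Pp pt]|far] := pselect (exists2 p, P' p & `|x - p| <= t).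
  have -> : x = p + ((x - p) / t) * t by rewrite divfK ?gt_eqF //; ring.
  apply: CB => //; rewrite normrM normfV (gtr0_norm t0) ler_pdivrMr //.
  by rewrite mul1r.
have farP p : P' p -> t < `|x - p|.
  by move=> Pp; rewrite ltNge; apply/negP => H; apply: far; exists p.
have Plo : P' lo by right; left.
have Phi : P' hi by right; right.
have [c [Pc cx] Hc] := closed_sup cP' Plo xlo.
have [d [Pd xd] Hd] := closed_inf cP' Phi xhi.
have ctx : c + t <= x by have := farP c Pc; rewrite ger0_norm ?subr_ge0 //; lra.
have xtd : x <= d - t by have := farP d Pd; rewrite ler0_norm ?subr_le0 //; lra.
have loc : lo <= c.
  by rewrite leNgt; apply/negP => clo; apply: (Hc lo) => //; rewrite clo.
have dhi : d <= hi.
  by rewrite leNgt; apply/negP => dlo; apply: (Hd hi) => //; rewrite dlo xhi.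
have gd z : c < z < d -> good z.
  move=> /andP[cz zd]; apply: contrapT => bad.
  have Pz : P' z by left; split => //=; rewrite (le_trans loc (ltW cz)) (le_trans (ltW zd) dhi).
  have [zx|xz] := leP z x; first by apply: (Hc z) => //; rewrite cz.
  by apply: (Hd z) => //; rewrite zd ltW.
rewrite ler_norml; apply/andP; split.
  apply: le_trans (good_monotone t0 gd (lexx _) ctx xtd).
  have := CB c 1 t Pc; rewrite normr1 mul1r => /(_ (lexx _) tt).
  by rewrite ler_norml => /andP[].
apply: le_trans (good_monotone t0 gd ctx xtd (lexx _)) _.
have := CB d (-1) t Pd; rewrite normrN1 mulN1r => /(_ (lexx _) tt).
by rewrite ler_norml => /andP[].
Qed.

End GoodPoints.

(** * A continuous primitive from bounded dilations *)

Section PrimitiveRepresentation.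
Context {R : realType}.
Local Notation mu := (@lebesgue_measure R).

Lemma cint_dominated (a b N : R) (f_ : nat -> R -> R) (f : R -> R) :
  (forall n, continuous (f_ n)) ->
  (forall n x, a <= x <= b -> `|f_ n x| <= N) ->
  (forall x, a <= x <= b -> f_ n x @[n --> \oo] --> f x) ->
  cint a b (f_ n) @[n --> \oo] --> cint a b f.
Proof.
move=> cf bf cvf; have mD : measurable (`[a, b]%classic : set (measurableTypeR R)) by [].
have mf n : measurable_fun `[a, b] (fun x => (f_ n x)%:E).
  by have /integrableP[] := cint_integrable a b (cf n).
have Hf x : `[a, b]%classic x -> (f_ n x)%:E @[n --> \oo] --> (f x)%:E.
  by rewrite /= in_itv /= => /cvf H; apply: cvg_EFin => //; exact: nearW.
have mfl : measurable_fun `[a, b] (fun x => (f x)%:E) by exact: emeasurable_fun_cvg mf Hf.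
have aeHf : {ae mu, forall x, `[a, b]%classic x -> (f_ n x)%:E @[n --> \oo] --> (f x)%:E}.
  by apply: aeW => x; exact: Hf.
have iN : mu.-integrable `[a, b] (EFin \o (fun=> N)).
  exact: (cint_integrable a b (@cst_continuous _ _ N)).
have bd : {ae mu, forall x n, `[a, b]%classic x -> (`|(f_ n x)%:E| <= (EFin \o (fun=> N)) x)%E}.
  by apply: aeW => x n /=; rewrite in_itv /= lee_fin; exact: bf.
have [H1 _ H2] := @dominated_convergence _ _ _ mu _ mD (fun n x => (f_ n x)%:E)
  (fun x => (f x)%:E) (EFin \o (fun=> N)) mf mfl aeHf iN bd.
apply: fine_cvg; rewrite fineK; first exact: H2.
exact: integrable_fin_num.
Qed.

Lemma lipschitz_cont (f : R -> R) (N : R) :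
  (forall x y, `|f y - f x| <= N * `|y - x|) -> continuous f.
Proof.
move=> H x; apply/cvgrPdist_le => e e0; apply/nbhs_ballP.
have N0 : 0 <= N by have := le_trans (normr_ge0 _) (H 0 1); rewrite subr0 normr1 mulr1.
exists (e / (N + 1)); first by rewrite /= divr_gt0 // ltr_wpDl.
move=> y; rewrite /ball /= => xy; apply: (le_trans (H _ _)).
apply: (le_trans (_ : _ <= (N + 1) * `|x - y|)); first by rewrite ler_wpM2r // lerDl.
by rewrite mulrC -ler_pdivlMr ?ltr_wpDl // ltW.
Qed.

(** Serves to extend functions given on [[lo, hi]] continuously by constants. *)
Definition clamp (lo hi x : R) : R := Num.max lo (Num.min x hi).

Lemma clamp_bounds (lo hi x : R) : lo <= hi -> lo <= clamp lo hi x <= hi.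
Proof. by move=> lohi; rewrite le_max lexx /= ge_max lohi ge_min lexx orbT. Qed.

Lemma clamp_id (lo hi x : R) : lo <= x <= hi -> clamp lo hi x = x.
Proof. by move=> /andP[lx xh]; rewrite /clamp min_l // max_r. Qed.

Lemma clamp_lipschitz (lo hi x y : R) : `|clamp lo hi y - clamp lo hi x| <= `|y - x|.
Proof.
wlog xy : x y / x <= y.
  by move=> H; have /orP[/H//|/H] := le_total x y; rewrite distrC [`|x - y|]distrC.
have [h1 h2] : clamp lo hi x <= clamp lo hi y /\ clamp lo hi y - clamp lo hi x <= y - x.
  rewrite /clamp; have [xh|hx] := leP x hi; have [yh|hy] := leP y hi.
  - by split; have [?|?] := leP lo x; have [?|?] := leP lo y; lra.
  - by split; have [?|?] := leP lo x; have [?|?] := leP lo hi; lra.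
  - by exfalso; lra.
  - by rewrite subrr subr_ge0.
by rewrite !ger0_norm ?subr_ge0.
Qed.

Variable W : (R -> R) -> R.
Hypothesis HW : Defs.distribution W.
Hypothesis pvW : forall x, exists c, point_value W x c.
Variables lo hi N tau : R.
Hypothesis lohi : lo < hi.
Hypothesis tau0 : 0 < tau.
Hypothesis bdW : forall x t, lo <= x <= hi -> 0 < t < tau -> `|dilation W x t psi| <= N.

(* [G] is the limit of the primitives of the mollifications of [W]. *)
Lemma primitive_rep : exists2 G : R -> R, continuous G &
  forall (c d : R) (th : R -> R), lo < c -> d < hi -> smooth th -> (forall x, ~~ (c <= x <= d) -> th x = 0) ->
    W th = - cint lo hi (fun x => G x * th^`()%classic x).
Proof.
have lohi' := ltW lohi.
(* The index [n.+2] keeps [s n] strictly below [tau] from the first term on. *)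
pose s n : R := Num.min tau 1 / n.+2%:R.
have s0 n : 0 < s n by rewrite divr_gt0 // lt_min tau0 ltr01.
have sm n : s n < Num.min tau 1.
  by rewrite ltr_pdivrMr // ltr_pMr ?ltr1n // lt_min tau0 ltr01.
have st n : s n < tau by apply: (lt_le_trans (sm n)); rewrite ge_min lexx.
have s1 n : s n <= 1 by apply: (le_trans (ltW (sm n))); rewrite ge_min lexx orbT.
have scvg : s n @[n --> \oo] --> (0 : R).
  rewrite -[X in _ --> X](mulr0 (Num.min tau 1)); apply: cvgM; first exact: cvg_cst.
  have := @cvg_harmonic R; rewrite -(cvg_shiftS (@harmonic R)) => H.
  exact: cvg_trans H.
pose V n x := dilation W x (s n) psi.
have cV n : continuous (V n) by exact: dilation_cont HW (@tpsi R) (s0 n).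
have bV n x : lo <= x <= hi -> `|V n x| <= N by move=> xl; apply: bdW => //; rewrite s0 st.
have N0 : 0 <= N by apply: le_trans (normr_ge0 _) (bV 0%N lo _); rewrite lexx.
(* Point values make the mollified functions converge at every point. As they are bounded by [N] on
   [[lo, hi]], their primitives converge too, without extraction of a subsequence. *)
have [U HU] : exists U : R -> R, forall x, V n x @[n --> \oo] --> U x.
  have cv x : exists u : R, V n x @[n --> \oo] --> u.
    have [c /(_ _ (@tpsi R)) H] := pvW x; exists (c * \int[mu]_y psi y).
    have : s n @[n --> \oo] --> 0^'.
      move=> A [e /= e0 He]; have := scvg; move=> /cvgrPdist_lt /(_ e e0).
      apply: filterS => n; rewrite sub0r normrN => Hn; apply: He.
        by rewrite /ball /= sub0r normrN.
      by rewrite gt_eqF.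
    by move=> h; exact: (cvg_comp _ _ h H).
  by exists (fun x => projT1 (cid (cv x))) => x; case: cid.
pose clamp := clamp lo hi.
have clamp_itv x : lo <= clamp x <= hi by exact: clamp_bounds.
have clampE x : lo <= x <= hi -> clamp x = x by exact: clamp_id.
have clamp_lip x y : `|clamp y - clamp x| <= `|y - x| by exact: clamp_lipschitz.
pose G_ n x := cint lo (clamp x) (V n).
pose G x := cint lo (clamp x) U.
have G_cvg x : G_ n x @[n --> \oo] --> G x.
  have /andP[h1 h2] := clamp_itv x.
  apply: (@cint_dominated _ _ N) => //.
  by move=> n z /andP[z1 z2]; apply: bV; rewrite z1 (le_trans z2).
have G_lip n x y : `|G_ n y - G_ n x| <= N * `|y - x|.
  apply: le_trans (ler_wpM2l N0 (clamp_lip x y)).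
  wlog xy : x y / clamp x <= clamp y.
    move=> H; have /orP[/H//|/H] := le_total (clamp x) (clamp y).
    by rewrite distrC [`|clamp x - _|]distrC.
  have /andP[h1 h2] := clamp_itv x; have /andP[h3 h4] := clamp_itv y.
  rewrite /G_ -(cint_chasles h1 xy (cV n)) addrAC subrr add0r.
  rewrite [`|clamp y - _|]ger0_norm ?subr_ge0 //.
  apply: cint_bound => // z /andP[z1 z2]; apply: bV.
  by rewrite (le_trans h1 z1) (le_trans z2 h4).
have G_cont n : continuous (G_ n) := lipschitz_cont (G_lip n).
have Glip x y : `|G y - G x| <= N * `|y - x|.
  apply: (@norm_cvg_le _ (fun n => G_ n y - G_ n x)) => //.
  by apply: cvgB; exact: G_cvg.
exists G; first exact: lipschitz_cont Glip.
move=> c d th loc dhi sth vth.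
have th_lo : th lo = 0 by apply: vth; apply/negP => /andP[h1 h2]; lra.
have th_hi : th hi = 0 by apply: vth; apply/negP => /andP[h1 h2]; lra.
pose L := `|lo| + `|hi|.
have L0 : 0 <= L by rewrite addr_ge0.
have LM : L < L + 1 by rewrite ltrDl.
have M0 : 0 <= L + 1 by rewrite addr_ge0.
have Llo : - L <= lo by rewrite /L; have := ler_norm (- lo); have := normr_ge0 hi; rewrite normrN; lra.
have hiL : hi <= L by rewrite /L; have := ler_norm hi; have := normr_ge0 lo; lra.
have vL : vanish L th.
  move=> x Lx; apply: vth; apply/negP => /andP[cx xd]; move: Lx; rewrite ltNge => /negP; apply.
  by rewrite ler_norml; apply/andP; split; lra.
have parts n : cint (- (L + 1)) (L + 1) (fun x => th x * V n x) =
    - cint lo hi (fun x => th^`()%classic x * G_ n x).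
  have vthV x : ~~ (c <= x <= d) -> th x * V n x = 0 by move=> /vth ->; rewrite mul0r.
  rewrite -(@cint_extend _ _ c d (- (L + 1)) (L + 1)) //; [|lra|lra].
  rewrite (@cint_extend _ _ c d lo hi) //; [|lra|lra].
  have [F HF] := cont_primitive lo hi (cV n).
  have GE x : lo <= x <= hi -> G_ n x = F x - F lo.
    move=> xl; rewrite /G_ clampE //; have /andP[h1 h2] := xl; apply: cint_FTC => //.
    by move=> z /andP[z1 z2]; apply: HF; rewrite z1 (le_trans z2).
  have cth := smooth_cont sth; have cth' := smooth_cont (smooth_derive sth).
  apply/eqP; rewrite -subr_eq0 opprK -cintD; last 2 first.
  - exact: contM cth (cV n).
  - exact: contM cth' (G_cont n).
  have D x : lo <= x <= hi -> is_derive x 1 (fun x => th x * (F x + - F lo))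
      (th x * V n x + th^`()%classic x * G_ n x).
    move=> xl; rewrite GE // addrC; apply: is_derive_mul; first exact: smooth_is.
    rewrite -[X in is_derive _ _ _ X]addr0; apply: is_derive_add; exact: HF.
  rewrite (cint_FTC lohi' _ D); first by rewrite th_lo th_hi; apply/eqP; ring.
  by apply: contD; [exact: contM cth (cV n)|exact: contM cth' (G_cont n)].
have lim1 : cint (- (L + 1)) (L + 1) (fun x => th x * V n x) @[n --> \oo] --> W th.
  have [C HC] := mollified_pairing HW sth vL LM M0.
  apply/cvgrPdist_le => e e0.
  have := scvg; move=> /cvgrPdist_lt /(_ (e / (`|C| + 1))).
  rewrite divr_gt0 ?ltr_wpDl // => /(_ isT); apply: filterS => n; rewrite sub0r normrN => Hn.
  rewrite distrC; apply: (le_trans (HC (s n) (s0 n) (s1 n))).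
  rewrite gtr0_norm // ltr_pdivlMr ?ltr_wpDl // in Hn.
  apply: ltW; apply: le_lt_trans Hn; rewrite mulrC ler_wpM2l ?(ltW (s0 n)) //.
  by rewrite (le_trans (ler_norm _)) // lerDl.
have [B B0 HB] := vanish_bounded (smooth_cont (smooth_derive sth)) (vanish_derive vL).
have lim2 : cint lo hi (fun x => th^`()%classic x * G_ n x) @[n --> \oo] -->
    cint lo hi (fun x => th^`()%classic x * G x).
  apply: (@cint_dominated _ _ (B * (N * (hi - lo)))).
  - by move=> n; apply: contM => //; exact: smooth_cont (smooth_derive sth).
  - move=> n x xl; apply: norm_mul_le; first exact: HB.
    have -> : G_ n x = G_ n x - G_ n lo.
      rewrite [G_ n lo]/G_ clampE ?lexx // /cint set_itv1 Rintegral_set1 subr0 //.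
    apply: (le_trans (G_lip n lo x)); apply: ler_wpM2l => //; have /andP[h1 h2] := xl.
    by rewrite ger0_norm ?subr_ge0 // lerD2r.
  - by move=> x _; apply: cvgM; [exact: cvg_cst|exact: G_cvg].
have lim3 : cint (- (L + 1)) (L + 1) (fun x => th x * V n x) @[n --> \oo] -->
    - cint lo hi (fun x => th^`()%classic x * G x).
  rewrite (_ : (fun n => _) = (fun n => - cint lo hi (fun x => th^`()%classic x * G_ n x))).
    exact: cvgN.
  by apply/funext => n; rewrite parts.
have -> : cint lo hi (fun x => G x * th^`()%classic x) = cint lo hi (fun x => th^`()%classic x * G x).
  by apply: eq_cint => x _; rewrite mulrC.
exact: (cvg_unique _ lim1 lim3).
Qed.

End PrimitiveRepresentation.

(** * Dilations of continuous functions *)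

Section ContinuousDistribution.
Context {R : realType}.
Local Notation mu := (@lebesgue_measure R).
Variables (G : R -> R) (lo hi : R).
Hypotheses (cG : continuous G) (lohi : lo < hi).

Definition cdist (f : R -> R) : R := cint lo hi (fun x => G x * f x).

Lemma cdist_distribution : Defs.distribution cdist.
Proof.
split=> [c f g tf tg|K _].
  have cf := smooth_cont (test_smooth tf); have cg := smooth_cont (test_smooth tg).
  rewrite /cdist -cintZ; last exact: contM.
  rewrite -cintD; [|exact: contZ (contM cG cf)|exact: contM].
  by apply: eq_cint => x _; ring.
have : compact (G @` `[lo, hi]).
  by apply: continuous_compact; [exact: continuous_subspaceT|exact: segment_compact].
move=> /compact_bounded [M [_ HM]].
exists ((`|M| + 1) * (hi - lo)), 0%N => f tf _ B HB.
have cf := smooth_cont (test_smooth tf).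
have -> : (`|M| + 1) * (hi - lo) * B = (`|M| + 1) * B * (hi - lo) by ring.
apply: cint_bound; [exact: ltW|exact: contM|move=> x xl].
apply: norm_mul_le; last by have := HB 0%N x isT; rewrite derive1n0.
have /HM : M < `|M| + 1 by rewrite (le_lt_trans (ler_norm _)) // ltrDl.
by apply; exists x => //=; rewrite in_itv.
Qed.

Lemma dilation_cdist x t f : 0 < t -> lo <= x - t -> x + t <= hi -> continuous f -> vanish 1 f ->
  dilation cdist x t f = cint (-1) 1 (fun y => G (x + t * y) * f y).
Proof.
move=> t0 h1 h2 cf vf; rewrite dilationE // /cdist.
have cft : continuous (fun y => f ((y - x) / t)).
  have -> : (fun y => f ((y - x) / t)) = (fun y => f (- (x / t) + t^-1 * y)).
    by apply/funext => y; congr f; ring.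
  exact: continuous_lin.
have cGf : continuous (fun z => G z * f ((z - x) / t)) by exact: contM.
rewrite -(@cint_extend _ _ (x + t * -1) (x + t * 1)); last 3 first.
- by rewrite mulrN1.
- by rewrite mulr1.
- move=> z Hz; rewrite vf ?mulr0 //; rewrite normrM normfV (gtr0_norm t0) ltr_pdivlMr // mul1r.
  by apply: out_norm; apply: contra Hz => /andP[z1 z2]; apply/andP; split; lra.
rewrite cint_subst // mulrA mulVf ?gt_eqF // mul1r; apply: eq_cint => y _.
by congr (_ * f _); field; rewrite gt_eqF.
Qed.

(** From [psi' = - y * phi] follows [psi'' = - (phi + y * phi')], which is exactly what
    differentiating [t^-1 * phi (u / t)] in [t] produces. *)
Lemma derive_t_kernel (u t : R) : 0 < t ->
  is_derive t 1 (fun t => t^-1 * phi (u / t))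
    (t^-1 ^+ 2 * psi^`()%classic^`()%classic (u / t)).
Proof.
move=> t0; have tn0 : t != 0 by rewrite gt_eqF.
have D1 : is_derive t 1 (fun y : R => y^-1) (- t ^- 2).
  have := @is_deriveV _ (@id R) t 1 1 tn0 (is_derive_id _ _).
  by rewrite /GRing.scale /= mulr1.
have D2 : is_derive t 1 (fun y : R => u / y) (u * - t ^- 2) by exact: is_derive_scal.
have D3 := @is_derive_comp _ phi (fun y => u / y) t _ _ (smooth_is (u / t) (@smooth_phi R)) D2.
have D4 := is_derive_mul D1 D3.
have E : psi^`()%classic^`()%classic (u / t) =
    - (1 * phi (u / t) + (u / t) * (@phi R)^`()%classic (u / t)).
  rewrite derive_psi; apply: derive1_is; apply: is_derive_opp.
  by apply: is_derive_mul; exact: smooth_is (@smooth_phi R).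
rewrite E -exprVn in D4 *; set p := phi _ in D4 *; set p' := _ (u / t) in D4 *.
by have -> : t^-1 ^+ 2 * - (1 * p + u / t * p') =
  - t^-1 ^+ 2 * p + t^-1 * (p' * (u * - t^-1 ^+ 2)) by ring.
Qed.

(** Differentiation under the integral sign, dominated for scales in []t / 2, t + 1[]. The
    right-hand side is [t] times the dilation of [G''] by [psi], because two derivatives cost
    [t^-2]. *)
Lemma derive_t_dilation (x t : R) : 0 < t ->
  is_derive t 1 (fun t => dilation cdist x t phi)
    (t^-1 * dilation cdist x t psi^`()%classic^`()%classic).
Proof.
move=> t0.
pose f t z := G z * (t^-1 * phi ((z - x) / t)).
have spp : smooth (@psi R)^`()%classic^`()%classic by do 2!apply: smooth_derive; exact: smooth_psi.
have vpp : vanish 1 (@psi R)^`()%classic^`()%classic.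
  by do 2!apply: vanish_derive; exact: psi0.
have [B B0 HB] := vanish_bounded (smooth_cont spp) vpp.
have Df (s z : R) : 0 < s -> is_derive s 1 (f ^~ z) (G z * (s^-1 ^+ 2 * psi^`()%classic^`()%classic ((z - x) / s))).
  by move=> s0; apply: is_derive_scal; exact: derive_t_kernel.
have Ia : `](t / 2), (t + 1)[%classic t.
  by rewrite /= in_itv /= ltrDl ltr01 andbT ltr_pdivrMr // ltr_pMr // ltr1n.
have Ipos s : `](t / 2), (t + 1)[%classic s -> 0 < s.
  by rewrite /= in_itv /= => /andP[h _]; apply: lt_trans h; rewrite divr_gt0.
have cphi s : continuous (fun z : R => phi ((z - x) / s)).
  by apply: smooth_cont; apply: smooth_comp_affine; exact: smooth_phi.
have intf s : `](t / 2), (t + 1)[%classic s -> mu.-integrable `[lo, hi] (EFin \o f s).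
  by move=> _; apply: cint_integrable; apply: contM => //; exact: contZ.
have derf s z : `](t / 2), (t + 1)[%classic s -> `[lo, hi]%classic z -> derivable (f ^~ z) s 1.
  by move=> /Ipos s0 _; have [] := Df s z s0.
pose K z := `|G z| * ((t / 2)^-1 ^+ 2 * B).
have K0 z : 0 <= K z by apply: mulr_ge0 => //; apply: mulr_ge0 => //; exact: sqr_ge0.
have cK : continuous K.
  apply: contM; last exact: cst_continuous.
  by move=> z; apply: (@continuous_comp _ _ _ G (fun u : R^o => `|u|)); [exact: cG|exact: norm_continuous].
have intK : mu.-integrable `[lo, hi] (EFin \o K) by exact: cint_integrable.
have Kub s z : `](t / 2), (t + 1)[%classic s -> `[lo, hi]%classic z -> `|partial1of2 f s z| <= K z.
  move=> Is _; have s0 := Ipos s Is; rewrite /partial1of2 (derive1_is (Df s z s0)).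
  apply: norm_mul_le => //; apply: norm_mul_le => //.
  rewrite ger0_norm ?exprn_ge0 ?invr_ge0 ?(ltW s0) // lerXn2r ?nnegrE ?invr_ge0 ?(ltW s0) //.
    by rewrite divr_ge0 // ltW.
  rewrite lef_pV2 ?posrE ?divr_gt0 //.
  by move: Is; rewrite /= in_itv /= => /andP[/ltW].
have mD : measurable (`[lo, hi]%classic : set (measurableTypeR R)) by [].
have D1 := @derivable_under_integral R _ _ mu f _ mD t _ _ Ia intf derf K K0 intK Kub.
have D2 := @differentiation_under_integral R _ _ mu f _ mD t _ _ Ia intf derf K K0 intK Kub.
have H : is_derive t 1 (fun s => \int[mu]_(y in `[lo, hi]) f s y)
    (t^-1 * dilation cdist x t psi^`()%classic^`()%classic).
  apply: DeriveDef => //; rewrite -derive1E D2 dilationE // /cdist /cint mulrA -expr2.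
  have cpp := smooth_cont (@smooth_comp_affine _ _ x t spp).
  rewrite -[RHS](@cintZ _ _ _ lo hi (contM cG cpp)).
  apply: eq_cint => z _; rewrite /partial1of2 (derive1_is (Df t z t0)); ring.
apply: near_eq_is_derive H; near=> s.
have s0 : 0 < s by near: s; exact: lt_nbhsr.
rewrite dilationE // /cdist -[RHS]cintZ; last exact: contM.
by apply: eq_cint => z _; rewrite /f; ring.
Unshelve. all: by end_near. Qed.

Lemma phi_mass_gt0 : 0 < cint (-1) 1 (@phi R).
Proof.
apply: cint_gt0; rewrite ?ltrN1 //; first exact: smooth_cont (@smooth_phi R).
by move=> x; exact: phi_gt0.
Qed.

(** The derivative in the scale is integrated from [s] to [t]. As [s] tends to 0, the average of [G]
    tends to [G x] times the mass of [phi], so the average at scale [t] is compared with the value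
    at the centre. *)
Lemma dilation_lower x t m : 0 < t -> lo <= x - t -> x + t <= hi -> 0 <= m ->
  (forall s, 0 < s <= t -> - m <= s^-1 * dilation cdist x s psi^`()%classic^`()%classic) ->
  - m * t <= cint (-1) 1 (fun y => G (x + t * y) * phi y) - cint (-1) 1 phi * G x.
Proof.
move=> t0 h1 h2 m0 Hm; have cp := smooth_cont (@smooth_phi R).
have vp : vanish 1 (@phi R) by exact: phi0.
have k0 := phi_mass_gt0; set k := cint _ _ phi in k0 *.
apply: (@le_all_eps _ _ _ k) => e e0.
have := @cG x; move=> /cvgrPdist_le /(_ e e0) /nbhs_ballP [d /= d0 Hd].
pose s := Num.min (t / 2) (d / 2).
have s0 : 0 < s by rewrite lt_min !divr_gt0.
have st : s < t by rewrite gt_min ltr_pdivrMr // ltr_pMr // ltr1n.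
have sd : s < d by rewrite gt_min orbC ltr_pdivrMr // ltr_pMr // ltr1n.
clearbody s.
have Js : `|cint (-1) 1 (fun y => G (x + s * y) * phi y) - k * G x| <= k * e.
  rewrite /k -[cint _ _ phi * G x]mulrC -[cint _ _ phi * e]mulrC -!cintZ //.
  have c1 : continuous (fun y => G (x + s * y) * phi y) by exact: contM (continuous_lin cG) cp.
  have c2 : continuous (fun y => G x * phi y) by exact: contZ.
  have c3 : continuous (fun y => e * phi y) by exact: contZ.
  have c4 : continuous (fun y => - e * phi y) by exact: contZ.
  have H y : -1 <= y <= 1 -> `|G (x + s * y) * phi y - G x * phi y| <= e * phi y.
    move=> y1; rewrite -mulrBl normrM (ger0_norm (phi_ge0 _)) ler_wpM2r ?phi_ge0 //.
    rewrite distrC; apply: Hd; rewrite /ball /= opprD addrA subrr sub0r normrN normrM (gtr0_norm s0).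
    by apply: le_lt_trans sd; rewrite ger_pMr // ler_norml.
  rewrite -cintB // ler_norml; apply/andP; split.
    have -> : - cint (-1) 1 (fun x => e * phi x) = cint (-1) 1 (fun x => - e * phi x).
      by rewrite (@cintZ _ phi e) // (@cintZ _ phi (- e)) // mulNr.
    apply: cint_le => //; first exact: contB c1 c2.
    by move=> y /H; rewrite ler_norml mulNr => /andP[].
  apply: cint_le => //; first exact: contB c1 c2.
  by move=> y /H; rewrite ler_norml => /andP[].
have D (u : R) : 0 < u -> is_derive u 1 (fun t => dilation cdist x t phi)
    (u^-1 * dilation cdist x u psi^`()%classic^`()%classic) by exact: derive_t_dilation.
have [||z zst] := @MVT _ (fun t => dilation cdist x t phi)
    (fun u => u^-1 * dilation cdist x u psi^`()%classic^`()%classic) s t st.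
- by move=> z; rewrite in_itv /= => /andP[sz _]; apply: D; exact: lt_trans sz.
- apply: derivable_within_continuous => z; rewrite in_itv /= => /andP[sz _].
  by have [] := D z (lt_le_trans s0 sz).
have xs : lo <= x - s by lra.
have sx : x + s <= hi by lra.
rewrite (@dilation_cdist x t phi) // (@dilation_cdist x s phi) // => HJ.
have : - m <= z^-1 * dilation cdist x z psi^`()%classic^`()%classic.
  by apply: Hm; move: zst; rewrite in_itv /= => /andP[h3 h4]; apply/andP; split; lra.
move=> Hz; have : - m * (t - s) <= z^-1 * dilation cdist x z psi^`()%classic^`()%classic * (t - s).
  by rewrite ler_wpM2r // subr_ge0 ltW.
rewrite -HJ; move: Js; rewrite ler_norml => /andP[h3 h4].
have : 0 <= m * s by rewrite mulr_ge0 // ltW.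
move: h3 h4; set A := cint _ _ _; set A' := cint _ _ _ => h3 h4; nra.
Qed.

End ContinuousDistribution.

(** * Generalized second derivatives and convexity *)

Section Schwarz.
Context {R : realType}.
Local Notation mu := (@lebesgue_measure R).
Implicit Types (H : R -> R) (x p q : R).

Definition below H x (s : R) := exists2 r : R, 0 < r & forall h, `|h| < r -> H (x + h) <= H x + s * h.

Lemma uncountable_itv (a b : R) : a < b -> ~ countable `]a, b[%classic.
Proof.
move=> ab /countable_lebesgue_measure0; rewrite lebesgue_measure_itv /= lte_fin ab.
by move=> /eqP; rewrite -EFinB eqe subr_eq0 gt_eqF.
Qed.

(* If [H] were above a chord at some point, tilting the chord would produce, for each of
   uncountably many slopes [m], an interior maximum of [H] minus a line of slope [m].
   These maxima all lie in [E] and determine [m]. *)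
Lemma schwarz_convex (E : set R) H p q : countable E -> continuous H -> p < q ->
  (forall x, p < x < q -> ~ E x -> forall s, ~ below H x s) ->
  (forall x, p < x < q -> forall s s', s < s' -> below H x s -> below H x s' -> False) ->
  forall x, p <= x <= q -> (q - p) * H x <= (q - x) * H p + (x - p) * H q.
Proof.
move=> cE cH pq HA HB x1 /andP[px1 x1q]; rewrite leNgt; apply/negP => Hx1.
have qp0 : 0 < q - p by rewrite subr_gt0.
pose k := (H q - H p) / (q - p).
pose l x := H p + k * (x - p).
have lq : l q = H q by rewrite /l /k divfK ?gt_eqF //; ring.
pose D := H x1 - l x1.
have kE : k * (q - p) = H q - H p by rewrite /k divfK ?gt_eqF.
have D0 : 0 < D.
  rewrite -(pmulr_rgt0 _ qp0) /D /l mulrBr mulrDr [(q - p) * (k * _)]mulrCA mulrA.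
  by have -> : k * (q - p) = H q - H p by []; nra.
(* For [m] below [m0] the tilted difference [g] is still positive at [x1], while it is 0 at [p] and
   negative at [q]; its maximum is therefore interior. *)
pose m0 := D / (q - p).
have m00 : 0 < m0 by rewrite divr_gt0.
have X m : exists x, 0 < m < m0 -> [/\ p < x < q, below H x (k + m) & E x].
  have [/andP[m1 m2]|nm] := pselect (0 < m < m0); last by exists 0 => /nm.
  pose g x := H x - l x - m * (x - p).
  have cg : continuous g.
    have ca (c : R) : continuous (fun x : R => c * (x - p)).
      by apply: contZ; apply: contB; [move=> z; exact: cvg_id|exact: cst_continuous].
    apply: contB => //; apply: contB => //; apply: contD; [exact: cst_continuous|exact: ca].
  have [x xpq Hmax] := EVT_max (ltW pq) (continuous_subspaceT cg).
  have gx1 : g x1 <= g x by apply: Hmax; rewrite in_itv /= px1.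
  have gx0 : 0 < g x.
    apply: lt_le_trans gx1; rewrite /g -/D subr_gt0.
    apply: (@le_lt_trans _ _ (m * (q - p))); first by rewrite ler_wpM2l ?lerD2r // ltW.
    by rewrite -ltr_pdivlMr.
  move: xpq; rewrite in_itv /= => /andP[px xq].
  have pltx : p < x.
    rewrite lt_neqAle px andbT; apply/eqP => px'; move: gx0.
    by rewrite /g /l -px' !subrr !mulr0 addr0 !subrr ltxx.
  have xltq : x < q.
    rewrite lt_neqAle xq andbT; apply/eqP => xq'; move: gx0; rewrite xq' /g lq subrr sub0r.
    by rewrite oppr_gt0 ltNge mulr_ge0 // ltW.
  have bx : below H x (k + m).
    exists (Num.min (x - p) (q - x)); first by rewrite lt_min !subr_gt0 pltx.
    move=> h; rewrite lt_min !ltr_norml => /andP[/andP[h1 h2] /andP[h3 h4]].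
    have := Hmax (x + h); rewrite in_itv /= => /(_ _)/wrap[]; first by apply/andP; split; lra.
    by rewrite /g /l; lra.
  exists x => _; split => //; first by rewrite pltx.
  apply: contrapT => nE; apply: (HA x _ nE (k + m)) => //; by rewrite pltx.
have [f Hf] : exists f : R -> R, forall m, 0 < m < m0 -> [/\ p < f m < q, below H (f m) (k + m) & E (f m)].
  by exists (fun m => projT1 (cid (X m))) => m; case: cid.
have finj m m' : 0 < m < m0 -> 0 < m' < m0 -> f m = f m' -> m = m'.
  wlog mm' : m m' / m < m'.
    by move=> HW; have [/HW//|/HW HW' a b c|//] := ltgtP m m'; rewrite HW'.
  move=> h1 h2 ff; exfalso.
  have [a1 a2 _] := Hf m h1; have [_ b2 _] := Hf m' h2; rewrite -ff in b2.
  by apply: (HB (f m) a1 (k + m) (k + m')) => //; rewrite ltrD2l.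
apply: (uncountable_itv m00); apply/countable_injP.
have /countable_injP [e Einj] := cE; exists (e \o f) => m m'.
rewrite !inE /= !in_itv /= => h1 h2 /Einj ff; apply: (finj m m' h1 h2); apply: ff.
  by rewrite inE; have [] := Hf m h1.
by rewrite inE; have [] := Hf m' h2.
Qed.

Definition phi2 : R := cint (-1) 1 (fun y => y * y * phi y).

Lemma id_cont : continuous (fun y : R => y). Proof. by move=> y; exact: cvg_id. Qed.

Lemma phi2_gt0 : 0 < phi2.
Proof.
have c : continuous (fun y : R => y * y * phi y).
  apply: contM (smooth_cont (@smooth_phi R)); exact: contM id_cont id_cont.
have h : (0 : R) <= 1 by [].
have h' : (-1 : R) <= 0 by rewrite oppr_le0.
rewrite /phi2 -(cint_chasles h' h c); apply: ltr_wpDl.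
  by apply: Rintegral_ge0 => y _; rewrite mulr_ge0 ?phi_ge0 // -expr2 sqr_ge0.
apply: cint_gt0 => // y /andP[y0 y1]; apply: mulr_gt0; first exact: mulr_gt0.
by apply: phi_gt0; rewrite y1 andbT (lt_trans _ y0) // oppr_lt0.
Qed.

(** As [phi] is even, the linear term averages out; of the parabola only the second moment [phi2]
    remains. *)
Lemma touch_upper (G : R -> R) x t a b : continuous G ->
  (forall y, -1 <= y <= 1 -> G (x + t * y) <= G x + a * y - b * (y * y)) ->
  cint (-1) 1 (fun y => G (x + t * y) * phi y) - cint (-1) 1 phi * G x <= - b * phi2.
Proof.
move=> cG HG; have cp := smooth_cont (@smooth_phi R).
have c0 : continuous (fun y : R => y * phi y) by exact: contM id_cont cp.
have c2 : continuous (fun y : R => y * y * phi y) by exact: contM (contM id_cont id_cont) cp.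
have odd : cint (-1) 1 (fun y : R => y * phi y) = 0.
  by apply: cint_even => // y; rewrite phiN mulNr.
rewrite lerBlDr.
have -> : - b * phi2 + cint (-1) 1 phi * G x =
    cint (-1) 1 (fun y => (G x * phi y + a * (y * phi y)) + - b * (y * y * phi y)).
  rewrite cintD; [|by apply: contD; exact: contZ|exact: contZ].
  rewrite cintD; [|exact: contZ|exact: contZ].
  by rewrite (cintZ _ _ _ cp) (cintZ _ _ _ c0) (cintZ _ _ _ c2) odd /phi2; ring.
apply: cint_le; first exact: contM (continuous_lin cG) cp.
  by apply: contD; [apply: contD; exact: contZ|exact: contZ].
move=> y y1; have -> : (G x * phi y + a * (y * phi y)) + - b * (y * y * phi y) =
  (G x + a * y - b * (y * y)) * phi y by ring.
by apply: ler_wpM2r; [exact: phi_ge0|exact: HG].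
Qed.

End Schwarz.

(** * A convex function with infinite curvature on a null set *)

Section SingularConvex.
Context {R : realType}.
Local Notation mu := (@lebesgue_measure R).
Implicit Types (x y : R).

Lemma negligible_outer (Z : set R) (e : R) : mu.-negligible Z -> 0 < e ->
  exists U : set R, [/\ open U, Z `<=` U & (mu U <= e%:E)%E].
Proof.
move=> [A [mA A0 ZA]] e0.
have Aoo : (mu A < +oo)%E by rewrite A0 ltry.
have [U [oU AU UA]] := lebesgue_regularity_outer mA Aoo e0.
exists U; split => //; first exact: subset_trans AU.
have mU : measurable U by exact: open_measurable.
have -> : U = (U `\` A) `|` A by rewrite setUC setDUK.
have := @measureU2 _ _ _ mu _ _ (measurableD mU mA) mA.
by move=> /le_trans; apply; rewrite [X in (_ + X)%E](_ : _ = 0%E) // adde0 ltW.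
Qed.

Section OneSet.
Variables (U : set R) (e : R).
Hypotheses (oU : open U) (Ue : (mu U <= e%:E)%E).

(** Slopes lie between 0 and 1 and equal 1 inside [U]: the building block of a function that is
    steep on a null set. *)
Definition mass x : R := fine (mu (U `&` `]-oo, x])).

Let mU : measurable U. Proof. exact: open_measurable. Qed.

Let fin_mass (A : set R) : measurable A -> mu (U `&` A) \is a fin_num.
Proof.
move=> mA; rewrite ge0_fin_numE //; apply: (@le_lt_trans _ _ e%:E); last exact: ltry.
by apply: le_trans Ue; apply: le_measure; rewrite ?inE //; exact: measurableI.
Qed.

Lemma mass_ge0 x : 0 <= mass x.
Proof. by apply: fine_ge0. Qed.

Lemma mass_le x : mass x <= e.
Proof.
rewrite -lee_fin fineK; last exact: fin_mass.
by apply: le_trans Ue; apply: le_measure; rewrite ?inE //; exact: measurableI.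
Qed.

Lemma massB x y : x <= y -> mass y - mass x = fine (mu (U `&` `]x, y])).
Proof.
move=> xy; rewrite /mass; have -> : U `&` `]-oo, y] = (U `&` `]-oo, x]) `|` (U `&` `]x, y]).
  rewrite -setIUr; congr (_ `&` _); apply/seteqP; split => z /=; rewrite !in_itv /=.
    by move=> zy; have [zx|xz] := leP z x; [left|right].
  by move=> [zx|/andP[]//]; exact: le_trans xy.
rewrite measureU; [|exact: measurableI|exact: measurableI|].
  by rewrite fineD; [rewrite addrAC subrr add0r|exact: fin_mass|exact: fin_mass].
apply/seteqP; split => z //= [[_ zx] [_]]; rewrite !in_itv /= in zx *.
by move=> /andP[xz _]; have := le_lt_trans zx xz; rewrite ltxx.
Qed.

Lemma mass_itv x y : x <= y -> 0 <= mass y - mass x <= y - x.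
Proof.
move=> xy; rewrite massB //; apply/andP; split; first exact: fine_ge0.
rewrite -lee_fin fineK; last exact: fin_mass.
apply: (@le_trans _ _ (mu `]x, y])).
  by apply: le_measure; rewrite ?inE //; exact: measurableI.
rewrite lebesgue_measure_itv /= lte_fin; case: ifP => _; first by rewrite -EFinB.
by rewrite lee_fin subr_ge0.
Qed.

Lemma mass_full x y : x <= y -> `]x, y]%classic `<=` U -> mass y - mass x = y - x.
Proof.
move=> xy H; rewrite massB //; have -> : U `&` `]x, y] = `]x, y]%classic by exact: setIidr.
rewrite lebesgue_measure_itv /= lte_fin; case: ltgtP xy => //= ->.
by rewrite subrr.
Qed.

End OneSet.

(* [k] is the sum of the functions [mu (U n `&` ]-oo, x])] for open sets [U n]
   containing [Z] of measure at most [2^-n]. *)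
Lemma singular_rate (Z : set R) : mu.-negligible Z -> exists k : R -> R,
  [/\ continuous k, (forall x y, x <= y -> k x <= k y) &
   forall x (n : nat), Z x -> exists2 r : R, 0 < r & forall y z, x - r < y -> y <= z -> z < x + r ->
     n%:R * (z - y) <= k z - k y].
Proof.
move=> nZ; have e0 n : 0 < 2^-1 ^+ n :> R by rewrite exprn_gt0 // invr_gt0.
have [U HU] : exists U : nat -> set R, forall n, [/\ open (U n), Z `<=` U n & (mu (U n) <= (2^-1 ^+ n)%:E)%E].
  by exists (fun n => projT1 (cid (negligible_outer nZ (e0 n)))) => n; case: cid.
have oU n : open (U n) by have [] := HU n.
have ZU n : Z `<=` U n by have [] := HU n.
have mU n : (mu (U n) <= (2^-1 ^+ n)%:E)%E by have [] := HU n.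
pose u n x := \sum_(i < n) mass (U i) x.
have uS n x : u n.+1 x = u n x + mass (U n) x by rewrite /u big_ord_recr.
have half n : 2^-1 ^+ n.+1 = 2^-1 ^+ n / 2 :> R by rewrite exprSr.
have tail n p x : 0 <= u (n + p)%N x - u n x <= 2 * (2^-1 ^+ n - 2^-1 ^+ (n + p)%N).
  elim: p => [|p IH]; first by rewrite addn0 !subrr mulr0 lexx.
  rewrite addnS uS half; have := mass_ge0 (U (n + p)%N) x; have := mass_le (oU (n + p)%N) (mU (n + p)%N) x.
  by move: IH => /andP[h1 h2] h3 h4; apply/andP; split; lra.
have tail2 n p x : (n <= p)%N -> 0 <= u p x - u n x <= 2 * 2^-1 ^+ n.
  move=> np; rewrite -(subnKC np); have /andP[h1 h2] := tail n (p - n)%N x.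
  by have := e0 (n + (p - n))%N; rewrite h1 /=; lra.
have [k Hk] : exists k : R -> R, forall x, u n x @[n --> \oo] --> k x.
  have cv x : exists l : R, u n x @[n --> \oo] --> l.
    suff : cvgn (u ^~ x) by move=> /cvg_ex.
    apply: nondecreasing_is_cvgn.
      by move=> n p np; have /andP[] := tail2 n p x np; rewrite subr_ge0.
    exists 2 => _ [n _ <-]; have /andP[_] := tail2 0%N n x (leq0n n).
    by rewrite expr0 {2}/u big_ord0 subr0 mulr1.
  by exists (fun x => projT1 (cid (cv x))) => x; case: cid.
have kdiff n x y : x <= y -> u n y - u n x <= k y - k x.
  move=> xy; apply: (cvgr_to_ge (cvgB (Hk y) (Hk x))); exists n => // p /= np.
  have : forall q, u n y - u n x <= u (n + q)%N y - u (n + q)%N x.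
    elim=> [|q IH]; first by rewrite addn0.
    rewrite addnS !uS; have /andP[+ _] := mass_itv (oU (n + q)%N) (mU (n + q)%N) xy; lra.
  by move=> /(_ (p - n)%N); rewrite subnKC.
have kmono x y : x <= y -> k x <= k y.
  by move=> xy; have := kdiff 0%N x y xy; rewrite /u !big_ord0 subrr subr_ge0.
have ulip n x y : x <= y -> 0 <= u n y - u n x <= n%:R * (y - x).
  move=> xy; elim: n => [|n IH]; first by rewrite /u !big_ord0 subrr mul0r lexx.
  rewrite !uS -natr1 mulrDl mul1r.
  have /andP[h1 h2] := mass_itv (oU n) (mU n) xy; move: IH => /andP[h3 h4].
  by apply/andP; split; lra.
have ktail n x : 0 <= k x - u n x <= 2 * 2^-1 ^+ n.
  have H : u p x - u n x @[p --> \oo] --> k x - u n x.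
    by apply: cvgB; [exact: Hk|exact: cvg_cst].
  apply/andP; split.
    by apply: (cvgr_to_ge H); exists n => // p /= np; have /andP[] := tail2 n p x np.
  by apply: (cvgr_to_le H); exists n => // p /= np; have /andP[] := tail2 n p x np.
exists k; split => //.
  move=> x; apply/cvgrPdist_le => eps eps0.
  have [n Hn] : exists n : nat, 2 * 2^-1 ^+ n < eps / 2 :> R.
    have h1 : 0 < eps / 4 by rewrite divr_gt0.
    have [n _ Hn] := near_infty_natSinv_lt (PosNum h1); exists n.
    have : 2^-1 ^+ n <= n.+1%:R^-1 :> R.
      by rewrite exprVn lef_pV2 ?posrE ?exprn_gt0 // -natrX ler_nat ltn_expl.
    have h2 : n.+1%:R^-1 < eps / 4 by exact: (Hn n (leqnn n)).
    by move: h2; set p := 2^-1 ^+ n; set q := n.+1%:R^-1; lra.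
  apply/nbhs_ballP; exists (eps / 2 / n.+1%:R); first by rewrite /= !divr_gt0.
  move=> y; rewrite /ball /= ltr_pdivlMr // => xy.
  have : `|u n x - u n y| <= eps / 2.
    apply: le_trans (ltW xy); rewrite mulrC.
    apply: (@le_trans _ _ (n%:R * `|x - y|)); last by rewrite ler_wpM2r // ler_nat.
    have /orP[h|h] := le_total x y.
      rewrite distrC [`|x - y|]distrC; have /andP[h1 h2] := ulip n x y h.
      by rewrite !ger0_norm ?subr_ge0 // -subr_ge0.
    by have /andP[h1 h2] := ulip n y x h; rewrite !ger0_norm // subr_ge0.
  have /andP[h1 h2] := ktail n x; have /andP[h3 h4] := ktail n y.
  by rewrite !ler_norml => /andP[h5 h6]; apply/andP; split; lra.
move=> x n Zx.
(* One ball inside the first [n] open sets: on it each of them contributes slope 1, and all the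
   others a nonnegative amount. *)
have [r r0 Hr] : exists2 r : R, 0 < r & forall i, (i < n)%N -> ball x r `<=` U i.
  elim: n => [|n [r r0 Hr]]; first by exists 1.
  have : nbhs x (U n) by apply: open_nbhs_nbhs; split => //; exact: ZU.
  move=> /nbhs_ballP [r' /= r'0 Hr']; exists (Num.min r r'); first by rewrite lt_min r0.
  move=> i; rewrite ltnS leq_eqVlt => /predU1P[->|il] z; rewrite /ball /= lt_min => /andP[z1 z2].
    exact: Hr'.
  by apply: (Hr i il).
exists r => // y z xy yz zx; apply: le_trans (kdiff n y z yz).
have : forall m, (m <= n)%N -> m%:R * (z - y) <= u m z - u m y.
  elim=> [|m IH] mn; first by rewrite mul0r /u !big_ord0 subrr.
  rewrite !uS -natr1 mulrDl mul1r.
  have := mass_full (oU m) (mU m) yz; move=> /(_ _)/wrap[].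
    move=> v /=; rewrite in_itv /= => /andP[v1 v2]; apply: (Hr m mn).
    by rewrite /ball /= ltr_norml; apply/andP; split; lra.
  by have := IH (ltnW mn); lra.
by apply.
Qed.

(** [K] is a primitive of the nondecreasing [k] of [singular_rate], so [s = k x] is a supporting
    slope; where [k] rises at rate [2 * n], the primitive gains [n * h ^+ 2] over its tangent. *)
Lemma singular_convex (Z : set R) (lo hi : R) : lo < hi -> mu.-negligible Z ->
  exists2 K : R -> R, continuous K & forall x, lo < x < hi -> exists s : R,
    exists2 r : R, 0 < r & (forall h, `|h| < r -> K x + s * h <= K (x + h)) /\
    (Z x -> forall n : nat, exists2 r : R, 0 < r & forall h, `|h| < r ->
       K x + s * h + n%:R * (h * h) <= K (x + h)).
Proof.
move=> lohi nZ; have [k [ck kmono kZ]] := singular_rate nZ.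
have [F HF] := cont_primitive lo hi ck.
exists (fun x => F (clamp lo hi x)).
  move=> x; apply: (@continuous_comp _ _ _ (clamp lo hi) F).
    have : forall x y, `|clamp lo hi y - clamp lo hi x| <= 1 * `|y - x|.
      by move=> u v; rewrite mul1r; exact: clamp_lipschitz.
    by move=> /lipschitz_cont; apply.
  exact: is_derive_cont (HF _ (clamp_bounds x (ltW lohi))).
(* Between [x] and [y] the derivative [g'] has the sign of [z - x], so [g] does not fall below
   [g x]. *)
have quad x y (n : R) : lo <= x <= hi -> lo <= y <= hi ->
   (forall z z', Num.min x y <= z -> z <= z' -> z' <= Num.max x y -> n * (z' - z) <= k z' - k z) ->
   F x + k x * (y - x) + n / 2 * ((y - x) * (y - x)) <= F y.
  move=> xl yl H.
  pose g z := F z - k x * z - n / 2 * ((z - x) * (z - x)).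
  pose g' z := k z - k x - n * (z - x).
  have Dg z : lo <= z <= hi -> is_derive z 1 g (g' z).
    move=> zl; have D1 : is_derive z 1 (fun z : R => k x * z) (k x).
      by rewrite -[X in is_derive _ _ _ X]mulr1; apply: is_derive_scal.
    have D2 : is_derive z 1 (fun z : R => z - x) 1.
      by rewrite -[X in is_derive _ _ _ X]addr0; apply: is_derive_add.
    have D3 := is_derive_scal (n / 2) (is_derive_mul D2 D2).
    have -> : g' z = (k z + - k x) + - (n / 2 * (1 * (z - x) + (z - x) * 1)).
      by rewrite /g'; field.
    exact: (is_derive_add (is_derive_add (HF z zl) (is_derive_opp D1)) (is_derive_opp D3)).
  suff : g x <= g y by rewrite /g subrr; lra.
  have mvt u v : u < v -> lo <= u -> v <= hi -> exists2 z, u < z < v & g v - g u = g' z * (v - u).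
    move=> uv lu vh; have [||z zuv ->] := @MVT _ g g' u v uv.
    - by move=> z; rewrite in_itv /= => /andP[h1 h2]; apply: Dg; apply/andP; split; lra.
    - apply: derivable_within_continuous => z; rewrite in_itv /= => /andP[h1 h2].
      by have [] := Dg z; rewrite ?(le_trans lu h1) ?(le_trans h2 vh).
    - by exists z => //; move: zuv; rewrite in_itv.
  move: xl yl => /andP[lx xh] /andP[ly yh].
  have [xy|yx|->//] := ltgtP x y.
    have [z /andP[z1 z2] Hz] := mvt x y xy lx yh.
    rewrite -subr_ge0 Hz mulr_ge0 ?subr_ge0 ?(ltW xy) //.
    have := H x z; rewrite (min_l (ltW xy)) (max_r (ltW xy)) lexx (ltW z1) (ltW z2).
    by move=> /(_ isT isT isT).
  have [z /andP[z1 z2] Hz] := mvt y x yx ly xh.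
  rewrite -subr_le0 Hz mulr_le0_ge0 ?subr_ge0 ?(ltW yx) //.
  have := H z x; rewrite (min_r (ltW yx)) (max_l (ltW yx)) lexx (ltW z1) (ltW z2).
  by move=> /(_ isT isT isT); rewrite /g'; lra.
move=> x /andP[lx xh]; exists (k x).
pose r0 := Num.min (x - lo) (hi - x).
have r00 : 0 < r0 by rewrite lt_min !subr_gt0 lx.
have near_x h : `|h| < r0 -> lo <= x + h <= hi.
  rewrite lt_min !ltr_norml => /andP[/andP[h1 h2] /andP[h3 h4]]; apply/andP; split; lra.
have xl : lo <= x <= hi by rewrite !ltW.
exists r0 => //; split.
  move=> h hr; rewrite (clamp_id xl) (clamp_id (near_x h hr)).
  have := @quad x (x + h) 0 xl (near_x h hr); rewrite !mul0r addr0 addrAC subrr add0r; apply.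
  by move=> z z' _ zz _; rewrite mul0r subr_ge0; exact: kmono.
move=> Zx n; have [r1 r10 Hr1] := kZ x (2 * n)%N Zx.
exists (Num.min r0 r1); first by rewrite lt_min r00.
move=> h; rewrite lt_min => /andP[hr hr1]; rewrite (clamp_id xl) (clamp_id (near_x h hr)).
have := @quad x (x + h) (2 * n)%N%:R xl (near_x h hr).
have -> : x + h - x = h by ring.
have -> : (2 * n)%N%:R / 2 = n%:R :> R by rewrite natrM; field.
apply => z z' h1 zz h2; apply: Hr1 => //.
  by move: h1; rewrite ltr_norml in hr1; case: (leP x (x + h)) => _; move: hr1 => /andP[a1 a2]; lra.
by move: h2; rewrite ltr_norml in hr1; case: (leP x (x + h)) => _; move: hr1 => /andP[a1 a2]; lra.
Qed.

End SingularConvex.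

(** * Positivity *)

Lemma cont_neg_near (R : realType) (f : R -> R) x : continuous f -> f x < 0 ->
  exists2 d : R, 0 < d & forall z, `|z - x| < d -> f z < 0.
Proof.
move=> cf fx; have := @cf x; move=> /cvgrPdist_lt /(_ (- f x)); rewrite oppr_gt0 => /(_ fx).
move=> /nbhs_ballP [d /= d0 Hd]; exists d => // z zx.
by have := Hd z; rewrite /ball /= distrC => /(_ zx); rewrite ltr_norml => /andP[h1 h2]; lra.
Qed.

(** Were [j2 x] negative, it would be so nearby. Two mean values turn the second difference of [j]
    into a difference of [j1], and a third turns this into a positive factor times a value of [j2]
    near [x]. *)
Lemma second_difference_ge0 (R : realType) (j j1 j2 : R -> R) (x e : R) :
  (forall z : R, is_derive z 1 j (j1 z)) -> (forall z : R, is_derive z 1 j1 (j2 z)) ->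
  continuous j2 -> 0 < e -> (forall h, 0 < h <= e -> 0 <= j (x + h) + j (x - h) - 2 * j x) ->
  0 <= j2 x.
Proof.
move=> D1 D2 cj2 e0 Hj; rewrite leNgt; apply/negP => j2x.
have [d d0 Hd] := cont_neg_near cj2 j2x.
pose h := Num.min (d / 2) e.
have h0 : 0 < h by rewrite lt_min !divr_gt0.
have [hd he] : h <= d / 2 /\ h <= e by rewrite /h !ge_min !lexx !orbT.
clearbody h.
have mvt (f f' : R -> R) (u v : R) : (forall z : R, is_derive z 1 f (f' z)) -> u < v ->
    exists2 z, u < z < v & f v - f u = f' z * (v - u).
  move=> Df uv; have [|z zuv ->] := @MVT _ f f' u v uv.
  - by apply: continuous_subspaceT => z; exact: is_derive_cont (Df z).
  - by exists z => //; move: zuv; rewrite in_itv.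
have xxh : x < x + h by rewrite ltrDl.
have xhx : x - h < x by rewrite gtrBl.
have [z1 /andP[a1 a2] E1] := mvt j j1 x (x + h) D1 xxh.
have [z2 /andP[b1 b2] E2] := mvt j j1 (x - h) x D1 xhx.
have z21 : z2 < z1 by exact: lt_trans b2 a1.
have [z /andP[c1 c2] E3] := mvt j1 j2 z2 z1 D2 z21.
have jz : j2 z < 0 by apply: Hd; rewrite ltr_norml; apply/andP; split; lra.
have := Hj h; rewrite h0 he => /(_ isT); rewrite leNgt => /negP; apply.
have -> : j (x + h) + j (x - h) - 2 * j x = (j (x + h) - j x) - (j x - j (x - h)) by ring.
rewrite E1 E2 [x + h - x]addrAC subrr add0r.
have -> : x - (x - h) = h by ring.
by rewrite -mulrBl E3 pmulr_llt0 // nmulr_rlt0 // subr_gt0.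
Qed.

(** * Convex primitives give nonnegative dilations *)

Section ConvexDilation.
Context {R : realType}.
Variables (G : R -> R) (lo hi : R).
Hypotheses (cG : continuous G) (lohi : lo < hi).
Hypothesis convG : forall p q x, lo <= p -> p < q -> q <= hi -> p <= x <= q ->
  (q - p) * G x <= (q - x) * G p + (x - p) * G q.
Local Notation TG := (cdist G lo hi).

Lemma convex_average x t h : 0 < t -> lo <= x - h - t -> x + h + t <= hi -> 0 < h ->
  0 <= cint (-1) 1 (fun y => G (x + h + t * y) * psi y) +
    cint (-1) 1 (fun y => G (x - h + t * y) * psi y) - 2 * cint (-1) 1 (fun y => G (x + t * y) * psi y).
Proof.
move=> t0 lx xh h0.
have cc u : continuous (fun y => G (u + t * y) * psi y).
  exact: contM (continuous_lin cG) (smooth_cont (@smooth_psi R)).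
rewrite -(cintZ _ _ _ (cc _)) -cintD; [|exact: cc|exact: cc].
rewrite -cintB; [|exact: contD (cc _) (cc _)|exact: contZ (cc _)].
apply: Rintegral_ge0 => y; rewrite /= in_itv /= => /andP[y1 y2].
have -> : G (x + h + t * y) * psi y + G (x - h + t * y) * psi y - 2 * (G (x + t * y) * psi y) =
  (G (x + h + t * y) + G (x - h + t * y) - 2 * G (x + t * y)) * psi y by ring.
apply: mulr_ge0; last exact: psi_ge0.
have ty1 : - t <= t * y by rewrite -mulrN1 ler_pM2l.
have ty2 : t * y <= t by rewrite -[leRHS]mulr1 ler_pM2l.
have := @convG (x - h + t * y) (x + h + t * y) (x + t * y).
have -> : x + h + t * y - (x - h + t * y) = 2 * h by ring.
have -> : x + h + t * y - (x + t * y) = h by ring.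
have -> : x + t * y - (x - h + t * y) = h by ring.
move=> /(_ _ _ _ _)/wrap[]; [lra|lra|lra|by apply/andP; split; lra|].
by rewrite -mulrDr [2 * h]mulrC -mulrA ler_pM2l //; lra.
Qed.

(** The dilation by [psi''] is [t ^+ 2] times the second derivative in [x] of the average of [G] by
    [psi], and averages of a convex function are convex. The strict inequalities leave room for
    second differences. *)
Lemma convex_dilation_ge0 x t : 0 < t -> lo < x - t -> x + t < hi ->
  0 <= dilation TG x t psi^`()%classic^`()%classic.
Proof.
move=> t0 lx xh.
have HT := cdist_distribution cG lohi.
have tpsi := @tpsi R.
have tpsi' := test_derive tpsi; have tpsi'' := test_derive tpsi'.
have D1 (z : R) := is_derive_dilation z HT tpsi t0.
have D2 (z : R) := is_derive_scal (- t^-1) (is_derive_dilation z HT tpsi' t0).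
have cj2 := @contZ _ (- t^-1) _ (@contZ _ (- t^-1) _ (dilation_cont HT tpsi'' t0)).
pose e := Num.min ((x - t - lo) / 2) ((hi - (x + t)) / 2).
have e0 : 0 < e by rewrite !lt_min !divr_gt0 ?subr_gt0.
have [h1 h2] : e <= (x - t - lo) / 2 /\ e <= (hi - (x + t)) / 2 by rewrite /e !ge_min !lexx !orbT.
clearbody e.
have cp := smooth_cont (@smooth_psi R).
have vp : vanish 1 (@psi R) by exact: psi0.
have jE u : lo <= u - t -> u + t <= hi ->
    dilation TG u t psi = cint (-1) 1 (fun y => G (u + t * y) * psi y).
  by move=> u1 u2; exact: (@dilation_cdist _ G lo hi cG u t psi t0 u1 u2 cp vp).
have := @second_difference_ge0 R _ _ _ x e D1 D2 cj2 e0.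
move=> /(_ _)/wrap[].
  move=> h /andP[h0 he]; rewrite !jE; [|clear - h1 h2 h0 he t0; lra..].
  by apply: convex_average => //; clear - h1 h2 h0 he t0; lra.
by rewrite mulrA mulrNN pmulr_rge0 // mulr_gt0 // invr_gt0.
Qed.

End ConvexDilation.

Section Positivity.
Context {R : realType}.
Local Notation mu := (@lebesgue_measure R).
Variables w W : (R -> R) -> R.
Hypothesis Hw : Defs.distribution w.
Hypothesis HW : Defs.distribution W.
Hypothesis wW : derivative_of W w.
Hypothesis pvW : forall x, exists c, point_value W x c.
Variables E Z : set R.
Hypothesis cE : countable E.
Hypothesis nZ : mu.-negligible Z.
Hypothesis lowZ : forall x, ~ E x -> ~ Z x -> forall e, 0 < e -> exists2 tau : R, 0 < tau &
  forall t, 0 < t < tau -> - e <= dilation w x t psi.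
Hypothesis lowE : forall x, ~ E x -> exists M tau : R, 0 < tau /\
  forall t, 0 < t < tau -> - M <= dilation w x t psi.

(** Up to sign this is the dilation of [W] by [psi'], which tends to a point value times the
    integral of [psi'], hence to 0. It holds at every point, also in [E], where nothing is assumed
    about the dilations of [w]. *)
Lemma dilation_vanishing x e : 0 < e -> exists2 tau : R, 0 < tau &
  forall t, 0 < t < tau -> - e <= t * dilation w x t psi.
Proof.
move=> e0; have tpsi := @tpsi R; have [c /(_ _ (test_derive tpsi)) H] := pvW x.
have z0 : \int[mu]_y psi^`()%classic y = 0.
  rewrite (@Rintegral_cint _ _ (-2) 2); last first.
    by move=> y /out_norm y2; apply: (vanish_derive (fun y => @psi0 R y)); apply: lt_trans y2; rewrite ltr1n.
  apply: cint_even => //; last exact: smooth_cont (smooth_derive (@smooth_psi R)).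
  by move=> y; rewrite derive_psi phiN mulNr.
rewrite z0 mulr0 in H; have := H; move=> /cvgr0Pnorm_lt /(_ e e0) [d /= d0 Hd].
exists d => // t /andP[t0 td]; rewrite (dilation_derivative HW wW) // mulrA mulrN mulfV ?gt_eqF //.
rewrite mulN1r lerN2; have := Hd t; rewrite /ball /= sub0r normrN gtr0_norm // => /(_ td).
by rewrite gt_eqF // => /(_ isT); rewrite ltr_norml => /andP[_ /ltW].
Qed.

Section Local.
Variables (G : R -> R) (lo hi : R).
Hypotheses (cG : continuous G) (lohi : lo < hi).
Hypothesis repG : forall (c d : R) (th : R -> R), lo < c -> d < hi -> smooth th ->
  (forall x, ~~ (c <= x <= d) -> th x = 0) ->
  W th = - cint lo hi (fun x => G x * th^`()%classic x).

(** On []lo, hi[] the distribution [W] is [G'] and [w] is [G'']; the two derivatives fall on the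
    bump at scale [t] and produce [t^-1 ^+ 2]. *)
Lemma dilation_rep x t : 0 < t -> lo < x - t -> x + t < hi ->
  dilation w x t psi = t^-1 ^+ 2 * dilation (cdist G lo hi) x t psi^`()%classic^`()%classic.
Proof.
move=> t0 lx xh; have spsi := @smooth_psi R; have spsi' := smooth_derive spsi.
have v z : ~~ (x - t <= z <= x + t) -> psi^`()%classic ((z - x) / t) = 0.
  move=> Hz; apply: (vanish_derive (fun y => @psi0 R y)).
  rewrite normrM normfV (gtr0_norm t0) ltr_pdivlMr // mul1r.
  by apply: out_norm; apply: contra Hz => /andP[h1 h2]; apply/andP; split; lra.
rewrite (dilation_derivative HW wW x t0 (@tpsi R)) !(dilationE _ _ _ t0).
rewrite (repG lx xh (@smooth_comp_affine _ _ x t spsi') v).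
rewrite (derive1_affine x t spsi') /cdist.
have cpp := smooth_cont (@smooth_comp_affine _ _ x t (smooth_derive spsi')).
have -> : cint lo hi (fun z => G z * (t^-1 * psi^`()%classic^`()%classic ((z - x) / t))) =
   t^-1 * cint lo hi (fun z => G z * psi^`()%classic^`()%classic ((z - x) / t)).
  rewrite -(@cintZ _ _ _ lo hi (contM cG cpp)); apply: eq_cint => z _; ring.
ring.
Qed.

(** The average of [G] minus the weighted value at the centre is at most [- b * phi2 * t ^+ 2] by
    contact with the parabola, and at least [- C * t ^+ 2] because its derivative in [t] is [t]
    times a dilation of [w]. *)
Lemma touch_slope x a b r C tau : lo < x < hi -> 0 < r -> 0 < tau -> 0 <= C ->
  (forall h, `|h| < r -> G (x + h) <= G x + a * h - b * (h * h)) ->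
  (forall t, 0 < t < tau -> - C <= dilation w x t psi) -> b * phi2 <= C.
Proof.
move=> /andP[lx xh] r0 tau0 C0 HG HC.
pose t := Num.min (Num.min (r / 2) (tau / 2)) (Num.min ((x - lo) / 2) ((hi - x) / 2)).
have t0 : 0 < t by rewrite !lt_min !divr_gt0 ?subr_gt0.
have [[tr tt] [t1 t2]] : (t <= r / 2 /\ t <= tau / 2) /\ (t <= (x - lo) / 2 /\ t <= (hi - x) / 2).
  by rewrite /t !ge_min !lexx !orbT.
clearbody t.
have := @touch_upper _ G x t (a * t) (b * (t * t)) cG; move=> /(_ _)/wrap[].
  move=> y y1; have := HG (t * y); rewrite normrM (gtr0_norm t0) => /(_ _)/wrap[].
    apply: (@le_lt_trans _ _ t); last by lra.
    by rewrite ger_pMr // ler_norml.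
  by rewrite mulrA => /le_trans; apply; rewrite le_eqVlt; apply/orP; left; apply/eqP; ring.
move=> H1; have := @dilation_lower _ G lo hi cG x t (C * t) t0; move=> /(_ _ _ _ _)/wrap[].
- lra.
- lra.
- by rewrite mulr_ge0 // ltW.
- move=> s /andP[s0 st]; have /andP[s1 s2] : (lo < x - s) && (x + s < hi) by apply/andP; split; lra.
  have : - C <= dilation w x s psi by apply: HC; apply/andP; split; lra.
  rewrite (dilation_rep s0 s1 s2) => H.
  have -> : s^-1 * dilation (cdist G lo hi) x s psi^`()%classic^`()%classic =
    s * (s^-1 ^+ 2 * dilation (cdist G lo hi) x s psi^`()%classic^`()%classic) by field; rewrite gt_eqF.
  apply: (@le_trans _ _ (- (C * s))); first by rewrite lerN2 ler_wpM2l.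
  by rewrite mulrC -mulrN ler_pM2l.
move=> H2; have := le_trans H2 H1; rewrite !mulNr -mulrA lerN2 mulrAC ler_pM2r //.
exact: mulr_gt0.
Qed.

(** Two contact lines confine [G] below a concave corner. Since [y ^+ 2] is at most the absolute
    value of [y] on [[-1, 1]], the average drops by at least [d * phi2 * t], of first order in [t],
    which [dilation_vanishing] forbids. *)
Lemma touch_two_slopes x a a' r : lo < x < hi -> 0 < r -> a < a' ->
  (forall h, `|h| < r -> G (x + h) <= G x + a * h) ->
  (forall h, `|h| < r -> G (x + h) <= G x + a' * h) -> False.
Proof.
move=> /andP[lx xh] r0 aa' Ha Ha'.
pose d := (a' - a) / 2; have d0 : 0 < d by rewrite divr_gt0 // subr_gt0.
pose eta := d * phi2 / 2.
have p2 := @phi2_gt0 R.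
have eta0 : 0 < eta by rewrite divr_gt0 // mulr_gt0.
have [tau tau0 Htau] := dilation_vanishing x eta0.
pose t := Num.min (Num.min (r / 2) (tau / 2)) (Num.min ((x - lo) / 2) ((hi - x) / 2)).
have t0 : 0 < t by rewrite !lt_min !divr_gt0 ?subr_gt0.
have [[tr tt] [t1 t2]] : (t <= r / 2 /\ t <= tau / 2) /\ (t <= (x - lo) / 2 /\ t <= (hi - x) / 2).
  by rewrite /t !ge_min !lexx !orbT.
clearbody t.
have := @touch_upper _ G x t ((a + a') / 2 * t) (d * t) cG; move=> /(_ _)/wrap[].
  move=> y y1; have ty : `|t * y| < r.
    rewrite normrM (gtr0_norm t0); apply: (@le_lt_trans _ _ t); last by lra.
    by rewrite ger_pMr // ler_norml.
  move: y1 => /andP[y1 y2]; have [y0|y0] := leP 0 y.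
    apply: (le_trans (Ha _ ty)); rewrite -addrA lerD2l.
    have -> : (a + a') / 2 * t * y - d * t * (y * y) = a * (t * y) + d * t * (y * (1 - y)).
      by rewrite /d; field.
    by rewrite lerDl; apply: mulr_ge0; [rewrite mulr_ge0 // ltW|rewrite mulr_ge0 // subr_ge0].
  apply: (le_trans (Ha' _ ty)); rewrite -addrA lerD2l.
  have -> : (a + a') / 2 * t * y - d * t * (y * y) = a' * (t * y) + d * t * ((- y) * (1 + y)).
    by rewrite /d; field.
  by rewrite lerDl; apply: mulr_ge0; [rewrite mulr_ge0 // ltW|rewrite mulr_ge0 //; lra].
move=> H1; have := @dilation_lower _ G lo hi cG x t eta t0; move=> /(_ _ _ _ _)/wrap[].
- lra.
- lra.
- exact: ltW.
- move=> s /andP[s0 st]; have /andP[s1 s2] : (lo < x - s) && (x + s < hi) by apply/andP; split; lra.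
  have : - eta <= s * dilation w x s psi by apply: Htau; apply/andP; split; lra.
  rewrite (dilation_rep s0 s1 s2) => H.
  have -> : s^-1 * dilation (cdist G lo hi) x s psi^`()%classic^`()%classic =
    s * (s^-1 ^+ 2 * dilation (cdist G lo hi) x s psi^`()%classic^`()%classic) by field; rewrite gt_eqF.
  exact: H.
move=> H2; have := le_trans H2 H1; rewrite !mulNr lerN2 mulrAC ler_pM2r // /eta.
by rewrite leNgt ltr_pdivrMr // ltr_pMr ?ltr1n // mulr_gt0.
Qed.

(** The perturbation [e * Q] has two tasks: on [Z] the unbounded curvature of [K] beats whatever
    finite lower bound [w] has, and elsewhere off [E] the term [u * u] beats the lower bound
    [- (e * phi2 / 2)]. On [E] only the exclusion of two slopes is used. Finally [e] tends to 0. *)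
Lemma primitive_convex p q x : lo <= p -> p < q -> q <= hi -> p <= x <= q ->
  (q - p) * G x <= (q - x) * G p + (x - p) * G q.
Proof.
move=> lp pq qh xpq.
have [K cK HK] := singular_convex lohi nZ.
pose Q u := K u + u * u.
have cQ : continuous Q by apply: contD cK _; exact: contM (@id_cont R) (@id_cont R).
pose B := (q - x) * Q p + (x - p) * Q q - (q - p) * Q x.
apply: (@le_all_eps _ _ _ B) => e e0.
pose H u := G u + e * Q u.
have cH : continuous H by apply: contD cG _; exact: contZ.
have p2 := @phi2_gt0 R.
suff : (q - p) * H x <= (q - x) * H p + (x - p) * H q by rewrite /H /B; lra.
apply: (schwarz_convex cE cH pq) => // u /andP[pu uq].
  move=> nEu s [r r0 Hr].
  have lu : lo < u < hi by apply/andP; split; lra.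
  have [sg [rk rk0 [Hk1 Hk2]]] := HK u lu.
  have touch (n : nat) : (exists2 r : R, 0 < r & forall h, `|h| < r ->
       K u + sg * h + n%:R * (h * h) <= K (u + h)) -> exists2 r : R, 0 < r & forall h, `|h| < r ->
       G (u + h) <= G u + (s - e * sg - 2 * e * u) * h - e * n.+1%:R * (h * h).
    move=> [r' r'0 Hr']; exists (Num.min r r'); first by rewrite lt_min r0.
    move=> h; rewrite lt_min => /andP[hr hr']; have := Hr h hr; have := Hr' h hr'.
    rewrite -(ler_pM2l e0) /H /Q -natr1; lra.
  have [Zu|nZu] := pselect (Z u).
    have [M [tau [tau0 HM]]] := lowE nEu.
    (* Makes [e * n.+1%:R * phi2] exceed the absolute value of [M]; of the curvature [n.+1], the
       part [n] comes from [K] and 1 from [u * u]. *)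
    pose n := Num.truncn (`|M| / (e * phi2)).
    have [r1 r10 Hr1] := touch n (Hk2 Zu n).
    have HM' t : 0 < t < tau -> - `|M| <= dilation w u t psi.
      by move=> /HM; apply: le_trans; rewrite lerN2 ler_norm.
    have := touch_slope lu r10 tau0 (normr_ge0 M) Hr1 HM'.
    rewrite leNgt => /negP; apply.
    have -> : e * n.+1%:R * phi2 = n.+1%:R * (e * phi2) by ring.
    by rewrite -ltr_pdivrMr ?mulr_gt0 // truncnS_gt.
  have c0 : 0 < e * phi2 / 2 by rewrite divr_gt0 // mulr_gt0.
  have [tau tau0 Htau] := lowZ nEu nZu c0.
  have [r1 r10 Hr1] : exists2 r : R, 0 < r & forall h, `|h| < r ->
       G (u + h) <= G u + (s - e * sg - 2 * e * u) * h - e * 1%:R * (h * h).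
    by apply: (touch 0%N); exists rk => // h hr; rewrite mul0r addr0; exact: Hk1.
  have := touch_slope lu r10 tau0 (ltW c0) Hr1 Htau.
  by rewrite mulr1 leNgt ltr_pdivrMr // ltr_pMr ?ltr1n // mulr_gt0.
move=> s s' ss' [r r0 Hr] [r' r'0 Hr'].
have lu : lo < u < hi by apply/andP; split; lra.
have [sg [rk rk0 [Hk1 _]]] := HK u lu.
have touch s1 h : `|h| < rk -> H (u + h) <= H u + s1 * h -> G (u + h) <= G u + (s1 - e * sg - 2 * e * u) * h.
  move=> hk; have := Hk1 h hk; rewrite -(ler_pM2l e0) /H /Q.
  have : 0 <= e * (h * h) by rewrite mulr_ge0 ?(ltW e0) // -expr2 sqr_ge0.
  lra.
apply: (@touch_two_slopes u (s - e * sg - 2 * e * u) (s' - e * sg - 2 * e * u)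
  (Num.min rk (Num.min r r')) lu); first by rewrite !lt_min rk0 r0.
- by rewrite !ltrD2r.
- by move=> h; rewrite !lt_min => /and3P[h1 h2 h3]; apply: touch => //; exact: Hr.
- by move=> h; rewrite !lt_min => /and3P[h1 h2 h3]; apply: touch => //; exact: Hr'.
Qed.

End Local.

(* Near a bad point the second primitive of [w] is convex, after adding
   small multiples of a convex function that is infinitely curved on [Z]. *)
Lemma positivity x : good w x.
Proof.
apply: contrapT => bad.
have [x1 [r [N [tau [bad1 r0 tau0 HN]]]]] := locally_bounded Hw HW wW pvW bad.
pose lo := x1 - r; pose hi := x1 + r.
have lohi : lo < hi by rewrite /lo /hi; lra.
have bd u t : lo <= u <= hi -> 0 < t < tau -> `|dilation W u t psi| <= N.
  move=> /andP[u1 u2]; apply: HN; rewrite /lo /hi in u1 u2.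
  by rewrite ler_norml; apply/andP; split; lra.
have [G cG repG] := primitive_rep HW pvW lohi tau0 bd.
have convG := primitive_convex cG lohi repG.
apply: bad1; exists (r / 2); first by rewrite divr_gt0.
move=> u t; rewrite ltr_norml => /andP[u1 u2] /andP[t0 tr].
have lu : lo < u - t by rewrite /lo; lra.
have uh : u + t < hi by rewrite /hi; lra.
rewrite (dilation_rep cG repG t0 lu uh) mulr_ge0 ?sqr_ge0 //.
exact: (convex_dilation_ge0 cG lohi convG t0 lu uh).
Qed.

End Positivity.

(** * Comparison of major and minor pairs *)

Section LimitInferior.
Context {R : realType} {T : choiceType} {X : filteredType T}.
Implicit Types (f : X -> \bar R) (F : set (set X)).

Lemma limf_einf_lt f F (c : \bar R) : Filter F -> (c < limf_einf f F)%E ->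
  F [set x | (c < f x)%E].
Proof.
move=> FF; rewrite limf_einfE => /ereal_sup_gt [_ [V FV <-]] cV.
apply: filterS FV => x Vx; apply: lt_le_trans cV _.
by apply: ereal_inf_lbound; exists x.
Qed.

Lemma limf_einf_ge f F (L : \bar R) : Filter F ->
  (forall c : R, (c%:E < L)%E -> F [set x | (c%:E <= f x)%E]) -> (L <= limf_einf f F)%E.
Proof.
move=> FF H; have K (c : R) : (c%:E < L)%E -> (c%:E <= limf_einf f F)%E.
  move=> /H cF; rewrite limf_einfE.
  apply: (@le_trans _ _ (ereal_inf (f @` [set x | (c%:E <= f x)%E]))).
    by apply: le_ereal_inf_tmp => _ [x /= cx <-].
  by apply: ereal_sup_ubound; exists [set x | (c%:E <= f x)%E].
case: L {H} K => [r| |] K; last by rewrite leNye.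
  apply/lee_subgt0Pr => e e0; rewrite -EFinB; apply: K.
  by rewrite lte_fin ltrBlDr ltrDl.
by rewrite leye_eq; apply/eqP/eqyP => r r0; apply: K; rewrite ltry.
Qed.

End LimitInferior.

Lemma limn_einf_ge (R : realType) (f : nat -> \bar R) (L : \bar R) :
  (forall c : R, (c%:E < L)%E -> \forall n \near \oo, (c%:E <= f n)%E) -> (L <= limn_einf f)%E.
Proof. exact: (@limf_einf_ge R _ _ f \oo L _). Qed.

Lemma limn_einf_lt (R : realType) (f : nat -> \bar R) (c : \bar R) :
  (c < limn_einf f)%E -> \forall n \near \oo, (c < f n)%E.
Proof. exact: (@limf_einf_lt R _ _ f \oo c _). Qed.

(** * Lower and upper values of dilations *)

Section Values.
Context {R : realType}.
Implicit Types (f : R -> R) (T : (R -> R) -> R).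

Lemma dilationN T x t f : dilation (fun g => - T g) x t f = - dilation T x t f.
Proof. by rewrite /dilation mulrN. Qed.

Lemma lower_valueN T f x : lower_value (fun g => - T g) f x = (- upper_value T f x)%E.
Proof.
rewrite /lower_value /upper_value -limf_einfN; congr (limf_einf _ _).
by apply/funext => t; rewrite dilationN EFinN.
Qed.

Lemma near_at_right0 (P : R -> Prop) : (\forall t \near 0^'+, P t) ->
  exists2 tau : R, 0 < tau & forall t, 0 < t < tau -> P t.
Proof.
move=> [tau /= tau0 H]; exists tau => // t /andP[t0 tt]; apply: H => //.
by rewrite /= sub0r normrN gtr0_norm.
Qed.

Lemma at_right0_near (P : R -> Prop) (tau : R) : 0 < tau -> (forall t, 0 < t < tau -> P t) ->
  \forall t \near 0^'+, P t.
Proof.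
move=> tau0 H; near=> t; apply: H; apply/andP; split; near: t; first exact: nbhs_right_gt.
exact: nbhs_right_lt.
Unshelve. all: by end_near. Qed.

Lemma lower_value_lt T f x (c : R) : (c%:E < lower_value T f x)%E ->
  exists2 tau : R, 0 < tau & forall t, 0 < t < tau -> c < dilation T x t f.
Proof. by move=> /limf_einf_lt /near_at_right0 [tau tau0 H]; exists tau. Qed.

Lemma upper_value_gt T f x (c : R) : (upper_value T f x < c%:E)%E ->
  exists2 tau : R, 0 < tau & forall t, 0 < t < tau -> dilation T x t f < c.
Proof.
rewrite -lteN2 -lower_valueN -EFinN => /lower_value_lt [tau tau0 H]; exists tau => // t /H.
by rewrite dilationN ltrN2.
Qed.

Lemma lower_value_ge T f x (L : \bar R) : (forall c : R, (c%:E < L)%E ->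
    exists2 tau : R, 0 < tau & forall t, 0 < t < tau -> c <= dilation T x t f) ->
  (L <= lower_value T f x)%E.
Proof.
move=> H; apply: limf_einf_ge => c /H [tau tau0 Ht].
by apply: (at_right0_near tau0) => t /Ht; rewrite /= lee_fin.
Qed.

Lemma upper_value_le T f x (L : \bar R) : (forall c : R, (L < c%:E)%E ->
    exists2 tau : R, 0 < tau & forall t, 0 < t < tau -> dilation T x t f <= c) ->
  (upper_value T f x <= L)%E.
Proof.
move=> H; rewrite -leeN2 -lower_valueN; apply: lower_value_ge => c.
rewrite -lteN2 oppeK -EFinN => /H [tau tau0 Ht]; exists tau => // t /Ht.
by rewrite dilationN lerNr.
Qed.

Lemma psi_test_class1 : test_class1 (@psi R).
Proof.
split; first split.
- exact: smooth_psi.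
- exact: psi_ge0.
- exact: integral_psi.
- exists (-2); first lra.
  move=> m; exists 0, 2 => x x2; rewrite mul0r (@vanish_derive1n _ 1) ?normr0 //.
    by move=> y y1; exact: psi0.
  by apply: lt_le_trans x2; lra.
- by move=> x; rewrite derive_psi; have := phi_ge0 x; nra.
Qed.

Lemma dilation_outside a b T x : supported_in `[a, b] T -> x \notin `[a, b] ->
  exists2 tau : R, 0 < tau & forall t, 0 < t < tau -> dilation T x t psi = 0.
Proof.
move=> sT; rewrite in_itv /= => xab.
have [tau tau0 Ht] : exists2 tau : R, 0 < tau & forall y, a <= y <= b -> tau <= `|y - x|.
  move: xab; rewrite negb_and -!ltNge => /orP[xa|bx].
    exists (a - x); first by lra.
    by move=> y /andP[ay yb]; rewrite ger0_norm; lra.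
  exists (x - b); first by lra.
  by move=> y /andP[ay yb]; rewrite ler0_norm; lra.
exists tau => // t /andP[t0 tt]; rewrite dilationE // sT ?mulr0 //.
  exact: (test_affine x t0 (@tpsi R)).
have cl : closed [set y : R | x - t <= y <= x + t].
  rewrite (_ : [set y : R | _] = `[x - t, x + t]%classic); first exact: interval_closed.
  by apply/seteqP; split=> y /=; rewrite in_itv.
rewrite -subset0 => y [Hy]; rewrite /= in_itv /= => /Ht yt.
have : [set y : R | x - t <= y <= x + t] y.
  rewrite (iffLR (closure_id _) cl); apply: closureS Hy => z /=.
  apply: contra_neqP => /negP nz; rewrite psi0 //.
  rewrite normrM normfV (gtr0_norm t0) ltr_pdivlMr // mul1r.
  by rewrite ltNge ler_norml; apply: contra nz => /andP[h1 h2]; apply/andP; split; lra.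
move=> /= /andP[h1 h2]; have : `|y - x| <= t by rewrite ler_norml; apply/andP; split; lra.
lra.
Qed.

End Values.

Section Difference.
Context {R : realType}.
Implicit Types (f : R -> R) (T S : (R -> R) -> R).

Lemma dilationB T S x t f :
  dilation (fun g => T g - S g) x t f = dilation T x t f - dilation S x t f.
Proof. by rewrite /dilation mulrBr. Qed.

Lemma distribution_sub T S : Defs.distribution T -> Defs.distribution S ->
  Defs.distribution (fun g => T g - S g).
Proof.
move=> [lT bT] [lS bS]; split.
  by move=> c f g tf tg; rewrite lT // lS //; ring.
move=> K cK; have [C [m HC]] := bT K cK; have [D [n HD]] := bS K cK.
exists (C + D), (maxn m n) => f tf fK B HB.
rewrite mulrDl (le_trans (ler_normB _ _)) // lerD //.
- by apply: HC => // k x km; apply: HB; rewrite (leq_trans km) // leq_maxl.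
- by apply: HD => // k x km; apply: HB; rewrite (leq_trans km) // leq_maxr.
Qed.

Lemma point_value_sub T S x c d : point_value T x c -> point_value S x d ->
  point_value (fun g => T g - S g) x (c - d).
Proof.
move=> hT hS f tf; rewrite mulrBl.
by under eq_fun do rewrite dilationB; apply: cvgB; [exact: hT | exact: hS].
Qed.

Lemma point_value_psi T x c (s : nat -> R) : point_value T x c -> (forall n, 0 < s n) ->
  s n @[n --> \oo] --> (0 : R) -> dilation T x (s n) psi @[n --> \oo] --> c.
Proof.
move=> hT s0 cs; have := hT _ (@tpsi R).
rewrite /Rintegral integral_psi mulr1 => /cvgrPdist_lt H; apply/cvgrPdist_lt => e e0.
have /nbhs_ballP [d /= d0 Hd] := H _ e0.
move/cvgrPdist_lt : cs => /(_ _ d0); apply: filterS => n; rewrite sub0r normrN => sd.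
apply: Hd; last by rewrite gt_eqF.
by rewrite /ball /= sub0r normrN.
Qed.

End Difference.

Lemma countable_union (T : Type) (A B : set T) : countable A -> countable B -> countable (A `|` B).
Proof.
move=> cA cB; rewrite -bigcup2E; apply: bigcup_countable => // -[|[|n]] _ //.
Qed.

(** * The Fatou estimate for a pair *)

Section Comparison.
Context {R : realType}.
Local Notation mu := (@lebesgue_measure R).
Variables (a b : R) (u U v V : (R -> R) -> R) (E Z : set R) (c d : R).
Hypothesis ab : a < b.
Hypotheses (su : supported_distribution a b u) (sv : supported_distribution a b v).
Hypotheses (lU : lojasiewicz U) (lV : lojasiewicz V).
Hypotheses (Uu : derivative_of U u) (Vv : derivative_of V v).
Hypotheses (Ua : point_value U a 0) (Va : point_value V a 0).
Hypotheses (Ub : point_value U b c) (Vb : point_value V b d).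
Hypotheses (cE : countable E) (nZ : mu.-negligible Z).
Hypothesis uvZ : forall x, x \in `[a, b] -> ~ Z x ->
  (upper_value v psi x <= lower_value u psi x)%E.
Hypothesis uE : forall x, x \in `[a, b] -> ~ E x -> (-oo < lower_value u psi x)%E.
Hypothesis vE : forall x, x \in `[a, b] -> ~ E x -> (upper_value v psi x < +oo)%E.

Let w f := u f - v f.
Let W f := U f - V f.

Let Hw : Defs.distribution w.
Proof. by case: su sv => [? _ _] [? _ _]; exact: distribution_sub. Qed.

Let HW : Defs.distribution W.
Proof. by case: lU lV => [? _] [? _]; exact: distribution_sub. Qed.

Let wW : derivative_of W w.
Proof. by move=> f tf; rewrite /w /W Uu // Vv //; ring. Qed.

Let pvW x : exists c, point_value W x c.
Proof.
case: lU lV => [_ /(_ x) [p hp]] [_ /(_ x) [q hq]].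
by exists (p - q); exact: point_value_sub.
Qed.

(** The values of [u] and [v] at a point may be infinite, so they are not subtracted; a real number
    lying between them up to [e] takes the place of the difference. *)
Lemma separating_real (p q : \bar R) (e : R) : (p <= q)%E -> (p < +oo)%E -> (-oo < q)%E -> 0 < e ->
  exists r : R, ((r - e)%:E < q)%E /\ (p < (r + e)%:E)%E.
Proof.
case: p q => [p| |] [q| |] //= pq _ _ e0.
- by exists p; rewrite !lte_fin; rewrite lee_fin in pq; split; lra.
- by exists p; rewrite ltry lte_fin; split => //; lra.
- by exists q; rewrite ltNyr lte_fin; split => //; lra.
- by exists 0; rewrite ltNyr ltry.
Qed.

(** On [[a, b]] the values of [u] and [v] supply the lower bounds that [positivity] asks for;
    outside, both distributions have zero dilations at small scales. *)
Lemma difference_good x : good w x.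
Proof.
apply: (@positivity R w W Hw HW wW pvW E Z cE nZ) => {}x Ex.
  move=> Zx e e0; have [xab|xab] := boolP (x \in `[a, b]).
    have e20 : 0 < e / 2 by rewrite divr_gt0.
    have [r [/lower_value_lt [t1 t10 H1] /upper_value_gt [t2 t20 H2]]] :=
      separating_real (uvZ xab Zx) (vE xab Ex) (uE xab Ex) e20.
    exists (Num.min t1 t2); first by rewrite lt_min t10.
    move=> t /andP[t0]; rewrite lt_min => /andP[tt1 tt2].
    have h1 := H1 t; rewrite t0 tt1 in h1; have h2 := H2 t; rewrite t0 tt2 in h2.
    rewrite dilationB; move: (h1 isT) (h2 isT).
    by move: (dilation _ _ _ _) (dilation _ _ _ _) => p q; lra.
  have [t1 t10 H1] := dilation_outside (let: And3 _ s _ := su in s) xab.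
  have [t2 t20 H2] := dilation_outside (let: And3 _ s _ := sv in s) xab.
  exists (Num.min t1 t2); first by rewrite lt_min t10.
  move=> t /andP[t0]; rewrite lt_min => /andP[tt1 tt2].
  by rewrite dilationB H1 ?t0 // H2 ?t0 // subrr oppr_le0 ltW.
have [xab|xab] := boolP (x \in `[a, b]).
  have [p hp] : exists p : R, (p%:E < lower_value u psi x)%E.
    have := uE xab Ex; case: (lower_value _ _ _) => [r| |] // _; last by exists 0; rewrite ltry.
    by exists (r - 1); rewrite lte_fin; lra.
  have [q hq] : exists q : R, (upper_value v psi x < q%:E)%E.
    have := vE xab Ex; case: (upper_value _ _ _) => [r| |] // _; last by exists 0; rewrite ltNyr.
    by exists (r + 1); rewrite lte_fin; lra.
  have [t1 t10 H1] := lower_value_lt hp; have [t2 t20 H2] := upper_value_gt hq.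
  exists (q - p), (Num.min t1 t2); rewrite lt_min t10 t20; split => // t /andP[t0].
  rewrite lt_min => /andP[tt1 tt2].
  have h1 := H1 t; rewrite t0 tt1 in h1; have h2 := H2 t; rewrite t0 tt2 in h2.
  rewrite dilationB; move: (h1 isT) (h2 isT).
  by move: (dilation _ _ _ _) (dilation _ _ _ _) => p' q'; lra.
have [t1 t10 H1] := dilation_outside (let: And3 _ s _ := su in s) xab.
have [t2 t20 H2] := dilation_outside (let: And3 _ s _ := sv in s) xab.
exists 0, (Num.min t1 t2); rewrite lt_min t10 t20; split => // t /andP[t0].
rewrite lt_min => /andP[tt1 tt2].
by rewrite dilationB H1 ?t0 // H2 ?t0 // subrr oppr0.
Qed.

(* [A], [B] and [M] are limits inferior and superior along scales [s n] tending to 0 of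
   the dilations of [u], [v] and [u - v]; Fatou's lemma applies to the latter, which
   are nonnegative and have integral [<W(b + s y), psi(y)> - <W(a + s y), psi(y)>]. *)
Lemma pair_comparison : exists A B M : R -> \bar R,
  [/\ measurable_fun `[a, b] A, measurable_fun `[a, b] M,
      forall x, x \in `[a, b] ->
        [/\ (0 <= M x)%E, (lower_value u psi x <= A x)%E & (B x <= upper_value v psi x)%E],
      forall x (p q : R), (p%:E < A x)%E -> (B x < q%:E)%E -> ((p - q)%:E <= M x)%E &
      (\int[mu]_(x in `[a, b]) M x <= (c - d)%:E)%E].
Proof.
have [e e0 He] := good_segment (fun x (_ : a <= x <= b) => difference_good x).
pose s n : R := e / 2 * n.+1%:R^-1.
have s0 n : 0 < s n by rewrite /s mulr_gt0 ?invr_gt0 ?divr_gt0.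
have se n : s n < e.
  rewrite /s ltr_pdivrMr //; have : 1 <= n.+1%:R :> R by rewrite ler1n.
  by nra.
have cs : s n @[n --> \oo] --> (0 : R).
  rewrite -(mulr0 (e / 2)); apply: cvgM; first exact: cvg_cst.
  exact: cvg_harmonic.
have sr (P : R -> Prop) (tau : R) : 0 < tau -> (forall t, 0 < t < tau -> P t) ->
    \forall n \near \oo, P (s n).
  move=> tau0 HP; move/cvgrPdist_lt : cs => /(_ _ tau0); apply: filterS => n; rewrite sub0r normrN gtr0_norm // => st.
  by apply: HP; rewrite s0.
pose F n x := dilation w x (s n) psi.
have cF T n : Defs.distribution T -> continuous (fun x => dilation T x (s n) psi).
  by move=> HT; exact: (dilation_cont HT (@tpsi R) (s0 n)).
have mF T n : Defs.distribution T -> measurable_fun `[a, b] (fun x => (dilation T x (s n) psi)%:E).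
  move=> HT; apply/measurable_EFinP; apply: (@measurable_funS _ _ _ _ setT) => //.
  exact: continuous_measurable_fun (cF T n HT).
have mlim (G : nat -> R -> \bar R) : (forall n, measurable_fun `[a, b] (G n)) ->
    measurable_fun `[a, b] (fun x => limn_einf (G ^~ x)).
  move=> mG; rewrite /limn_einf; apply: measurableT_comp => //.
  by apply: measurable_fun_limn_esup => n; apply: measurableT_comp.
have [Hu _ _] := su; have [Hv _ _] := sv.
exists (fun x => limn_einf (fun n => (dilation u x (s n) psi)%:E)).
exists (fun x => limn_esup (fun n => (dilation v x (s n) psi)%:E)).
exists (fun x => limn_einf (fun n => (F n x)%:E)); split.
- by apply: mlim => n; exact: mF.
- by apply: mlim => n; exact: mF.
- move=> x xab; split.
  + apply: limn_einf_ge => k k0; apply: nearW => n; rewrite (le_trans (ltW k0)) // lee_fin.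
    by apply: He; rewrite ?s0 ?se //; rewrite in_itv in xab.
  + apply: limn_einf_ge => k /lower_value_lt [tau tau0 H]; apply: (sr (fun t => (k%:E <= (dilation u x t psi)%:E)%E) _ tau0) => t /H.
    by rewrite lee_fin => /ltW.
  + rewrite -leeN2 -limn_einfN -lower_valueN.
    apply: limn_einf_ge => k /lower_value_lt [tau tau0 H]; apply: (sr (fun t => (k%:E <= - (dilation v x t psi)%:E)%E) _ tau0) => t /H.
    by rewrite dilationN lee_fin => /ltW.
(* The inequality between [A - B] and [M] is phrased with real bounds [p] and [q], because [A] and
   [B] may be infinite of the same sign. *)
- move=> x p q hp; rewrite -lteN2 -limn_einfN -EFinN => hq.
  apply: limn_einf_ge => k kpq; near=> n; rewrite (le_trans (ltW kpq)) // lee_fin /F dilationB.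
  have h1 : (p%:E < (dilation u x (s n) psi)%:E)%E by near: n; exact: limn_einf_lt hp.
  have h2 : ((- q)%:E < - (dilation v x (s n) psi)%:E)%E by near: n; exact: limn_einf_lt hq.
  move: h1 h2; rewrite -EFinN !lte_fin.
  by move: (dilation _ _ _ _) (dilation _ _ _ _) => p' q'; lra.
- have F0 n x : `[a, b]%classic x -> (0 <= (F n x)%:E)%E.
    by rewrite /= in_itv /= => xab; rewrite lee_fin; apply: He; rewrite ?s0 ?se.
  have mFw n : measurable_fun `[a, b] (fun x => (F n x)%:E) by exact: mF.
  apply: le_trans.
    by apply: (@fatou _ _ _ mu _ _ (fun n x => (F n x)%:E) mFw F0).
  have -> : (fun n => \int[mu]_(x in `[a, b]) (F n x)%:E)%E =
      (fun n => (dilation W b (s n) psi - dilation W a (s n) psi)%:E).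
    apply/funext => n; have dF (x : R) : is_derive x 1 (fun x => dilation W x (s n) psi) (F n x).
      exact: (is_derive_dilation_psi HW wW x (s0 n)).
    have <- := cint_FTC (ltW ab) (cF w n Hw) (fun x _ => dF x).
    rewrite /cint /Rintegral fineK //.
    have := cint_integrable a b (cF w n Hw); exact: integrable_fin_num.
  have cvgW : (dilation W b (s n) psi - dilation W a (s n) psi)%:E @[n --> \oo] --> (c - d)%:E.
    apply: cvg_EFin; first exact: nearW.
    rewrite -[c - d]subr0 -[X in _ - X](subrr 0); apply: cvgB.
      exact: (point_value_psi (point_value_sub Ub Vb)).
    exact: (point_value_psi (point_value_sub Ua Va)).
  by rewrite (cvg_limn_einf_sup cvgW).1.
Unshelve. all: by end_near. Qed.

Lemma pair_le : d <= c.
Proof.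
have [A [B [M [_ _ H _ HM]]]] := pair_comparison.
rewrite -subr_ge0 -lee_fin (le_trans _ HM) // integral_ge0 // => x xab.
by have [] := H x xab.
Qed.

End Comparison.

(** * Distributions with a density *)

Section TailIntegral.
Context {R : realType}.
Local Notation mu := (@lebesgue_measure R).
Implicit Types (f g F : R -> R) (L M B x y z t : R).

Lemma continuous_dilate f x t : continuous f -> continuous (fun y => f ((y - x) / t)).
Proof.
move=> cf z; apply: (@continuous_comp _ _ _ (fun z => (z - x) / t) f); last exact: cf.
by apply: continuousM; [apply: continuousB => //; exact: cst_continuous|exact: cst_continuous].
Qed.

Lemma continuous_reflect f : continuous f -> continuous (fun y => f (- y)).
Proof.
move=> cf z; apply: (@continuous_comp _ _ _ -%R f); [exact: oppr_continuous | exact: cf].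
Qed.

Definition tail f y : R := \int[mu]_(z in `[y, +oo[) f z.

Lemma tailE L M f y : vanish L f -> L <= M -> y <= M -> tail f y = cint y M f.
Proof.
move=> vf LM yM; rewrite /tail /cint Rintegral_mkcond [RHS]Rintegral_mkcond.
congr Rintegral; apply/funext => z; rewrite !patchE !mem_setE !in_itv /= andbT.
case: (leP y z) => //= yz; case: (leP z M) => //= Mz.
by apply: vf; rewrite (lt_le_trans _ (ler_norm _)) // (le_lt_trans LM).
Qed.

Lemma tail_chasles L f y z : continuous f -> vanish L f -> y <= z ->
  tail f y = cint y z f + tail f z.
Proof.
move=> cf vf yz; rewrite (@tailE _ (Num.max L z) _ y vf) ?le_max ?lexx ?yz ?orbT //.
rewrite (@tailE _ (Num.max L z) _ z vf) ?le_max ?lexx ?orbT //.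
by rewrite cint_chasles // le_max lexx orbT.
Qed.

Lemma cint1 y f : cint y y f = 0.
Proof. by rewrite /cint set_itv1 Rintegral_set1. Qed.

Lemma tail_right L f y : vanish L f -> L <= y -> tail f y = 0.
Proof. by move=> vf Ly; rewrite (tailE vf Ly (lexx _)) cint1. Qed.

Lemma integral_vanish L f : vanish L f -> \int[mu]_z f z = cint (- L) L f.
Proof. by move=> vf; apply: Rintegral_cint => x /out_norm /vf. Qed.

Lemma tail_left L f y : 0 <= L -> vanish L f -> y <= - L -> tail f y = \int[mu]_z f z.
Proof.
move=> L0 vf yL; rewrite (tailE vf (lexx _)); last by lra.
symmetry; apply: Rintegral_cint => x; rewrite negb_and -!ltNge => /orP[xy|Lx]; apply: vf.
  by rewrite ltr0_norm; lra.
by rewrite gtr0_norm; lra.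
Qed.

Lemma tail_bound L B f y : 0 <= L -> continuous f -> vanish L f -> (forall z, `|f z| <= B) ->
  `|tail f y| <= B * (2 * L).
Proof.
move=> L0 cf vf fB; have B0 : 0 <= B by rewrite (le_trans _ (fB 0)).
have [Ly|yL] := leP L y; first by rewrite (tail_right vf Ly) normr0; nra.
have [ly|ly] := leP (- L) y.
  rewrite (tailE vf (lexx _) (ltW yL)) (le_trans (cint_bound (ltW yL) cf (fun z _ => fB z))) //.
  by apply: ler_wpM2l => //; lra.
rewrite (tail_left L0 vf (ltW ly)) (integral_vanish vf).
have LL : - L <= L by lra.
by rewrite (le_trans (cint_bound LL cf (fun z _ => fB z))) // (_ : L - - L = 2 * L) //; ring.
Qed.

Lemma tail_continuous L B f : continuous f -> vanish L f -> (forall z, `|f z| <= B) ->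
  continuous (tail f).
Proof.
move=> cf vf fB; apply: (@lipschitz_cont _ _ B) => y z.
wlog yz : y z / y <= z.
  by move=> H; have [/H//|/ltW/H] := leP y z; rewrite distrC [X in _ * X]distrC.
rewrite (tail_chasles cf vf yz) opprD addrCA subrr addr0 normrN (ger0_norm (_ : 0 <= z - y)) ?subr_ge0 //.
exact: (cint_bound yz cf (fun u _ => fB u)).
Qed.

Lemma tail_lin L M f g (c : R) y : continuous f -> continuous g -> vanish L f -> vanish M g ->
  tail (fun z => c * f z + g z) y = c * tail f y + tail g y.
Proof.
move=> cf cg vf vg; pose K := Num.max (Num.max L M) y.
have LK : L <= K by rewrite /K !le_max lexx.
have MK : M <= K by rewrite /K !le_max lexx orbT.
have yK : y <= K by rewrite /K !le_max lexx orbT.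
have vh : vanish K (fun z => c * f z + g z).
  by move=> z Kz; rewrite vf ?vg ?mulr0 ?addr0 //; apply: le_lt_trans Kz.
rewrite (tailE vh (lexx _) yK) (tailE vf LK yK) (tailE vg MK yK).
by rewrite cintD ?cintZ //; exact: contZ.
Qed.

Lemma tail_derive L f y : smooth f -> vanish L f -> tail f^`()%classic y = - f y.
Proof.
move=> sf vf; pose K := Num.max L y + 1.
have LK : L < K by rewrite /K ltr_pwDr // le_max lexx.
have yK : y <= K by rewrite /K ler_wpDr // le_max lexx orbT.
rewrite (tailE (vanish_derive vf) (ltW LK) yK).
rewrite (cint_FTC yK (smooth_cont (smooth_derive sf)) (fun x _ => smooth_is x sf)).
by rewrite vf ?sub0r // (lt_le_trans LK) // ler_norm.
Qed.

Lemma tail_affine L f x t y : 0 < t -> continuous f -> vanish L f ->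
  tail (fun z => f ((z - x) / t)) y = t * tail f ((y - x) / t).
Proof.
move=> t0 cf vf; pose m := Num.max L ((y - x) / t).
have Lm : L <= m by rewrite /m le_max lexx.
have ym : (y - x) / t <= m by rewrite /m le_max lexx orbT.
have tn : t != 0 by rewrite gt_eqF.
have yE : y = x + t * ((y - x) / t) by field.
have vft : vanish (`|x| + t * `|m|) (fun z => f ((z - x) / t)).
  move=> z Hz; apply: vf; apply: (le_lt_trans (le_trans Lm (ler_norm _))).
  rewrite normrM normfV (gtr0_norm t0) ltr_pdivlMr // mulrC.
  by have := lerB_dist z x; lra.
pose M := Num.max (`|x| + t * `|m|) (x + t * m).
have ME : M = x + t * ((M - x) / t) by field.
have mM : m <= (M - x) / t.
  by rewrite ler_pdivlMr // mulrC lerBrDl /M le_max lexx orbT.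
have cft := @continuous_dilate f x t cf.
have yM : y <= M.
  rewrite yE /M le_max; apply/orP; right; rewrite lerD2l; apply: ler_wpM2l => //; exact: ltW.
rewrite (tailE vft _ yM); last by rewrite /M le_max lexx.
rewrite [in LHS]ME [in X in cint X]yE cint_subst //; last exact: le_trans mM.
rewrite (tailE vf (le_trans Lm mM) (le_trans ym mM)); congr (_ * _).
by apply: eq_cint => z _; congr f; field.
Qed.

Lemma cint_reflect f a b : a <= b -> continuous f ->
  cint a b (fun z => f (- z)) = cint (- b) (- a) f.
Proof.
move=> ab cf; have [F HF] := cont_primitive (- b) (- a) cf.
have ab' : - b <= - a by rewrite lerN2.
rewrite (cint_FTC ab' cf HF).
have cfN := continuous_reflect cf.
have H z : a <= z <= b -> is_derive z 1 (fun z => - F (- z)) (f (- z)).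
  move=> /andP[az zb]; have Hz : - b <= - z <= - a by rewrite !lerN2 az zb.
  have H1 : is_derive z 1 (fun z : R => - z) (- 1) by apply: is_deriveN.
  have := is_derive_opp (is_derive_comp (HF _ Hz) H1).
  by rewrite mulrN1 opprK.
rewrite (cint_FTC ab cfN H); ring.
Qed.

Lemma tail_reflect L f y : 0 <= L -> continuous f -> vanish L f ->
  tail (fun z => f (- z)) y = \int[mu]_z f z - tail f (- y).
Proof.
move=> L0 cf vf; pose M := Num.max L `|y|.
have LM : L <= M by rewrite /M le_max lexx.
have : `|y| <= M by rewrite /M le_max lexx orbT.
rewrite ler_norml => /andP[My yM].
have vfN : vanish L (fun z => f (- z)) by move=> z Lz; apply: vf; rewrite normrN.
rewrite (tailE vfN LM yM) cint_reflect //.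
rewrite -(@tail_left L f (- M) L0 vf); last by rewrite lerN2.
have MyN : - M <= - y by rewrite lerN2.
by rewrite (tail_chasles cf vf MyN) addrK.
Qed.

(** Negative [t] occurs because point values are two-sided limits; the reflection exchanges right
    and left tails. *)
Lemma tail_affine_neg L f x t y : 0 <= L -> t < 0 -> continuous f -> vanish L f ->
  tail (fun z => f ((z - x) / t)) y = - t * (\int[mu]_z f z - tail f ((y - x) / t)).
Proof.
move=> L0 t0 cf vf; have tn : t != 0 by rewrite lt_eqF.
have vfN : vanish L (fun z => f (- z)) by move=> z Lz; apply: vf; rewrite normrN.
have cfN := continuous_reflect cf.
have Nt0 : 0 < - t by rewrite oppr_gt0.
have -> : (fun z => f ((z - x) / t)) = (fun z => (fun z => f (- z)) ((z - x) / - t)).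
  by apply/funext => z; congr f; field.
rewrite (tail_affine x y Nt0 cfN vfN) (tail_reflect _ L0 cf vf); congr (_ * (_ - tail _ _)).
by field.
Qed.

End TailIntegral.

(** * The distribution of an integrable density *)

Section Density.
Context {R : realType}.
Local Notation mu := (@lebesgue_measure R).
Variables (a b : R) (p : R -> R).
Hypothesis ab : a < b.
Hypothesis mp : measurable_fun setT p.
Hypothesis p0 : forall x, 0 <= p x.
Hypothesis ip : mu.-integrable `[a, b] (EFin \o p).

Let mD : measurable (`[a, b]%classic : set (measurableTypeR R)).
Proof. by []. Qed.

Definition density (f : R -> R) : R := \int[mu]_(x in `[a, b]) (p x * f x).

(** After an exchange of integrals this is the pairing of [f] with the primitive of [p] that
    vanishes to the left of [a]. Putting the integration on [f] reduces derivative, continuity and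
    point values to properties of [tail]. *)
Definition density_primitive (f : R -> R) : R := \int[mu]_(x in `[a, b]) (p x * tail f x).

Lemma density_integrable f : continuous f ->
  mu.-integrable `[a, b] (fun x => (p x * f x)%:E).
Proof.
move=> cf; have mf : measurable_fun `[a, b] f.
  by apply: (@measurable_funS _ _ _ _ setT) => //; exact: continuous_measurable_fun cf.
have bf : [bounded f x | x in `[a, b]%classic].
  have [B [Br HB]] := compact_bounded (continuous_compact (continuous_subspaceT cf) (@segment_compact _ a b)).
  by exists B; split=> // M BM x xab; apply: HB BM _ _; exists x.
have := integrableMl mD ip mf bf.
by apply: eq_integrable => // x _; rewrite /= EFinM.
Qed.

Lemma density_lin f g (c : R) : continuous f -> continuous g ->
  \int[mu]_(x in `[a, b]) (p x * (c * f x + g x)) = c * density f + density g.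
Proof.
move=> cf cg; rewrite /density.
rewrite -(RintegralZl _ mD (density_integrable cf)).
rewrite -RintegralD //.
- by apply: eq_Rintegral => x _; ring.
- have := integrableZl mD c (density_integrable cf).
  by apply: eq_integrable => // x _; rewrite EFinM.
- exact: density_integrable cg.
Qed.

Definition total_mass : R := \int[mu]_(x in `[a, b]) p x.

Lemma density_bound f B : continuous f -> (forall x, `|f x| <= B) -> `|density f| <= total_mass * B.
Proof.
move=> cf fB; rewrite /density (le_trans (le_normr_Rintegral _ (density_integrable cf))) //.
rewrite -(RintegralZr _ mD ip); apply: le_Rintegral => //.
- have := integrable_norm (density_integrable cf).
  by apply: eq_integrable.
- have := integrableZr mD B ip.
  by apply: eq_integrable => // x _; rewrite /= EFinM.
- by move=> x _; rewrite normrM (ger0_norm (p0 x)) ler_wpM2l.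
Qed.

Lemma test_bounded f : test_function f -> exists2 B : R, 0 <= B & forall x, `|f x| <= B.
Proof. by move=> tf; have [L _ vf] := test_vanish tf; exact: vanish_bounded (smooth_cont (test_smooth tf)) vf. Qed.

Lemma density_distribution : Defs.distribution density.
Proof.
split.
  move=> c f g tf tg; apply: density_lin; [exact: smooth_cont (test_smooth tf)|].
  exact: smooth_cont (test_smooth tg).
move=> K cK; exists total_mass, 0%N => f tf _ B HB; apply: density_bound.
  exact: smooth_cont (test_smooth tf).
by move=> x; exact: (HB 0%N x).
Qed.

Lemma density_supported : supported_distribution a b density.
Proof.
split; first exact: density_distribution.
- move=> f tf fab; rewrite /density.
  rewrite (@eq_Rintegral _ _ _ mu _ (fun=> 0)).
    by rewrite Rintegral_cst // mul0r.
  move=> x xab; rewrite (_ : f x = 0) ?mulr0 //; apply: contrapT => fx.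
  have : (tsupport f `&` `[a, b]) x.
    by split; [apply: subset_closure; apply/eqP | rewrite inE in xab].
  by rewrite fab.
- move=> f chi sf tchi H; apply: eq_Rintegral => x; rewrite inE /= => /H /nbhs_singleton ->.
  by rewrite mul1r.
Qed.

Lemma density_primitive_derivative : derivative_of density_primitive density.
Proof.
move=> f tf; have [L _ vf] := test_vanish tf; rewrite /density /density_primitive.
rewrite [in RHS](@eq_Rintegral _ _ _ mu _ (fun x => (-1) * (p x * f x))); last first.
  by move=> x _; rewrite (tail_derive _ (test_smooth tf) vf); ring.
rewrite (RintegralZl _ mD (density_integrable (smooth_cont (test_smooth tf)))).
by rewrite mulN1r opprK.
Qed.

Lemma tail_bounded f : test_function f -> continuous (tail f) /\
  exists B : R, forall x, `|tail f x| <= B.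
Proof.
move=> tf; have [L L0 vf] := test_vanish tf; have [B _ fB] := test_bounded tf.
have cf := smooth_cont (test_smooth tf).
split; first exact: tail_continuous cf vf fB.
by exists (B * (2 * L)) => x; exact: tail_bound (ltW L0) cf vf fB.
Qed.

Lemma density_primitive_distribution : Defs.distribution density_primitive.
Proof.
split.
  move=> c f g tf tg; have [ctf [B fB]] := tail_bounded tf; have [ctg [C gC]] := tail_bounded tg.
  have [L _ vf] := test_vanish tf; have [M _ vg] := test_vanish tg.
  rewrite /density_primitive -(@density_lin (tail f) (tail g)) //.
  apply: eq_Rintegral => x _; rewrite (tail_lin c x _ _ vf vg) //.
    exact: smooth_cont (test_smooth tf).
  exact: smooth_cont (test_smooth tg).
move=> K cK; have [M [Mr HM]] := compact_bounded cK.
pose L := `|M| + 1.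
have L0 : 0 <= L by rewrite /L addr_ge0.
have KL x : K x -> `|x| <= L.
  by move=> Kx; apply: (HM L _ x Kx); rewrite /L ltr_pwDr // ler_norm.
exists (total_mass * (2 * L)), 0%N => f tf fK B HB.
have fB x : `|f x| <= B by exact: (HB 0%N x).
have vf : vanish L f.
  move=> x Lx; apply: contrapT => /eqP fx; have : K x by apply: fK; exact: subset_closure.
  by move=> /KL; rewrite leNgt Lx.
have cf := smooth_cont (test_smooth tf).
have := @density_bound (tail f) (B * (2 * L)) (tail_continuous cf vf fB) (fun x => tail_bound x L0 cf vf fB).
by rewrite /density_primitive (_ : _ * B = total_mass * (B * (2 * L))) //; ring.
Qed.

Definition cumulative x : R := \int[mu]_(y in `[a, b]) (p y * \1_(`]-oo, x[%classic) y).

(* [|t|^-1] times the tail integral of [f ((. - x) / t)], for either sign of [t]. *)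
Definition dilated_tail f x t y : R :=
  if 0 < t then tail f ((y - x) / t) else \int[mu]_z f z - tail f ((y - x) / t).

Lemma dilated_tail_continuous f x t : continuous (tail f) -> continuous (dilated_tail f x t).
Proof.
move=> ctf; have cft := @continuous_dilate R (tail f) x t ctf.
rewrite /dilated_tail; case: (0 < t) => //; apply: contB => //; exact: cst_continuous.
Qed.

Lemma dilation_density_primitive f x t : test_function f -> t != 0 ->
  dilation density_primitive x t f = density (dilated_tail f x t).
Proof.
move=> tf tn; have [L L0 vf] := test_vanish tf; have cf := smooth_cont (test_smooth tf).
have [ctf [B tB]] := tail_bounded tf.
have cd := @dilated_tail_continuous f x t ctf.
have tE y : tail (fun y => f ((y - x) / t)) y = `|t| * dilated_tail f x t y.
  rewrite /dilated_tail; have [t0|t0] := ltP 0 t; first by rewrite gtr0_norm // (tail_affine _ _ t0 cf vf).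
  have {}t0 : t < 0 by rewrite lt_neqAle tn.
  by rewrite ltr0_norm // (tail_affine_neg _ _ (ltW L0) t0 cf vf).
rewrite /dilation /density_primitive.
rewrite (@eq_Rintegral _ _ _ mu _ (fun y => `|t| * (p y * dilated_tail f x t y))); last first.
  by move=> y _; rewrite tE; ring.
by rewrite (RintegralZl _ mD (density_integrable cd)) mulKf ?normr_eq0.
Qed.

Lemma dilated_tail_limit f x y L t : 0 <= L -> vanish L f -> t != 0 -> y != x -> `|t| * L <= `|y - x| ->
  dilated_tail f x t y = \int[mu]_z f z * \1_(`]-oo, x[%classic) y.
Proof.
move=> L0 vf tn yx H; rewrite /dilated_tail indicE mem_setE in_itv /=.
have [t0|t0] := ltP 0 t.
  rewrite gtr0_norm // in H; have [yx'|yx'] := ltP y x.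
    rewrite (tail_left L0 vf) ?mulr1 // ler_pdivrMr // mulNr mulrC.
    by rewrite ltr0_norm ?subr_lt0 // in H; lra.
  rewrite (tail_right vf) ?mulr0 // ler_pdivlMr // mulrC.
  by rewrite ger0_norm ?subr_ge0 // in H.
have {}t0 : t < 0 by rewrite lt_neqAle tn.
rewrite ltr0_norm // in H; have [yx'|yx'] := ltP y x.
  rewrite (tail_right vf) ?mulr1 ?subr0 // ler_ndivlMr //.
  by rewrite ltr0_norm ?subr_lt0 // in H; nra.
rewrite (tail_left L0 vf) ?mulr0 ?subrr // ler_ndivrMr //.
by rewrite ger0_norm ?subr_ge0 // in H; nra.
Qed.

(** For [y != x] the dilated tails are eventually constant, equal to the integral of [f] for [y < x]
    and to 0 for [y > x]. They are uniformly bounded and [p] is integrable, so dominated convergence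
    applies. *)
Lemma density_primitive_point_value x : point_value density_primitive x (cumulative x).
Proof.
move=> f tf; have [L L0 vf] := test_vanish tf; have cf := smooth_cont (test_smooth tf).
have [ctf [B tB]] := tail_bounded tf.
set m := \int[mu]_y f y.
have ia : measurable_fun `[a, b] (\1_(`]-oo, x[%classic) : R -> R).
  by apply: measurable_indic; exact: measurable_itv.
have mp' : measurable_fun `[a, b] p by exact: measurable_funS mp.
have ipa : mu.-integrable `[a, b] (fun y => (p y * \1_(`]-oo, x[%classic) y)%:E).
  have bi : [bounded (\1_(`]-oo, x[%classic) y : R) | y in `[a, b]%classic].
    exists 1; split; [exact: num_real|move=> M M1 y _ /=; rewrite (le_trans _ (ltW M1)) //].
    by rewrite indicE ger0_norm // lern1 leq_b1.
  have := integrableMl mD ip ia bi.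
  by apply: eq_integrable => // y _; rewrite /= EFinM.
apply/cvgr_dnbhsP => u [un u0].
pose N := `|m| + B.
have cd n := @dilated_tail_continuous f x (u n) ctf.
have dN n y : `|dilated_tail f x (u n) y| <= N.
  rewrite /dilated_tail /N; case: ifP => _; first by rewrite (le_trans (tB _)) // lerDr.
  by rewrite (le_trans (ler_normB _ _)) // lerD2l.
have -> : (fun n => dilation density_primitive x (u n) f) = (fun n => density (dilated_tail f x (u n))).
  by apply/funext => n; rewrite dilation_density_primitive.
rewrite mulrC -(RintegralZl _ mD ipa).
pose F n y := (p y * dilated_tail f x (u n) y)%:E.
pose G y := (m * (p y * \1_(`]-oo, x[%classic) y))%:E.
have mF n : measurable_fun `[a, b] (F n) by have /integrableP[] := density_integrable (cd n).
have mG : measurable_fun `[a, b] G.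
  by apply/measurable_EFinP; apply: measurable_funM => //; apply: measurable_funM.
have cFG : {ae mu, forall y, `[a, b]%classic y -> F n y @[n --> \oo] --> G y}.
  exists [set x]; split; [exact: measurable_set1|exact: lebesgue_measure_set1|].
  move=> y /= Hy; apply: contrapT => /eqP yx; apply: Hy => _.
  apply: cvg_near_cst; near=> n; rewrite /F /G; congr EFin.
  rewrite (@dilated_tail_limit _ _ _ L _ (ltW L0) vf (un n) yx); first by rewrite -/m; ring.
  rewrite -ler_pdivlMr //; apply: ltW; near: n.
  have d0 : 0 < `|y - x| / L by rewrite divr_gt0 // normr_gt0 subr_eq0.
  move/cvgrPdist_lt : u0 => /(_ _ d0); apply: filterS => n.
  by rewrite sub0r normrN.
have iN : mu.-integrable `[a, b] (fun y => (N * p y)%:E).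
  by have := integrableZl mD N ip; apply: eq_integrable => // y _; rewrite /= EFinM.
have FN : {ae mu, forall y n, `[a, b]%classic y -> (`|F n y| <= (N * p y)%:E)%E}.
  apply: aeW => y n _; rewrite /F lee_fin normrM (ger0_norm (p0 y)) mulrC.
  by apply: ler_wpM2r.
have [iG _ H2] := @dominated_convergence _ _ _ mu _ mD F G _ mF mG cFG iN FN.
apply: fine_cvg; rewrite fineK; first exact: H2.
exact: integrable_fin_num.
Unshelve. all: by end_near. Qed.

Lemma density_primitive_lojasiewicz : lojasiewicz density_primitive.
Proof.
split; first exact: density_primitive_distribution.
by move=> x; exists (cumulative x); exact: density_primitive_point_value.
Qed.

Lemma cumulative_left : cumulative a = 0.
Proof.
rewrite /cumulative (@eq_Rintegral _ _ _ mu _ (fun=> 0)); first by rewrite Rintegral_cst // mul0r.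
by move=> y; rewrite inE /= in_itv /= indicE mem_setE in_itv /= => /andP[ay _]; rewrite ltNge ay mulr0.
Qed.

Lemma cumulative_right : cumulative b = total_mass.
Proof.
rewrite /cumulative /total_mass /Rintegral; congr fine; apply: ae_eq_integral => //.
- apply/measurable_EFinP; apply: measurable_funM; first exact: measurable_funS mp.
  by apply: measurable_indic; exact: measurable_itv.
- by apply/measurable_EFinP; exact: measurable_funS mp.
- exists [set b]; split; [exact: measurable_set1|exact: lebesgue_measure_set1|].
  move=> y /= Hy; apply: contrapT => /eqP yb; apply: Hy; rewrite /= in_itv /= => /andP[_ yb'].
  by rewrite indicE mem_setE in_itv /= lt_neqAle yb yb' mulr1.
Qed.

End Density.

Lemma perturbed_product_le (R : realType) (r s f B d : R) : 0 <= d -> 0 <= f -> f <= B -> r - s <= d ->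
  r * f - B * d <= s * f.
Proof. by move=> d0 f0 fB rs; nra. Qed.

(** * Values of a density at Lebesgue points *)

Section DensityValues.
Context {R : realType}.
Local Notation mu := (@lebesgue_measure R).

Lemma test_class_cint (f : R -> R) c d : test_class0 f -> cint c d f <= 1.
Proof.
move=> [sf f0 If _]; have cf := smooth_cont sf.
have ci := cint_integrable c d cf.
rewrite -lee_fin /cint /Rintegral fineK; last exact: integrable_fin_num.
rewrite -If; apply: ge0_subset_integral => //.
- by apply/measurable_EFinP; exact: continuous_measurable_fun cf.
- by move=> x _; rewrite lee_fin.
Qed.

(** Functions of the test classes need not have compact support; a large window retains almost all
    of the mass. *)
Lemma test_class_mass (f : R -> R) e : test_class0 f -> 0 < e ->
  exists2 K : R, 0 < K & 1 - e <= cint (- K) K f.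
Proof.
move=> [sf f0 If _] e0; have cf := smooth_cont sf.
pose F (n : nat) : set (measurableTypeR R) := `[- n%:R, n%:R]%classic.
have nF : nondecreasing_seq F.
  move=> m n mn; rewrite subsetEset => x; rewrite /F /= !in_itv /= => /andP[h1 h2].
  have : m%:R <= n%:R :> R by rewrite ler_nat.
  by move=> h; apply/andP; split; lra.
have mF n : measurable (F n) by exact: (@measurable_itv R `[- n%:R, n%:R]).
have mf n : measurable_fun (F n) (EFin \o f).
  apply: (@measurable_funS _ _ _ _ setT) => //.
  by apply/measurable_EFinP; exact: continuous_measurable_fun cf.
have Ff0 n x : F n x -> (0 <= (EFin \o f) x)%E by move=> _; rewrite lee_fin.
have := @ge0_nondecreasing_set_cvg_integral _ _ _ F (EFin \o f) mu nF mF mf Ff0.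
have -> : \bigcup_i F i = setT.
  apply/seteqP; split => // x _; exists (Num.truncn `|x|).+1 => //.
  rewrite /F /= in_itv /= -ler_norml ltW //.
  by have /andP[] := truncn_itv (normr_ge0 x).
have -> : (\int[mu]_x (EFin \o f) x = 1)%E by exact: If.
have FE : (fun i => (\int[mu]_(x in F i) (EFin \o f) x)%E) = (fun i : nat => (cint (- i%:R) i%:R f)%:E).
  apply/funext => n; have ci := cint_integrable (- n%:R) n%:R cf.
  by rewrite /cint /Rintegral fineK //; exact: integrable_fin_num.
rewrite FE => /fine_cvgP [_] /cvgrPdist_lt /(_ _ e0) [n _ Hn].
exists n.+1%:R; first by rewrite ltr0n.
have := Hn n.+1 (leqnSn n); rewrite /= => /(le_lt_trans (ler_norm _)).
by lra.
Qed.

Lemma lebesgue_pt_small (q : R -> R) (x e : R) : lebesgue_pt q x -> measurable_fun setT q -> 0 < e ->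
  exists2 d : R, 0 < d & forall r, 0 < r < d ->
    (\int[mu]_(y in `[(x - r)%R, (x + r)%R]) (`|q y - q x|%R)%:E <= (r * e)%:E)%E.
Proof.
move=> H mq e0.
(* The open ball of radius [2 * r], of measure [4 * r], contains the closed interval of radius [r];
   hence the factor 1/4. *)
have e40 : (0 < (e / 4)%:E :> \bar R)%E by rewrite lte_fin divr_gt0.
have /near_at_right0 [d d0 Hd] := H _ (open_ereal_lt' e40).
exists (d / 2); first by rewrite divr_gt0.
move=> r /andP[r0 rd]; have r20 : 0 < 2 * r by rewrite mulr_gt0.
have := Hd (2 * r); rewrite r20 /= => /(_ _)/wrap[]; first by lra.
have muE : mu (ball x (2 * r)) = ((2 * r) *+ 2)%:E by apply: lebesgue_measure_ball; exact: ltW.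
have r40 : 0 < (2 * r) *+ 2 by rewrite mulrn_wgt0.
rewrite /davg /iavg muE inver gt_eqF // lte_pdivrMl // -EFinM => Hr.
apply: le_trans (_ : ((2 * r) *+ 2 * (e / 4))%:E <= _)%E; last by rewrite lee_fin mulr2n; lra.
apply: le_trans (ltW Hr); apply: ge0_subset_integral.
- exact: measurable_itv.
- exact: measurable_ball.
- apply/measurable_EFinP; apply: measurableT_comp => //; apply: measurable_funB => //.
  exact: measurable_funS mq.
- by move=> y _; rewrite lee_fin.
- move=> y; rewrite /ball /= in_itv /= => /andP[h1 h2].
  by rewrite ltr_norml; apply/andP; split; lra.
Qed.

Section Lower.
Variables (a b : R) (p : R -> R).
Hypothesis ab : a < b.
Hypothesis mp : measurable_fun setT p.
Hypothesis p0 : forall x, 0 <= p x.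
Hypothesis ip : mu.-integrable `[a, b] (EFin \o p).

Let mD : measurable (`[a, b]%classic : set (measurableTypeR R)).
Proof. by []. Qed.

Lemma density_dilation_ge0 (x t : R) f : 0 < t -> (forall x, 0 <= f x) -> 0 <= dilation (density a b p) x t f.
Proof.
move=> t0 f0; rewrite dilationE // mulr_ge0 //; first by rewrite invr_ge0 ltW.
rewrite /density; apply: Rintegral_ge0 => y _; exact: mulr_ge0.
Qed.

Lemma density_dilation_le (N x t : R) f : 0 < t -> test_class0 f -> 0 <= N -> (forall x, p x <= N) ->
  dilation (density a b p) x t f <= N.
Proof.
move=> t0 tf N0 pN; have [sf f0 _ _] := tf; have cf := smooth_cont sf.
have cft := @continuous_dilate R f x t cf.
rewrite dilationE // /density.
have H : \int[mu]_(y in `[a, b]) (p y * f ((y - x) / t)) <= N * cint a b (fun y => f ((y - x) / t)).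
  rewrite -cintZ //; apply: le_Rintegral => //.
  - exact: (density_integrable ip cft).
  - exact: (@cint_integrable R _ a b (@contZ _ N _ cft)).
  - by move=> y _; rewrite ler_wpM2r.
have tn : t != 0 by rewrite gt_eqF.
have E c : c = x + t * ((c - x) / t) by field.
have le1 : (a - x) / t <= (b - x) / t by rewrite ler_pM2r ?invr_gt0 // lerD2r ltW.
have H2 : cint a b (fun y => f ((y - x) / t)) = t * cint ((a - x) / t) ((b - x) / t) f.
  rewrite [in LHS](E a) [in LHS](E b) cint_subst //; congr (_ * _); apply: eq_cint => y _.
  by congr f; field.
rewrite H2 in H.
have H3 := test_class_cint ((a - x) / t) ((b - x) / t) tf.
rewrite mulrC ler_pdivrMr // (le_trans H) //.
by rewrite mulrCA mulrC; apply: ler_wpM2r; [exact: ltW | rewrite -[leRHS]mulr1; apply: ler_wpM2l].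
Qed.

Lemma density_lower x f : a < x < b -> lebesgue_pt (p \_ `[a, b]%classic) x -> test_class0 f ->
  ((p x)%:E <= lower_value (density a b p) f x)%E.
Proof.
move=> /andP[ax xb] Hx tf; have [sf f0 _ _] := tf; have cf := smooth_cont sf.
apply: lower_value_ge => c; rewrite lte_fin => cp.
(* The solution of [p x * (1 - e) - e = c]: a fraction [e] of the mass is lost, and replacing [p] by
   [p x] costs another [e]. *)
pose e := (p x - c) / (p x + 1).
have px1 : 0 < p x + 1 by rewrite ltr_wpDl.
have e0 : 0 < e by rewrite /e divr_gt0 // subr_gt0.
have eE : p x * (1 - e) - e = c by rewrite /e; field; rewrite gt_eqF.
have [K K0 HK] := test_class_mass tf e0.
have [B B0 HB] : exists2 B : R, 0 < B & forall y, - K <= y <= K -> `|f y| <= B.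
  have [B [Br HB]] := compact_bounded (continuous_compact (continuous_subspaceT cf) (@segment_compact _ (- K) K)).
  exists (`|B| + 1); first by rewrite ltr_wpDl.
  move=> y yK; apply: (HB (`|B| + 1)); last by exists y => //; rewrite /= in_itv.
  by rewrite (le_lt_trans (ler_norm _)) // ltrDl.
set q := p \_ `[a, b]%classic in Hx.
have [mq _ _] := integrable_locally_restrict mD ip.
have BK0 : 0 < B * K by rewrite mulr_gt0.
have [d d0 Hd] := lebesgue_pt_small Hx mq (divr_gt0 e0 BK0).
exists (Num.min (d / K) (Num.min ((x - a) / K) ((b - x) / K))).
  by rewrite !lt_min !divr_gt0 // subr_gt0.
move=> t /andP[t0]; rewrite !lt_min !ltr_pdivlMr // => /and3P[td ta tb].
have cft := @continuous_dilate R f x t cf.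
have sub : `[x - t * K, x + t * K]%classic `<=` `[a, b]%classic.
  by move=> y; rewrite /= !in_itv /= => /andP[h1 h2]; apply/andP; split; lra.
have tK0 : 0 < t * K by rewrite mulr_gt0.
have mI : measurable (`[x - t * K, x + t * K]%classic : set (measurableTypeR R)) by exact: measurable_itv.
have ipI : mu.-integrable `[x - t * K, x + t * K] (EFin \o p) by exact: integrableS ip.
have iI : mu.-integrable `[x - t * K, x + t * K] (EFin \o (fun y => p y * f ((y - x) / t))).
  exact: integrableS (density_integrable ip cft).
have tn : t != 0 by rewrite gt_eqF.
have icst : mu.-integrable `[x - t * K, x + t * K] (EFin \o (fun=> p x)).
  exact: (cint_integrable _ _ (@cst_continuous _ _ (p x))).
have idiff : mu.-integrable `[x - t * K, x + t * K] (EFin \o (fun y => `|p y - p x|)).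
  have := integrable_norm (integrableB mI ipI icst).
  by apply: eq_integrable.
have Hdiff : \int[mu]_(y in `[x - t * K, x + t * K]) `|p y - p x| <= t * K * (e / (B * K)).
  have := Hd (t * K); rewrite tK0 td => /(_ isT) H.
  rewrite -lee_fin /Rintegral fineK; last exact: integrable_fin_num.
  apply: le_trans H; rewrite le_eqVlt; apply/orP; left; apply/eqP; apply: eq_integral => y yI.
  have -> : q y = p y by rewrite /q patchE ifT // inE; apply: sub; rewrite inE in yI.
  by rewrite /q patchE ifT // inE /= in_itv /= !ltW.
have H1 : \int[mu]_(y in `[x - t * K, x + t * K]) (p y * f ((y - x) / t)) <= density a b p (fun y => f ((y - x) / t)).
  rewrite -lee_fin /density /Rintegral fineK; last exact: integrable_fin_num.
  rewrite fineK; last exact: (integrable_fin_num mD (density_integrable ip cft)).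
  apply: ge0_subset_integral => //.
    by have /integrableP[] := density_integrable ip cft.
  by move=> y _; rewrite lee_fin mulr_ge0.
have H2 : p x * (t * cint (- K) K f) - B * (t * K * (e / (B * K))) <=
    \int[mu]_(y in `[x - t * K, x + t * K]) (p y * f ((y - x) / t)).
  have -> : t * cint (- K) K f = cint (x - t * K) (x + t * K) (fun y => f ((y - x) / t)).
    rewrite -mulrN cint_subst //; last by lra.
    by congr (_ * _); apply: eq_cint => y _; congr f; field.
  apply: le_trans (_ : _ <= p x * cint (x - t * K) (x + t * K) (fun y => f ((y - x) / t)) -
    B * \int[mu]_(y in `[x - t * K, x + t * K]) `|p y - p x|) _.
    by rewrite lerD2l lerN2 ler_wpM2l // ltW.
  rewrite -cintZ // /cint -(RintegralZl _ mI idiff) -RintegralB //.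
  - apply: le_Rintegral => //.
    + have := integrableB mI (cint_integrable (x - t * K) (x + t * K) (@contZ _ (p x) _ cft)) (integrableZl mI B idiff).
      by apply: eq_integrable.
    + move=> y; rewrite /= in_itv /= => /andP[h1 h2].
      have yK : - K <= (y - x) / t <= K.
        by rewrite ler_pdivlMr // ler_pdivrMr //; apply/andP; split; lra.
      have fB := HB _ yK.
      rewrite (ger0_norm (f0 _)) in fB.
      have n1 := ler_norm (p x - p y); rewrite distrC in n1.
      by apply: perturbed_product_le.
  - exact: (cint_integrable _ _ (@contZ _ (p x) _ cft)).
  - have := integrableZl mI B idiff.
    by apply: eq_integrable.
have {}H1 := le_trans H2 H1.
rewrite dilationE // -eE -[leLHS](mulKf tn); apply: ler_wpM2l; first by rewrite invr_ge0 ltW.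
apply: le_trans H1.
have -> : B * (t * K * (e / (B * K))) = t * e by field; rewrite !gt_eqF.
rewrite mulrBr lerD2r mulrCA; apply: ler_wpM2l => //; apply: ler_wpM2l => //; exact: ltW.
Qed.

End Lower.

Lemma bounded_integrable a b (q : R -> R) (N : R) : measurable_fun setT q ->
  (forall x, 0 <= q x <= N) -> mu.-integrable `[a, b] (EFin \o q).
Proof.
move=> mq q0; have N0 : 0 <= N by have /andP[] := q0 0; exact: le_trans.
have mD : measurable (`[a, b]%classic : set (measurableTypeR R)) by [].
apply: (le_integrable mD _ _ (cint_integrable a b (@cst_continuous _ _ N))).
  by apply/measurable_EFinP; exact: measurable_funS mq.
by move=> y _; rewrite /= lee_fin; have /andP[h1 h2] := q0 y; rewrite !ger0_norm.
Qed.

(** For bounded [q] this is the lower estimate for [N - q], because dilations of the constant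
    density [N] are at most [N]. *)
Lemma density_upper a b (q : R -> R) (N x : R) f : a < b -> measurable_fun setT q ->
  (forall x, 0 <= q x <= N) -> a < x < b ->
  lebesgue_pt ((fun y => N - q y) \_ `[a, b]%classic) x -> test_class0 f ->
  (upper_value (density a b q) f x <= (q x)%:E)%E.
Proof.
move=> ab mq q0 axb Hx tf; have [sf f0 _ _] := tf; have cf := smooth_cont sf.
have mD : measurable (`[a, b]%classic : set (measurableTypeR R)) by [].
have icst : mu.-integrable `[a, b] (EFin \o (fun=> N)).
  exact: (cint_integrable a b (@cst_continuous _ _ N)).
have N0 : 0 <= N by have /andP[] := q0 x; exact: le_trans.
have iq := bounded_integrable a b mq q0.
pose r y := N - q y.
have mr : measurable_fun setT r by apply: measurable_funB.
have r0 y : 0 <= r y by rewrite subr_ge0; case/andP: (q0 y).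
have ir : mu.-integrable `[a, b] (EFin \o r).
  by have := integrableB mD icst iq; apply: eq_integrable.
have H := density_lower r0 ir axb Hx tf.
apply: upper_value_le => c; rewrite lte_fin => qc.
have /lower_value_lt [tau tau0 Ht] : ((N - c)%:E < lower_value (density a b r) f x)%E.
  by apply: lt_le_trans H; rewrite lte_fin /r; lra.
exists tau => // t tt; have t0 : 0 < t by case/andP: tt.
have cft := @continuous_dilate R f x t cf.
have E : dilation (density a b q) x t f + dilation (density a b r) x t f =
    dilation (density a b (fun=> N)) x t f.
  rewrite !dilationE // -mulrDr; congr (_ * _); rewrite /density -RintegralD //.
  - by apply: eq_Rintegral => y _; rewrite /r; ring.
  - exact: (density_integrable iq cft).
  - exact: (density_integrable ir cft).
have := @density_dilation_le a b (fun=> N) ab icst N x t f t0 tf N0 (fun=> lexx N).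
by rewrite -E; have := Ht t tt; lra.
Qed.

Lemma ae_lebesgue_pt a b (p : R -> R) : mu.-integrable `[a, b] (EFin \o p) ->
  exists2 Z : set R, mu.-negligible Z & forall x, ~ Z x -> lebesgue_pt (p \_ `[a, b]%classic) x.
Proof.
move=> ip; have mD : measurable (`[a, b]%classic : set (measurableTypeR R)) by [].
have H := lebesgue_differentiation (integrable_locally_restrict mD ip).
exists (~` [set x | lebesgue_pt (p \_ `[a, b]%classic) x]); first exact: H.
by move=> x /= /contrapT.
Qed.

End DensityValues.

(** * The distributional integral *)

Section Sums.
Context {R : realType}.
Implicit Types (f : R -> R) (T S : (R -> R) -> R) (a b x c d r : R).

Lemma dilation_add T S x t f :
  dilation (fun g => T g + S g) x t f = dilation T x t f + dilation S x t f.
Proof. by rewrite /dilation mulrDr. Qed.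

Lemma distribution_add T S : Defs.distribution T -> Defs.distribution S ->
  Defs.distribution (fun g => T g + S g).
Proof.
move=> [lT bT] [lS bS]; split.
  by move=> c f g tf tg; rewrite lT // lS //; ring.
move=> K cK; have [C [m HC]] := bT K cK; have [D [n HD]] := bS K cK.
exists (C + D), (maxn m n) => f tf fK B HB.
rewrite mulrDl (le_trans (ler_normD _ _)) // lerD //.
- by apply: HC => // k x km; apply: HB; rewrite (leq_trans km) // leq_maxl.
- by apply: HD => // k x km; apply: HB; rewrite (leq_trans km) // leq_maxr.
Qed.

Lemma supported_add a b T S : supported_distribution a b T -> supported_distribution a b S ->
  supported_distribution a b (fun g => T g + S g).
Proof.
move=> [dT sT eT] [dS sS eS]; split; first exact: distribution_add.
- by move=> f tf fab; rewrite sT // sS // addr0.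
- move=> f chi sf tchi H; rewrite (eT f chi sf tchi H) (eS f chi sf tchi H). by [].
Qed.

Lemma point_value_add T S x c d : point_value T x c -> point_value S x d ->
  point_value (fun g => T g + S g) x (c + d).
Proof.
move=> hT hS f tf; rewrite mulrDl.
by under eq_fun do rewrite dilation_add; apply: cvgD; [exact: hT | exact: hS].
Qed.

Lemma lojasiewicz_add T S : lojasiewicz T -> lojasiewicz S -> lojasiewicz (fun g => T g + S g).
Proof.
move=> [dT pT] [dS pS]; split; first exact: distribution_add.
move=> x; have [c hc] := pT x; have [d hd] := pS x.
by exists (c + d); exact: point_value_add.
Qed.

Lemma derivative_add T S U V : derivative_of U T -> derivative_of V S ->
  derivative_of (fun g => U g + V g) (fun g => T g + S g).
Proof. by move=> hT hS f tf; rewrite hT // hS // opprD. Qed.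

Lemma lower_value_add T S x f (l : \bar R) r : (l <= lower_value T f x)%E ->
  (r%:E <= lower_value S f x)%E -> (l + r%:E <= lower_value (fun g => (T g + S g)%R) f x)%E.
Proof.
move=> hl hr; apply: lower_value_ge => c clr.
have [s cs sl] : exists2 s : R, c - r < s & (s%:E < l)%E.
  case: l clr {hl} => [l| |] //.
    rewrite -EFinD lte_fin => clr; exists ((l + (c - r)) / 2); first by lra.
    by rewrite lte_fin; lra.
  by move=> _; exists (c - r + 1); [lra | rewrite ltry].
have [t1 t10 H1] := lower_value_lt (lt_le_trans sl hl).
have csr : ((c - s)%:E < lower_value S f x)%E.
  by apply: lt_le_trans hr; rewrite lte_fin; lra.
have [t2 t20 H2] := lower_value_lt csr.
exists (Num.min t1 t2); first by rewrite lt_min t10.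
move=> t /andP[t0]; rewrite lt_min => /andP[tt1 tt2].
have h1 := H1 t; rewrite t0 tt1 in h1; have h2 := H2 t; rewrite t0 tt2 in h2.
by rewrite dilation_add; move: (h1 isT) (h2 isT); lra.
Qed.

Lemma upper_value_add T S x f (l : \bar R) r : (upper_value T f x <= l)%E ->
  (upper_value S f x <= r%:E)%E -> (upper_value (fun g => (T g + S g)%R) f x <= l + r%:E)%E.
Proof.
move=> hl hr; rewrite -leeN2 -lower_valueN.
have -> : (fun g => - (T g + S g)) = (fun g => - T g + - S g).
  by apply/funext => g; rewrite opprD.
rewrite fin_num_oppeD // -EFinN; apply: lower_value_add; rewrite lower_valueN ?EFinN leeN2 //.
Qed.

End Sums.

Lemma gap_add (R : realType) (i j d e s : R) : i - e / 2 < d -> j - e / 2 < s -> i + j - e < d + s.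
Proof. by move=> h1 h2; lra. Qed.

(** * The integral in epsilon form and the addition of densities *)

Section Integral.
Context {R : realType}.
Local Notation mu := (@lebesgue_measure R).
Variables (a b : R).
Hypothesis ab : a < b.
Implicit Types (h k : R -> \bar R) (i c d : R).

Lemma pairs_le k u U v V c d : major_pair a b k u U -> minor_pair a b k v V ->
  point_value U b c -> point_value V b d -> d <= c.
Proof.
move=> [su lU Uu Ua [Eu [Zu [cEu nZu HZu HEu]]]] [sv lV Vv Va [Ev [Zv [cEv nZv HZv HEv]]]] Uc Vd.
have tpsi := @psi_test_class1 R.
have cE := countable_union cEu cEv.
have nZ : mu.-negligible (Zu `|` Zv) by exact: negligibleU.
apply: (pair_le ab su sv lU lV Uu Vv Ua Va Uc Vd cE nZ).
- move=> x xab /not_orP[Zux Zvx]; apply: le_trans (HZv _ _ xab Zvx tpsi.1) _.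
  exact: HZu xab Zux tpsi.1.
- by move=> x xab /not_orP[Eux _]; exact: HEu.
- by move=> x xab /not_orP[_ Evx]; exact: HEv.
Qed.

(** Integrability together with its value, in a form without suprema in the extended reals: pairs
    can be modified one at a time, as the addition of a density requires. *)
Definition has_integral k i := forall e, 0 < e ->
  (exists u U c, [/\ major_pair a b k u U, point_value U b c & c < i + e]) /\
  (exists v V d, [/\ minor_pair a b k v V, point_value V b d & i - e < d]).

Lemma has_integral_inf k i : has_integral k i -> ereal_inf (major_values a b k) = i%:E.
Proof.
move=> H; apply/eqP; rewrite eq_le; apply/andP; split.
  apply/lee_addgt0Pr => e e0; have [[u [U [c [hu Uc ce]]]] _] := H e e0.
  apply: le_trans (_ : c%:E <= _)%E; last by rewrite -EFinD lee_fin ltW.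
  by apply: ereal_inf_lbound; exists c => //; exists u, U.
apply: le_ereal_inf_tmp => _ [c [u [U [hu Uc]] <-]].
apply/lee_subgt0Pr => e e0; have [_ [v [V [d [hv Vd de]]]]] := H e e0.
by rewrite -EFinB lee_fin (le_trans (ltW de)) //; exact: pairs_le hu hv Uc Vd.
Qed.

Lemma has_integral_sup k i : has_integral k i -> ereal_sup (minor_values a b k) = i%:E.
Proof.
move=> H; apply/eqP; rewrite eq_le; apply/andP; split.
  apply: ge_ereal_sup => _ [d [v [V [hv Vd]] <-]].
  apply/lee_addgt0Pr => e e0; have [[u [U [c [hu Uc ce]]]] _] := H e e0.
  by rewrite -EFinD lee_fin (le_trans _ (ltW ce)) //; exact: pairs_le hu hv Uc Vd.
apply/lee_subgt0Pr => e e0; have [_ [v [V [d [hv Vd de]]]]] := H e e0.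
apply: le_trans (_ : _ <= d%:E)%E _; first by rewrite -EFinB lee_fin ltW.
by apply: ereal_sup_ubound; exists d => //; exists v, V.
Qed.

Lemma has_integral_integrable k i : has_integral k i -> dist_integrable a b k.
Proof.
move=> H; have [[u [U [c [hu _ _]]]] [v [V [d [hv _ _]]]]] := H 1 ltr01.
split; [by exists u, U|by exists v, V|].
by rewrite (has_integral_inf H) (has_integral_sup H).
Qed.

Lemma has_integralE k i : has_integral k i -> dist_integral a b k = i%:E.
Proof.
move=> H; rewrite /dist_integral asboolT ?(has_integral_inf H) //.
exact: has_integral_integrable H.
Qed.

Lemma integrable_has_integral k : dist_integrable a b k -> exists i, has_integral k i.
Proof.
move=> [[u [U hu]] [v [V hv]] E].
have [c Uc] : exists c, point_value U b c by case: hu => _ [_ pU] _ _ _; exact: pU.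
have [d Vd] : exists d, point_value V b d by case: hv => _ [_ pV] _ _ _; exact: pV.
have [i iE] : exists i : R, ereal_inf (major_values a b k) = i%:E.
  have h1 : (ereal_inf (major_values a b k) <= c%:E)%E.
    by apply: ereal_inf_lbound; exists c => //; exists u, U.
  have h2 : (d%:E <= ereal_inf (major_values a b k))%E.
    by rewrite -E; apply: ereal_sup_ubound; exists d => //; exists v, V.
  by move: h1 h2; case: ereal_inf => [i| |] //; exists i.
exists i => e e0; split.
  have : (ereal_inf (major_values a b k) < (i + e)%:E)%E by rewrite iE lte_fin ltrDl.
  by move=> /ereal_inf_lt [_ [c' [u' [U' [hu' Uc']]] <-]]; rewrite lte_fin => h; exists u', U', c'.
have : ((i - e)%:E < ereal_sup (minor_values a b k))%E by rewrite E iE lte_fin gtrBl.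
by move=> /ereal_sup_gt [_ [d' [v' [V' [hv' Vd']]] <-]]; rewrite lte_fin => h; exists v', V', d'.
Qed.

(** With the zero function in the role of [h], the results on [h + p] apply to [p] alone; this shows
    that a summand of infinite Lebesgue integral is not distributionally integrable. *)
Lemma has_integral0 : has_integral (cst 0%E) 0.
Proof.
have t0 : Defs.distribution (fun=> 0 : R).
  split; first by move=> c f g _ _; rewrite mulr0 addr0.
  by move=> K _; exists 0, 0%N => f _ _ B _; rewrite normr0 mul0r.
have d0 x t f : dilation (fun=> 0 : R) x t f = 0 by rewrite /dilation mulr0.
have p0 x : point_value (fun=> 0 : R) x 0.
  by move=> f _; rewrite mul0r; under eq_fun do rewrite d0; exact: cvg_cst.
have l0 x f : (0 <= lower_value (fun=> 0%R : R) f x)%E.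
  apply: lower_value_ge => c; rewrite lte_fin => c0; exists 1 => // t _.
  by rewrite d0 ltW.
have u0 x f : (upper_value (fun=> 0%R : R) f x <= 0)%E.
  apply: upper_value_le => c; rewrite lte_fin => c0; exists 1 => // t _.
  by rewrite d0 ltW.
have L0 : lojasiewicz (fun=> 0 : R) by split => // x; exists 0.
have D0 : derivative_of (fun=> 0 : R) (fun=> 0 : R) by move=> f _; rewrite oppr0.
have S0 : supported_distribution a b (fun=> 0 : R) by [].
move=> e e0; split.
  exists (fun=> 0), (fun=> 0), 0; split; [|exact: p0|by rewrite add0r].
  split => //; exists set0, set0; split => //; first exact: negligible_set0.
  by move=> x f _ _ _; apply: lt_le_trans (l0 x f); rewrite ltNyr.
exists (fun=> 0), (fun=> 0), 0; split; [|exact: p0|by rewrite sub0r oppr_lt0].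
split => //; exists set0, set0; split => //; first exact: negligible_set0.
by move=> x f _ _ _; apply: le_lt_trans (u0 x f) _; rewrite ltry.
Qed.

Lemma negligible_ends : mu.-negligible [set a; b].
Proof.
have H (x : R) : mu.-negligible [set x].
  by exists [set x]; split => //; exact: lebesgue_measure_set1.
exact: negligibleU.
Qed.

(** A nonnegative density keeps the lower values above [-oo] off the same countable set. The null
    set grows by the points where [k] differs from [h + p], the non-Lebesgue points and the end
    points, where every window leaves [[a, b]]. *)
Lemma major_add h k (p : R -> R) u U c : measurable_fun setT p -> (forall x, 0 <= p x) ->
  mu.-integrable `[a, b] (EFin \o p) ->
  {ae mu, forall x, x \in `[a, b] -> k x = (h x + (p x)%:E)%E} ->
  major_pair a b h u U -> point_value U b c ->
  exists u' U', major_pair a b k u' U' /\ point_value U' b (c + \int[mu]_(x in `[a, b]) p x).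
Proof.
move=> mp p0 ip [N [mN N0 HN]] [su lU Uu Ua [E [Z [cE nZ HZ HE]]]] Uc.
have nN : mu.-negligible N by exists N; split.
have [Y nY HY] := ae_lebesgue_pt ip.
exists (fun f => u f + density a b p f), (fun f => U f + density_primitive a b p f); split; last first.
  apply: point_value_add => //; rewrite -[\int[mu]_(x in `[a, b]) p x]/(total_mass a b p).
  rewrite -(cumulative_right a b mp); exact: density_primitive_point_value.
split.
- by apply: supported_add => //; exact: density_supported.
- by apply: lojasiewicz_add => //; exact: density_primitive_lojasiewicz.
- by apply: derivative_add => //; exact: density_primitive_derivative.
- rewrite -[0]addr0 -{2}(cumulative_left a b p); apply: point_value_add => //.
  exact: density_primitive_point_value.
exists E, (Z `|` N `|` Y `|` [set a; b]); split => //.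
- apply: negligibleU; last exact: negligible_ends.
  by apply: negligibleU => //; apply: negligibleU.
- move=> x f xab /not_orP[/not_orP[/not_orP[Zx Nx] Yx] abx] tf.
  have -> : k x = (h x + (p x)%:E)%E by apply: contrapT => kx; apply: Nx; apply: HN => /= /(_ xab).
  apply: lower_value_add; first exact: HZ.
  apply: density_lower => //; last exact: HY.
  move: xab; rewrite in_itv /= => /andP[ax xb]; rewrite !lt_neqAle ax xb !andbT.
  by apply/andP; split; apply/eqP => xE; apply: abx; rewrite xE; [left|right].
- move=> x f xab Ex tf; have hu := HE x f xab Ex tf.
  apply: (lt_le_trans hu); rewrite -[leLHS]adde0; apply: lower_value_add => //.
  apply: lower_value_ge => e; rewrite lte_fin => e0; exists 1 => // t /andP[t0 _].
  have [[_ f0 _ _] _] := tf.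
  by apply: (le_trans (ltW e0)); exact: density_dilation_ge0.
Qed.

(** Boundedness of [q] keeps the upper values below [+oo] off the same countable set, at the price
    of adding only a part of [p]. *)
Lemma minor_add h k (p q : R -> R) (N : R) v V d : measurable_fun setT q ->
  (forall x, 0 <= q x <= N) -> (forall x, q x <= p x) ->
  {ae mu, forall x, x \in `[a, b] -> k x = (h x + (p x)%:E)%E} ->
  minor_pair a b h v V -> point_value V b d ->
  exists v' V', minor_pair a b k v' V' /\ point_value V' b (d + \int[mu]_(x in `[a, b]) q x).
Proof.
move=> mq q0 qp [M [mM M0 HM]] [sv lV Vv Va [E [Z [cE nZ HZ HE]]]] Vd.
have mD : measurable (`[a, b]%classic : set (measurableTypeR R)) by [].
have icst : mu.-integrable `[a, b] (EFin \o (fun=> N)).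
  exact: (cint_integrable a b (@cst_continuous _ _ N)).
have N0 : 0 <= N by have /andP[] := q0 0; exact: le_trans.
have q00 x : 0 <= q x by case/andP: (q0 x).
have iq := bounded_integrable a b mq q0.
have ir : mu.-integrable `[a, b] (EFin \o (fun y => N - q y)).
  by have := integrableB mD icst iq; apply: eq_integrable.
have nM : mu.-negligible M by exists M; split.
have [Y nY HY] := ae_lebesgue_pt ir.
exists (fun f => v f + density a b q f), (fun f => V f + density_primitive a b q f); split; last first.
  apply: point_value_add => //; rewrite -[\int[mu]_(x in `[a, b]) q x]/(total_mass a b q).
  rewrite -(cumulative_right a b mq); exact: density_primitive_point_value.
split.
- by apply: supported_add => //; exact: density_supported.
- by apply: lojasiewicz_add => //; exact: density_primitive_lojasiewicz.
- by apply: derivative_add => //; exact: density_primitive_derivative.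
- rewrite -[0]addr0 -{2}(cumulative_left a b q); apply: point_value_add => //.
  exact: density_primitive_point_value.
exists E, (Z `|` M `|` Y `|` [set a; b]); split => //.
- apply: negligibleU; last exact: negligible_ends.
  by apply: negligibleU => //; apply: negligibleU.
- move=> x f xab /not_orP[/not_orP[/not_orP[Zx Mx] Yx] abx] tf.
  have -> : k x = (h x + (p x)%:E)%E by apply: contrapT => kx; apply: Mx; apply: HM => /= /(_ xab).
  apply: le_trans (_ : _ <= h x + (q x)%:E)%E _; last by rewrite leeD2l // lee_fin.
  apply: upper_value_add; first exact: HZ.
  apply: (@density_upper _ _ _ _ N) => //; last exact: HY.
  move: xab; rewrite in_itv /= => /andP[ax xb]; rewrite !lt_neqAle ax xb !andbT.
  by apply/andP; split; apply/eqP => xE; apply: abx; rewrite xE; [left|right].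
- move=> x f xab Ex tf; have hv := HE x f xab Ex tf.
  apply: (@le_lt_trans _ _ (upper_value v f x + N%:E)%E); last by rewrite lte_add_pinfty // ltry.
  apply: upper_value_add => //.
  apply: upper_value_le => e; rewrite lte_fin => Ne; exists 1 => // t /andP[t0 _].
  apply: le_trans (ltW Ne); apply: density_dilation_le => //; first exact: tf.1.
  by move=> y; case/andP: (q0 y).
Qed.

(** Major pairs receive all of [p]; minor pairs receive the truncation of [p] at a level [n], whose
    integral approaches that of [p] by dominated convergence. *)
Lemma has_integral_add h k (p : R -> R) i : measurable_fun setT p -> (forall x, 0 <= p x) ->
  mu.-integrable `[a, b] (EFin \o p) ->
  {ae mu, forall x, x \in `[a, b] -> k x = (h x + (p x)%:E)%E} ->
  has_integral h i -> has_integral k (i + \int[mu]_(x in `[a, b]) p x).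
Proof.
move=> mp p0 ip hk H e e0; split.
  have [[u [U [c [hu Uc ce]]]] _] := H e e0.
  have [u' [U' [hu' Uc']]] := major_add mp p0 ip hk hu Uc.
  by exists u', U', (c + \int[mu]_(x in `[a, b]) p x); split => //; lra.
have e20 : 0 < e / 2 by rewrite divr_gt0.
have [_ [v [V [d [hv Vd de]]]]] := H _ e20.
pose q (n : nat) x := Num.min (p x) n%:R.
have mD : measurable (`[a, b]%classic : set (measurableTypeR R)) by [].
have mq n : measurable_fun setT (q n) by apply: measurable_minr.
have q0 n x : 0 <= q n x <= n%:R by rewrite /q le_min p0 ler0n /= ge_min lexx orbT.
have qp n x : q n x <= p x by rewrite /q ge_min lexx.
have [n Hn] : exists n, \int[mu]_(x in `[a, b]) p x - e / 2 < \int[mu]_(x in `[a, b]) q n x.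
  have mqE n : measurable_fun `[a, b] (EFin \o q n).
    by apply/measurable_EFinP; exact: measurable_funS (mq n).
  have mpE : measurable_fun `[a, b] (EFin \o p).
    by apply/measurable_EFinP; exact: measurable_funS mp.
  have cq x : `[a, b]%classic x -> (EFin \o q n) x @[n --> \oo] --> (EFin \o p) x.
    move=> _; apply: cvg_near_cst; exists (Num.truncn (p x)).+1 => // n /= Hn.
    rewrite /q min_l //; apply: ltW; apply: (lt_le_trans (truncnS_gt _)).
    by rewrite ler_nat.
  have bq : {ae mu, forall x n, `[a, b]%classic x -> (`|(EFin \o q n) x| <= (EFin \o p) x)%E}.
    by apply: aeW => x n _; rewrite /= lee_fin ger0_norm //; case/andP: (q0 n x).
  have aecq : {ae mu, forall x, `[a, b]%classic x -> (EFin \o q n) x @[n --> \oo] --> (EFin \o p) x}.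
    by apply: aeW => x; exact: cq.
  have [_ _ H2] := @dominated_convergence _ _ _ mu _ mD (fun n => EFin \o q n) (EFin \o p) (EFin \o p)
    mqE mpE aecq ip bq.
  have : \int[mu]_(x in `[a, b]) q n x @[n --> \oo] --> \int[mu]_(x in `[a, b]) p x.
    by apply: fine_cvg; rewrite fineK; [exact: H2|exact: integrable_fin_num].
  move=> /cvgrPdist_lt /(_ _ e20) [n _ /(_ n (leqnn n)) Hn]; exists n.
  by have := le_lt_trans (ler_norm _) Hn; lra.
have [v' [V' [hv' Vd']]] := minor_add (mq n) (q0 n) (qp n) hk hv Vd.
exists v', V', (d + \int[mu]_(x in `[a, b]) q n x); split => //.
exact: gap_add de Hn.
Qed.

End Integral.

(** * Borel representatives *)

Section Representative.
Context {R : realType}.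
Local Notation mu := (@lebesgue_measure R).
Variables (a b : R).
Hypothesis ab : a < b.
Implicit Types (h k p : R -> \bar R) (i c d : R).

Let mD : measurable (`[a, b]%classic : set (measurableTypeR R)).
Proof. by []. Qed.

Lemma ae_not (Z : set R) : mu.-negligible Z -> {ae mu, forall x, ~ Z x}.
Proof. by apply: negligibleS => x /= /contrapT. Qed.

Lemma aeS (P Q : R -> Prop) : {ae mu, forall x, P x} -> (forall x, P x -> Q x) ->
  {ae mu, forall x, Q x}.
Proof. by move=> h1 H; apply: (negligibleS _ h1) => x /= Qx Px; exact/Qx/H. Qed.

Lemma aeS2 (P Q S : R -> Prop) : {ae mu, forall x, P x} -> {ae mu, forall x, Q x} ->
  (forall x, P x -> Q x -> S x) -> {ae mu, forall x, S x}.
Proof.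
move=> h1 h2 H; apply: (negligibleS _ (negligibleU h1 h2)) => x /= Sx.
by apply/not_andP => -[Px Qx]; exact/Sx/H.
Qed.

Lemma countable_negligible (E : set R) : countable E -> mu.-negligible E.
Proof.
move=> cE; exists E; split => //; first exact: countable_measurable.
exact: countable_lebesgue_measure0.
Qed.

(** If [h] were infinite, [A] would be [+oo] or [B] would be [-oo], and the differences [p - q]
    could exceed the finite [M]. *)
Lemma pinching_finite (h A B M : \bar R) : (-oo < A)%E -> (B < +oo)%E -> (h <= A)%E -> (B <= h)%E ->
  (forall p q : R, (p%:E < A)%E -> (B < q%:E)%E -> ((p - q)%:E <= M)%E) ->
  (0 <= M)%E -> (M < +oo)%E -> h \is a fin_num /\ (A <= h + M)%E.
Proof.
move=> A1 B1 hA Bh H M0 M1.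
have [m Mm] : exists m : R, M = m%:E by case: M M0 M1 {H} => // m _ _; exists m.
rewrite {}Mm lee_fin in H M0 M1 *.
have [p pA] : exists p : R, (p%:E < A)%E.
  by case: A A1 {hA H} => // [r|] _; [exists (r - 1); rewrite lte_fin; lra | exists 0; rewrite ltry].
have [q Bq] : exists q : R, (B < q%:E)%E.
  by case: B B1 {Bh H} => // [r|] _; [exists (r + 1); rewrite lte_fin; lra | exists 0; rewrite ltNyr].
case: h hA Bh => [r| |] hA Bh.
- split=> //; rewrite leNgt; apply/negP => rA.
  have [s rs sA] : exists2 s : R, r + m < s & (s%:E < A)%E.
    case: A rA {A1 hA H pA} => [z| |] //; last by move=> _; exists (r + m + 1); rewrite ?ltry //; lra.
    by rewrite -EFinD lte_fin => rz; exists ((r + m + z) / 2); rewrite ?lte_fin; lra.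
  have Br : (B < (r + (s - r - m) / 2)%:E)%E by apply: le_lt_trans Bh _; rewrite lte_fin; lra.
  by have := H _ _ sA Br; rewrite lee_fin; lra.
- have sA : ((q + m + 1)%:E < A)%E by apply: lt_le_trans hA; rewrite ltry.
  by exfalso; have := H _ _ sA Bq; rewrite lee_fin; lra.
- have Bs : (B < (p - m - 1)%:E)%E by apply: le_lt_trans Bh _; rewrite ltNyr.
  by exfalso; have := H _ _ pA Bs; rewrite lee_fin; lra.
Qed.

(** If [p] exceeded [M], a real just below [r + p] and a real just above [r] would be admissible and
    differ by more than [M]. *)
Lemma increment_le (r : R) (p A B M : \bar R) : (r%:E + p <= A)%E -> (B <= r%:E)%E ->
  (forall s t : R, (s%:E < A)%E -> (B < t%:E)%E -> ((s - t)%:E <= M)%E) -> (0 <= M)%E -> (p <= M)%E.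
Proof.
move=> pA Br H M0; rewrite leNgt; apply/negP => Mp.
have [m Mm] : exists m : R, M = m%:E by case: M M0 Mp {H} => // [m|] _; [exists m | rewrite ltNge leey].
rewrite {}Mm in H M0 Mp.
have [s ms sp] : exists2 s : R, m < s & (s%:E < p)%E.
  case: p Mp {pA} => [q| |] //; last by move=> _; exists (m + 1); rewrite ?ltry //; lra.
  by rewrite lte_fin => mq; exists ((m + q) / 2); rewrite ?lte_fin; lra.
have rsA : ((r + s)%:E < A)%E by apply: lt_le_trans pA; rewrite EFinD lteD2lE.
have Bt : (B < (r + (s - m) / 2)%:E)%E by apply: le_lt_trans Br _; rewrite lte_fin; lra.
by have := H _ _ rsA Bt; rewrite lee_fin; lra.
Qed.

(** Nothing is known about the measurability of [h], but limits inferior of dilations along a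
    sequence of scales are Borel; they enclose [h] up to a function [M] of small integral. *)
Lemma sandwich h i e : has_integral a b h i -> 0 < e -> exists A M : R -> \bar R,
  [/\ measurable_fun `[a, b] A, measurable_fun `[a, b] M,
      forall x, x \in `[a, b] -> (0 <= M x)%E,
      (\int[mu]_(x in `[a, b]) M x <= e%:E)%E &
      {ae mu, forall x, x \in `[a, b] -> (h x <= A x)%E /\
        ((M x < +oo)%E -> h x \is a fin_num /\ (A x <= h x + M x)%E)}].
Proof.
move=> H e0; have e20 : 0 < e / 2 by rewrite divr_gt0.
have [[u [U [c [hu Uc ce]]]] [v [V [d [hv Vd de]]]]] := H _ e20.
have [su lU Uu Ua [Eu [Zu [cEu nZu HZu HEu]]]] := hu.
have [sv lV Vv Va [Ev [Zv [cEv nZv HZv HEv]]]] := hv.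
have tpsi := @psi_test_class1 R.
have cE := countable_union cEu cEv.
have nZ : mu.-negligible (Zu `|` Zv) by exact: negligibleU.
have uvZ x : x \in `[a, b] -> ~ (Zu `|` Zv) x -> (upper_value v psi x <= lower_value u psi x)%E.
  move=> xab /not_orP[Zux Zvx]; apply: le_trans (HZv _ _ xab Zvx tpsi.1) _.
  exact: HZu xab Zux tpsi.1.
have uE x : x \in `[a, b] -> ~ (Eu `|` Ev) x -> (-oo < lower_value u psi x)%E.
  by move=> xab /not_orP[Eux _]; exact: HEu.
have vE x : x \in `[a, b] -> ~ (Eu `|` Ev) x -> (upper_value v psi x < +oo)%E.
  by move=> xab /not_orP[_ Evx]; exact: HEv.
have [A [B [M [mA mM ABM pq iM]]]] :=
  pair_comparison ab su sv lU lV Uu Vv Ua Va Uc Vd cE nZ uvZ uE vE.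
exists A, M; split => //.
- by move=> x /ABM [].
- by apply: le_trans iM _; rewrite lee_fin; lra.
apply: (aeS2 (ae_not nZ) (ae_not (countable_negligible cE))) => x /not_orP[Zux Zvx] Ex xab.
have [M0 uA Bv] := ABM x xab.
have hA : (h x <= A x)%E := le_trans (HZu _ _ xab Zux tpsi.1) uA.
have Bh : (B x <= h x)%E := le_trans Bv (HZv _ _ xab Zvx tpsi.1).
split=> // M1; apply: (@pinching_finite _ _ (B x)) => //.
- exact: lt_le_trans (uE x xab Ex) uA.
- exact: le_lt_trans Bv (vE x xab Ex).
- by move=> p q; exact: pq.
Qed.

(* [h] is the infimum of the upper functions [A n] wherever [liminf M n = 0], that is,
   almost everywhere. *)
Lemma integrable_representative h i : has_integral a b h i ->
  exists2 h' : R -> R, measurable_fun setT h' &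
    {ae mu, forall x, x \in `[a, b] -> h x = (h' x)%:E}.
Proof.
move=> H; have H1 n : 0 < n.+1%:R^-1 :> R by [].
pose A n := projT1 (cid (sandwich H (H1 n))).
pose M n := projT1 (cid (projT2 (cid (sandwich H (H1 n))))).
have AM n : [/\ measurable_fun `[a, b] (A n), measurable_fun `[a, b] (M n),
      forall x, x \in `[a, b] -> (0 <= M n x)%E,
      (\int[mu]_(x in `[a, b]) M n x <= (n.+1%:R^-1)%:E)%E &
      {ae mu, forall x, x \in `[a, b] -> (h x <= A n x)%E /\
        ((M n x < +oo)%E -> h x \is a fin_num /\ (A n x <= h x + M n x)%E)}].
  exact: (projT2 (cid (projT2 (cid (sandwich H (H1 n)))))).
have mA n : measurable_fun `[a, b] (A n) by have [] := AM n.
have mM n : measurable_fun `[a, b] (M n) by have [] := AM n.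
have M0 n x : `[a, b]%classic x -> (0 <= M n x)%E by have [_ _ H2 _ _] := AM n; exact: H2.
have aeAM : {ae mu, forall x, forall n, x \in `[a, b] -> (h x <= A n x)%E /\
        ((M n x < +oo)%E -> h x \is a fin_num /\ (A n x <= h x + M n x)%E)}.
  by apply: ae_foralln => n; have [] := AM n.
pose m x := limn_einf (M ^~ x).
have mm : measurable_fun `[a, b] m.
  rewrite /m /limn_einf; apply: measurableT_comp => //.
  by apply: measurable_fun_limn_esup => n; apply: measurableT_comp.
have m0 x : `[a, b]%classic x -> (0 <= m x)%E.
  by move=> xab; apply: limn_einf_ge => c c0; apply: nearW => n; rewrite (le_trans (ltW c0)) // M0.
(* Fatou's lemma once more: the integral of [M n] is at most [n.+1%:R^-1]. *)
have im : (\int[mu]_(x in `[a, b]) m x = 0)%E.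
  apply/eqP; rewrite eq_le integral_ge0 // andbT.
  apply: (le_trans (fatou mu mD mM M0)).
  have c0 : (n.+1%:R^-1 : R)%:E @[n --> \oo] --> 0%E.
    by apply: cvg_EFin; [exact: nearW | exact: cvg_harmonic].
  rewrite -(cvg_limn_einf_sup c0).1.
  apply: limn_einf_ge => c /limn_einf_lt; apply: filterS => n /ltW cn.
  by apply: le_trans cn _; have [_ _ _] := AM n.
have aem : {ae mu, forall x, `[a, b]%classic x -> m x = 0%E}.
  apply: (ae_eq_integral_abs mu mD mm).1; rewrite -[RHS]im; apply: eq_integral => x xab.
  by rewrite gee0_abs // m0 //; rewrite inE in xab.
(* At index 0 [einfs] is the infimum over all [n]. *)
pose Ab x := einfs (A ^~ x) 0%N.
have mAb : measurable_fun `[a, b] Ab by exact: measurable_fun_einfs.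
exists (fun x => fine ((Ab \_ `[a, b]%classic) x)).
  apply: (measurableT_comp (fine_measurable measurableT)).
  exact: (measurable_restrictT Ab mD).1.
apply: (aeS2 aeAM aem) => x AMx mx xab; have {}mx := mx xab.
have small e : 0 < e -> exists n, (M n x < e%:E)%E.
  move=> e0; apply: contrapT => /forallNP He.
  have : (e%:E <= m x)%E.
    apply: limn_einf_ge => c ce; apply: nearW => n; rewrite (le_trans (ltW ce)) // leNgt.
    exact/negP/He.
  by rewrite mx lee_fin leNgt e0.
have [n0 Mn0] := small 1 ltr01.
have [_ /(_ (lt_trans Mn0 (ltry _))) [hf _]] := AMx n0 xab.
rewrite patchE ifT ?inE //; suff -> : Ab x = h x by rewrite fineK.
apply/eqP; rewrite eq_le; apply/andP; split; last first.
  by apply: le_ereal_inf_tmp => _ [n _ <-]; case: (AMx n xab).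
apply/lee_addgt0Pr => e e0; have [n Mn] := small e e0.
have [_ /(_ (lt_trans Mn (ltry _))) [_ hM]] := AMx n xab.
apply: (@le_trans _ _ (A n x)); first by apply: ereal_inf_lbound; exists n.
by apply: (le_trans hM); rewrite leeD2l // ltW.
Qed.

(** A major pair of [k] is played against a minor pair of [h]: the limits inferior for [u - v]
    dominate [p] almost everywhere, so their Fatou bound [c - d] also bounds the integral of [p]. *)
Lemma integrable_increment h k (h' : R -> R) p i : has_integral a b h i -> dist_integrable a b k ->
  {ae mu, forall x, x \in `[a, b] -> h x = (h' x)%:E} ->
  measurable_fun `[a, b] p -> (forall x, 0 <= p x)%E ->
  {ae mu, forall x, x \in `[a, b] -> k x = ((h' x)%:E + p x)%E} ->
  (\int[mu]_(x in `[a, b]) p x < +oo)%E.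
Proof.
move=> Hh Hk hh' mp p0 kp.
have [[u [U hu]] _ _] := Hk.
have [_ [v [V [d [hv Vd _]]]]] := Hh 1 ltr01.
have [su lU Uu Ua [Eu [Zu [cEu nZu HZu HEu]]]] := hu.
have [sv lV Vv Va [Ev [Zv [cEv nZv HZv HEv]]]] := hv.
have [c Uc] : exists c, point_value U b c by case: lU.
have tpsi := @psi_test_class1 R.
have cE := countable_union cEu cEv.
have [N [mN N0 HN]] := hh'; have [N' [mN' N'0 HN']] := kp.
have nN : mu.-negligible N by exists N; split.
have nN' : mu.-negligible N' by exists N'; split.
have nZ : mu.-negligible ((Zu `|` Zv) `|` (N `|` N')).
  by apply: negligibleU; exact: negligibleU.
have hN x : x \in `[a, b] -> ~ N x -> h x = (h' x)%:E.
  by move=> xab Nx; apply: contrapT => hx; apply: Nx; apply: HN => /= /(_ xab).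
have kN x : x \in `[a, b] -> ~ N' x -> k x = ((h' x)%:E + p x)%E.
  by move=> xab Nx; apply: contrapT => hx; apply: Nx; apply: HN' => /= /(_ xab).
have uvZ x : x \in `[a, b] -> ~ ((Zu `|` Zv) `|` (N `|` N')) x ->
    (upper_value v psi x <= lower_value u psi x)%E.
  move=> xab /not_orP[/not_orP[Zux Zvx] /not_orP[Nx N'x]].
  apply: le_trans (HZv _ _ xab Zvx tpsi.1) _; apply: le_trans (HZu _ _ xab Zux tpsi.1).
  by rewrite hN // kN // leeDl.
have uE x : x \in `[a, b] -> ~ (Eu `|` Ev) x -> (-oo < lower_value u psi x)%E.
  by move=> xab /not_orP[Eux _]; exact: HEu.
have vE x : x \in `[a, b] -> ~ (Eu `|` Ev) x -> (upper_value v psi x < +oo)%E.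
  by move=> xab /not_orP[_ Evx]; exact: HEv.
have [A [B [M [mA mM ABM pq iM]]]] :=
  pair_comparison ab su sv lU lV Uu Vv Ua Va Uc Vd cE nZ uvZ uE vE.
apply: (@le_lt_trans _ _ (c - d)%:E); last by rewrite ltry.
apply: le_trans iM; apply: ae_ge0_le_integral => //.
  by move=> x xab; have [] := ABM x xab.
apply: (aeS (ae_not nZ)) => x /not_orP[/not_orP[Zux Zvx] /not_orP[Nx N'x]] xab.
have [M0 uA Bv] := ABM x xab.
have kA : (k x <= A x)%E := le_trans (HZu _ _ xab Zux tpsi.1) uA.
have Bh : (B x <= h x)%E := le_trans Bv (HZv _ _ xab Zvx tpsi.1).
rewrite kN // in kA; rewrite hN // in Bh; exact: increment_le kA Bh (pq x) M0.
Qed.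

End Representative.

Lemma unpickle_surj (T : countType) (x : T) : exists n, unpickle n = Some x.
Proof. by exists (pickle x); exact: pickleK. Qed.

(** * Borel representatives of Lebesgue measurable functions *)

Section Completion.
Context {R : realType}.
Local Notation mu := (@lebesgue_measure R).
Variables (a b : R).

Let mD : measurable (`[a, b]%classic : set (measurableTypeR R)).
Proof. by []. Qed.

Lemma completed_measurable (A : set R) : measurable (A : set (measurableTypeR R)) ->
  @measurable _ (g_sigma_algebraType (completed_algebra_gen mu)) A.
Proof.
move=> mA; apply: sub_sigma_algebra; exists A => //; exists set0; first exact: negligible_set0.
by rewrite setU0.
Qed.

Lemma borel_lebesgue_measurable (D : set R) (f : R -> \bar R) :
  measurable (D : set (measurableTypeR R)) -> measurable_fun D f -> lebesgue_measurable_fun D f.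
Proof. by move=> mD' mf _ Y mY; apply: completed_measurable; exact: mf. Qed.

(** Each set where [f] exceeds a rational [q] is a Borel set [A q] up to a null set; [f] is
    recovered almost everywhere as the supremum of the rationals [q] with [x] in [A q]. Countably
    many null sets are discarded. *)
Lemma borel_representative (f : R -> \bar R) : lebesgue_measurable_fun `[a, b] f ->
  exists2 f' : R -> \bar R, measurable_fun setT f' &
    {ae mu, forall x, x \in `[a, b] -> f x = f' x}.
Proof.
move=> mf.
have sublevel (q : rat) : exists A N : set R, [/\ measurable (A : set (measurableTypeR R)),
    mu.-negligible N & `[a, b]%classic `&` f @^-1` `](ratr q)%:E, +oo%E]%classic = A `|` N].
  have : @measurable _ (g_sigma_algebraType (completed_algebra_gen mu))
      (`[a, b]%classic `&` f @^-1` `](ratr q)%:E, +oo%E]%classic).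
    by apply: mf; [exact: completed_measurable | exact: emeasurable_itv].
  rewrite g_sigma_completed_algebra_genE => -[A mA [N nN AN]].
  by exists A, N.
pose A q := projT1 (cid (sublevel q)).
pose N q := projT1 (cid (projT2 (cid (sublevel q)))).
have AN q : [/\ measurable (A q : set (measurableTypeR R)), mu.-negligible (N q) &
    `[a, b]%classic `&` f @^-1` `](ratr q)%:E, +oo%E]%classic = A q `|` N q].
  exact: (projT2 (cid (projT2 (cid (sublevel q))))).
(* [unpickle] enumerates the rationals; the default [-oo] is neutral for the supremum. *)
pose s (n : nat) (x : R) : \bar R :=
  if unpickle n is Some q then if x \in A q then (ratr q)%:E else -oo%E else -oo%E.
have ms n : measurable_fun setT (s n).
  rewrite /s; case: (unpickle n) => [q|]; last exact: measurable_cst.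
  apply: measurable_fun_ifT; [|exact: measurable_cst|exact: measurable_cst].
  apply: (measurable_fun_bool true); rewrite setTI (_ : _ @^-1` _ = A q); first by have [] := AN q.
  by apply/seteqP; split=> x /=; [exact: set_mem | exact: mem_set].
exists (fun x => esups (s ^~ x) 0%N); first exact: measurable_fun_esups.
pose N' n := if unpickle n is Some q then N q else set0.
have nN' : mu.-negligible (\bigcup_n N' n).
  apply: negligible_bigcup => n; rewrite /N'; case: (unpickle n) => [q|]; last exact: negligible_set0.
  by have [] := AN q.
apply: (aeS (ae_not nN')) => x Nx xab.
have Aq q : x \in A q = ((ratr q)%:E < f x)%E.
  have [_ _ /seteqP[H1 H2]] := AN q.
  have nNq : ~ N q x.
    by have [n qn] := unpickle_surj q; move=> Nq; apply: Nx; exists n; rewrite // /N' qn.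
  apply/idP/idP => [|qf].
    by rewrite inE => Aqx; have [_] := H2 x (or_introl Aqx); rewrite /= in_itv /= leey andbT.
  have : (`[a, b]%classic `&` f @^-1` `](ratr q)%:E, +oo%E]%classic) x.
    by split; [exact: xab | rewrite /= in_itv /= leey andbT].
  by move=> /H1 [|//]; rewrite inE.
apply/eqP; rewrite eq_le; apply/andP; split.
  have H (r : R) : (r%:E < f x)%E -> (r%:E <= esups (s ^~ x) 0%N)%E.
    move=> rf; have [q rq qf] : exists2 q : rat, r < ratr q & ((ratr q)%:E < f x)%E.
      case: (f x) rf => [y| |] //.
        by rewrite lte_fin => /rat_in_itvoo [q]; rewrite in_itv /= => /andP[h1 h2]; exists q; rewrite ?lte_fin.
      have /rat_in_itvoo [q] : r < r + 1 by rewrite ltrDl.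
      by rewrite in_itv /= => /andP[h1 _] _; exists q => //; rewrite ltry.
    apply: (@le_trans _ _ (ratr q)%:E); first by rewrite lee_fin ltW.
    have [n qn] := unpickle_surj q; apply: ereal_sup_ubound; exists n; first by [].
    by rewrite /s qn Aq qf.
  case: (f x) H => [y| |] H; last by rewrite leNye.
    by apply/lee_subgt0Pr => e e0; rewrite -EFinB; apply: H; rewrite lte_fin gtrBl.
  by rewrite leye_eq; apply/eqP/eqyP => r r0; apply: H; rewrite ltry.
apply: ge_ereal_sup => _ [n _ <-]; rewrite /s; case: (unpickle n) => [q|]; last by rewrite leNye.
by case: ifPn => [|_]; [rewrite Aq => /ltW | rewrite leNye].
Qed.

End Completion.

(** * Adding a nonnegative extended-valued function *)

Section Increments.
Context {R : realType}.
Local Notation mu := (@lebesgue_measure R).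
Variables (a b : R).
Hypothesis ab : a < b.
Variables (h : R -> \bar R) (h' : R -> R) (i : R).
Hypothesis Hh : has_integral a b h i.
Hypothesis hh' : {ae mu, forall x, x \in `[a, b] -> h x = (h' x)%:E}.

Let mD : measurable (`[a, b]%classic : set (measurableTypeR R)).
Proof. by []. Qed.

Variables (k p : R -> \bar R).
Hypothesis mp : measurable_fun setT p.
Hypothesis p0 : forall x, (0 <= p x)%E.
Hypothesis kp : {ae mu, forall x, x \in `[a, b] -> k x = ((h' x)%:E + p x)%E}.

Let mpD : measurable_fun `[a, b] p.
Proof. exact: measurable_funS mp. Qed.

(** A finite integral makes [p] finite almost everywhere, so the real function [fine (p x)] can
    serve as the density. *)
Lemma has_integral_increment : (\int[mu]_(x in `[a, b]) p x < +oo)%E ->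
  has_integral a b k (i + fine (\int[mu]_(x in `[a, b]) p x)%E).
Proof.
move=> poo; have ip : mu.-integrable `[a, b] p.
  apply/integrableP; split=> //.
  by under eq_integral do rewrite gee0_abs //.
have aef : {ae mu, forall x, x \in `[a, b] -> p x \is a fin_num} := integrable_ae mD ip.
pose r x := fine (p x).
have mr : measurable_fun setT r by apply: (measurableT_comp (fine_measurable measurableT)).
have r0 x : 0 <= r x by rewrite fine_ge0.
have aer : {ae mu, forall x, x \in `[a, b] -> p x = (r x)%:E}.
  by apply: (aeS aef) => x H xab; rewrite /r fineK // H.
have E : (\int[mu]_(x in `[a, b]) p x = \int[mu]_(x in `[a, b]) (r x)%:E)%E.
  apply: ae_eq_integral => //; apply/measurable_EFinP; exact: measurable_funS mr.
have ir : mu.-integrable `[a, b] (EFin \o r).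
  apply/integrableP; split; first by apply/measurable_EFinP; exact: measurable_funS mr.
  rewrite (@eq_integral _ _ _ mu _ (fun x => (r x)%:E)); first by rewrite -E.
  by move=> x _ /=; rewrite ger0_norm.
rewrite E; apply: (has_integral_add ab mr r0 ir _ Hh).
apply: (aeS2 (aeS2 hh' aer (fun x h1 h2 => conj h1 h2)) kp) => x [h1 h2] h3 xab.
by rewrite h3 // h1 // h2.
Qed.

Lemma increment_integrable : dist_integrable a b k <-> (\int[mu]_(x in `[a, b]) p x < +oo)%E.
Proof.
split; first by move=> Hk; exact: (integrable_increment ab Hh Hk hh' mpD p0 kp).
by move=> /has_integral_increment; exact: has_integral_integrable.
Qed.

End Increments.

Section IncrementIntegral.
Context {R : realType}.
Local Notation mu := (@lebesgue_measure R).
Variables (a b : R).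
Hypothesis ab : a < b.
Variables (h : R -> \bar R) (h' : R -> R) (i : R).
Hypothesis Hh : has_integral a b h i.
Hypothesis hh' : {ae mu, forall x, x \in `[a, b] -> h x = (h' x)%:E}.

(** If [p] has infinite integral, [k = h + p] is itself a decomposition of the kind that defines an
    infinite integral, so the formula holds in both cases. *)
Lemma dist_integral_increment (k p : R -> \bar R) : measurable_fun setT p ->
  (forall x, 0 <= p x)%E ->
  {ae mu, forall x, x \in `[a, b] -> k x = ((h' x)%:E + p x)%E} ->
  lebesgue_measurable_fun `[a, b] k ->
  dist_integral a b k = (i%:E + \int[mu]_(x in `[a, b]) p x)%E.
Proof.
move=> mp p0 kp mk.
have mD : measurable (`[a, b]%classic : set (measurableTypeR R)) by [].
have I0 : (0 <= \int[mu]_(x in `[a, b]) p x)%E by exact: integral_ge0.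
have [poo|poo] := ltP (\int[mu]_(x in `[a, b]) p x)%E +oo%E.
  have H := has_integral_increment ab Hh hh' mp p0 kp poo.
  by rewrite (has_integralE ab H) EFinD fineK // ge0_fin_numE.
have nk : ~ dist_integrable a b k.
  by move/(increment_integrable ab Hh hh' mp p0 kp); rewrite ltNge poo.
have E : (\int[mu]_(x in `[a, b]) p x = +oo)%E by apply/eqP; rewrite -leye_eq.
rewrite E addey // /dist_integral asboolF // asboolT //; split => //.
exists h, p; split.
- by apply: (aeS2 hh' kp) => x h1 h2 xab; rewrite h1 // h2.
- exact: has_integral_integrable Hh.
- by apply: aeW => x _.
- by apply: borel_lebesgue_measurable => //; exact: measurable_funS mp.
- have h0 : {ae mu, forall x, x \in `[a, b] -> cst (0%E : \bar R) x = (cst (0%R : R) x)%:E} by apply: aeW.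
  have p00 : {ae mu, forall x, x \in `[a, b] -> p x = ((cst (0%R : R) x)%:E + p x)%E}.
    by apply: aeW => x _; rewrite add0e.
  by move/(increment_integrable ab (has_integral0 a b) h0 mp p0 p00); rewrite ltNge poo.
Qed.

End IncrementIntegral.

(** * Reduction to monotone convergence *)

Section RunningMaximum.
Context {R : realType}.
Implicit Types (f : nat -> R -> \bar R).

(** The increments [g_ n - h] increase in [n] only almost everywhere. Running maxima increase at
    every point and agree with the sequence wherever it already increases, so their limit exists
    everywhere. *)
Fixpoint running_max f n x : \bar R :=
  if n is m.+1 then maxe (running_max f m x) (f n x) else f 0%N x.

Lemma running_max_measurable f : (forall n, measurable_fun setT (f n)) ->
  forall n, measurable_fun setT (running_max f n).
Proof. by move=> mf; elim=> [|n IH]; [exact: mf | apply: measurable_maxe]. Qed.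

Lemma running_max_ge f n x : (f n x <= running_max f n x)%E.
Proof. by case: n => //= n; rewrite le_max lexx orbT. Qed.

Lemma running_max_homo f x : {homo running_max f ^~ x : m n / (m <= n)%N >-> (m <= n)%E}.
Proof. by apply/nondecreasing_seqP => n /=; rewrite le_max lexx. Qed.

Lemma running_max_id f x n : (forall m, (f m x <= f m.+1 x)%E) -> running_max f n x = f n x.
Proof. by move=> H; elim: n => //= n ->; rewrite max_r. Qed.

End RunningMaximum.

Theorem theorem9p4 (R : realType) (a b : R) (ab : a < b)
    (h g : R -> \bar R) (g_ : nat -> R -> \bar R)
    (h_int : dist_integrable a b h)
    (g_meas : forall n, lebesgue_measurable_fun `[a, b] (g_ n))
    (g_mono : forall n, {ae @lebesgue_measure R, forall x, x \in `[a, b] ->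
       (h x <= g_ n x)%E /\ (g_ n x <= g_ n.+1 x)%E})
    (g_lim : {ae @lebesgue_measure R, forall x, x \in `[a, b] ->
       g_ n x @[n --> \oo] --> g x}) :
  (dist_integrable a b g <->
     cvgn (fun n => dist_integral a b (g_ n)) /\
     (limn (fun n => dist_integral a b (g_ n)) < +oo)%E) /\
  (dist_integrable a b g ->
     dist_integral a b (g_ n) @[n --> \oo] --> dist_integral a b g).
Proof.
have mD : measurable (`[a, b]%classic : set (measurableTypeR R)) by [].
have [i Hh] := integrable_has_integral h_int.
have [h' mh' hh'] := integrable_representative ab Hh.
have G n : {f : R -> \bar R | measurable_fun setT f /\
    {ae @lebesgue_measure R, forall x, x \in `[a, b] -> g_ n x = f x}}.
  by apply: cid; have [f mf gf] := borel_representative (g_meas n); exists f.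
(* The maximum with 0 makes the increment nonnegative at every point and changes it only on a null
   set, because [g_ n] is at least [h] almost everywhere; as [h'] is real, the difference is never
   indeterminate. *)
pose q n x := maxe 0%E (projT1 (G n) x - (h' x)%:E)%E.
have mq n : measurable_fun setT (q n).
  apply: measurable_maxe; first exact: measurable_cst.
  apply: emeasurable_funB; first by case: (projT2 (G n)).
  exact/measurable_EFinP.
have q0 n x : (0 <= q n x)%E by rewrite /q le_max lexx.
pose p := running_max q.
have mp := running_max_measurable mq.
have p0 n x : (0 <= p n x)%E := le_trans (q0 n x) (running_max_ge q n x).
have pE : {ae @lebesgue_measure R, forall x, forall n, x \in `[a, b] -> g_ n x = ((h' x)%:E + p n x)%E}.
  have H : {ae @lebesgue_measure R, forall x, forall n, x \in `[a, b] ->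
      [/\ h x = (h' x)%:E, (h x <= g_ n x)%E, (g_ n x <= g_ n.+1 x)%E & g_ n x = projT1 (G n) x]}.
    apply: ae_foralln => n; have [_ Gn] := projT2 (G n).
    apply: (aeS2 (aeS2 hh' (g_mono n) (fun x h1 h2 => conj h1 h2)) Gn) => x [h1 h2] h3 xab.
    by have [h4 h5] := h2 xab; split; [exact: h1 | exact: h4 | exact: h5 | exact: h3].
  apply: (aeS H) => x Hx n xab.
  have qE m : q m x = (g_ m x - (h' x)%:E)%E.
    have [hE hg _ gE] := Hx m xab; rewrite /q -gE max_r // sube_ge0 ?fin_numE //.
    by rewrite -hE.
  rewrite /p running_max_id; first by rewrite qE addeC subeK.
  by move=> m; have [_ _ gm _] := Hx m xab; rewrite !qE; exact: leeD2r.
pose P x := limn (p ^~ x).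
have pP x : p n x @[n --> \oo] --> P x.
  by apply: ereal_nondecreasing_is_cvgn; exact: running_max_homo.
have mP : measurable_fun setT P.
  by apply: (emeasurable_fun_cvg p) => // x _; exact: pP.
have P0 x : (0 <= P x)%E.
  by apply: lime_ge; [exact: pP | apply: nearW => n].
have gP : {ae @lebesgue_measure R, forall x, x \in `[a, b] -> g x = ((h' x)%:E + P x)%E}.
  apply: (aeS2 pE g_lim) => x Hx gx xab.
  have H : ((h' x)%:E + p n x)%E @[n --> \oo] --> ((h' x)%:E + P x)%E.
    by apply: cvgeD; [exact: fin_num_adde_defr | exact: cvg_cst | exact: pP].
  apply: (cvg_unique _ (gx xab)) => //.
  by apply: cvg_trans H; apply: near_eq_cvg; apply: nearW => n; rewrite Hx.
have DE n : dist_integral a b (g_ n) = (i%:E + \int[@lebesgue_measure R]_(x in `[a, b]) p n x)%E.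
  apply: (dist_integral_increment ab Hh hh' (mp n) (p0 n)) => //.
  by apply: (aeS pE) => x Hx; exact: Hx.
have cvgD : dist_integral a b (g_ n) @[n --> \oo] -->
    (i%:E + \int[@lebesgue_measure R]_(x in `[a, b]) P x)%E.
  under eq_fun do rewrite DE; apply: cvgeD; [exact: fin_num_adde_defr | exact: cvg_cst |].
  apply: cvg_monotone_convergence => //.
  - by move=> n; exact: measurable_funS (mp n).
  - by move=> x _; exact: running_max_homo.
have gint := increment_integrable ab Hh hh' mP P0 gP.
split.
  (* Both sides of the equivalence now speak of the integral of [P]: the limit of the integrals is
     [i] plus that integral, and [i] is real. *)
  rewrite gint (cvg_lim _ cvgD) //; split.
    by move=> Poo; split; [exact: cvgD | rewrite lte_add_pinfty // ltry].
  by move=> [_]; rewrite !ltey; apply: contra => /eqP ->; rewrite addey.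
move=> /gint Poo; rewrite (has_integralE ab (has_integral_increment ab Hh hh' mP P0 gP Poo)).
by rewrite EFinD fineK // ge0_fin_numE // integral_ge0.
Qed.
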